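(* Let $\lambda$ be an uncountable cardinal such that ${\rm NPr}_{\omega_1}(\lambda)$ holds, and let $3\leq\iota<\omega$. Then there is a ccc forcing notion $\mathbb{P}$ of size $\lambda$ such that $\mathbb{P}$ forces the following: there is a $\Sigma^0_2$ set $B\subseteq{}^{\omega}2$ which is a $2\iota$-npots-set, and for which there is a sequence $\langle\eta_\alpha:\alpha<\lambda\rangle$ of distinct elements of ${}^{\omega}2$ such that $\big|(\eta_\alpha+B)\cap(\eta_\beta+B)\big|\geq 2\iota$ for all $\alpha,\beta<\lambda$.
   Context: The Cantor space ${}^{\omega}2$ carries the product topology and the group operation $+$ of coordinatewise addition modulo 2. Pointclasses such as $\Sigma^0_2$ are boldface. A set $B\subseteq{}^{\omega}2$ is a $k$-pots-set if there is a perfect set $P\subseteq{}^{\omega}2$ such that $|(B+x)\cap(B+y)|\geq k$ for all $x,y\in P$; it is a $k$-npots-set if it is not a $k$-pots-set. Rank. Let $\mathbb{M}$ be a model with universe a cardinal $\lambda$ and a countable vocabulary $\tau$. For finite non-empty $w=\{a_0,\ldots,a_n\}\subseteq\lambda$ with $|w|=n+1$, define ${\rm rk}(w,\mathbb{M})\geq\alpha$ by induction on ordinals $\alpha$: (a) ${\rm rk}(w,\mathbb{M})\geq 0$ iff for every quantifier free formula $\varphi\in\mathcal{L}(\tau)$ and each $k\leq n$, if $\mathbb{M}\models\varphi[a_0,\ldots,a_k,\ldots,a_n]$ then the set $\{a\in\lambda:\mathbb{M}\models\varphi[a_0,\ldots,a_{k-1},a,a_{k+1},\ldots,a_n]\}$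 is uncountable; (b) for limit $\alpha$, ${\rm rk}(w,\mathbb{M})\geq\alpha$ iff ${\rm rk}(w,\mathbb{M})\geq\beta$ for all $\beta<\alpha$; (c) ${\rm rk}(w,\mathbb{M})\geq\alpha+1$ iff for every quantifier free $\varphi\in\mathcal{L}(\tau)$ and each $k\leq n$, if $\mathbb{M}\models\varphi[a_0,\ldots,a_k,\ldots,a_n]$ then there is $a^*\in\lambda\setminus w$ with ${\rm rk}(w\cup\{a^*\},\mathbb{M})\geq\alpha$ and $\mathbb{M}\models\varphi[a_0,\ldots,a_{k-1},a^*,a_{k+1},\ldots,a_n]$. Set ${\rm rk}(w,\mathbb{M})=-1$ if not ${\rm rk}(w,\mathbb{M})\geq0$; ${\rm rk}(w,\mathbb{M})=\infty$ if ${\rm rk}(w,\mathbb{M})\geq\alpha$ for all ordinals $\alpha$; and ${\rm rk}(w,\mathbb{M})=\alpha$ if ${\rm rk}(w,\mathbb{M})\geq\alpha$ but not ${\rm rk}(w,\mathbb{M})\geq\alpha+1$. ${\rm NPr}_{\varepsilon}(\lambda)$ is the statement: there is a model $\mathbb{M}^*$ with universe $\lambda$ and a countable vocabulary such that $\sup\{{\rm rk}(w,\mathbb{M}^* ):\emptyset\neq w\in[\lambda]^{<\omega}\}<\varepsilon$. *)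

(* Defs.v *)
From Stdlib Require Import Wf_nat PeanoNat.
From mathcomp Require Import all_boot boolp classical_sets functions cardinality.

Set Implicit Arguments.
Unset Strict Implicit.
Unset Printing Implicit Defensive.

Local Open Scope classical_set_scope.
Local Open Scope card_scope.

(* An ordinal is represented by a well-ordered type, whose elements stand for
   the smaller ordinals; a cardinal is an initial ordinal. *)

Record wellorder := WellOrder {
  wo_car :> Type;
  wo_lt : wo_car -> wo_car -> Prop;
  wo_wf : well_founded wo_lt;
  wo_trans : forall a b c, wo_lt a b -> wo_lt b c -> wo_lt a c;
  wo_tri : forall a b, wo_lt a b \/ a = b \/ wo_lt b a }.

Definition is_cardinal (L : wellorder) : Prop :=
  forall a : L, ~ ([set b : L | wo_lt b a] #= [set: L]).

Definition is_omega1 (W : wellorder) : Prop :=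
  ~ countable [set: W] /\ forall a : W, countable [set b : W | wo_lt b a].

Lemma nat_tri (a b : nat) : lt a b \/ a = b \/ lt b a.
Proof. exact: Nat.lt_total. Qed.

Definition omega : wellorder := WellOrder lt_wf Nat.lt_trans nat_tri.

Record vocabulary := Vocabulary {
  fsym : Type;
  farity : fsym -> nat;
  rsym : Type;
  rarity : rsym -> nat }.

Definition countable_vocabulary (tau : vocabulary) : Prop :=
  countable [set: fsym tau] /\ countable [set: rsym tau].

Record model (tau : vocabulary) (U : Type) := Model {
  fint : forall f : fsym tau, ('I_(farity f) -> U) -> U;
  rint : forall r : rsym tau, ('I_(rarity r) -> U) -> Prop }.

Inductive term (tau : vocabulary) (n : nat) : Type :=
| tvar of 'I_n
| tapp (f : fsym tau) of ('I_(farity f) -> term tau n).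

Inductive qf_formula (tau : vocabulary) (n : nat) : Type :=
| qf_eq of term tau n & term tau n
| qf_rel (r : rsym tau) of ('I_(rarity r) -> term tau n)
| qf_not of qf_formula tau n
| qf_and of qf_formula tau n & qf_formula tau n.

Fixpoint eval tau U (M : model tau U) n (a : 'I_n -> U) (t : term tau n) : U :=
  match t with
  | tvar i => a i
  | tapp f ts => fint M (fun i => eval M a (ts i))
  end.

Fixpoint sat tau U (M : model tau U) n (phi : qf_formula tau n)
    (a : 'I_n -> U) : Prop :=
  match phi with
  | qf_eq s t => eval M a s = eval M a t
  | qf_rel r ts => rint M (fun i => eval M a (ts i))
  | qf_not phi1 => ~ sat M phi1 a
  | qf_and phi1 phi2 => sat M phi1 a /\ sat M phi2 a
  end.

Definition replace U n (a : 'I_n -> U) (k : 'I_n) (x : U) : 'I_n -> U :=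
  fun j => if j == k then x else a j.

Definition enumerates U n (a : 'I_n -> U) (w : set U) : Prop :=
  injective a /\ range a = w.

(* [rk_ge0] is rk(w,M) >= 0; if [X] is "rk(-,M) >= alpha" then [rk_geS X] is
   "rk(-,M) >= alpha + 1".  The enumeration of w is quantified universally:
   renaming variables in phi makes its choice immaterial. *)

Definition rk_ge0 tau U (M : model tau U) (w : set U) : Prop :=
  forall n (a : 'I_n.+1 -> U), enumerates a w ->
  forall (phi : qf_formula tau n.+1) (k : 'I_n.+1), sat M phi a ->
  ~ countable [set x | sat M phi (replace a k x)].

Definition rk_geS tau U (M : model tau U) (X : set U -> Prop) (w : set U) : Prop :=
  forall n (a : 'I_n.+1 -> U), enumerates a w ->
  forall (phi : qf_formula tau n.+1) (k : 'I_n.+1), sat M phi a ->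
  exists x : U, [/\ ~ w x, X (w `|` [set x]) & sat M phi (replace a k x)].

Inductive rk_ge tau U (M : model tau U) (W : wellorder) : W -> set U -> Prop :=
| rk_ge_zero (alpha : W) w :
    (forall beta : W, ~ wo_lt beta alpha) ->
    rk_ge0 M w -> rk_ge M alpha w
| rk_ge_succ (alpha beta : W) w :
    wo_lt beta alpha ->
    (forall gamma : W, wo_lt gamma alpha -> gamma = beta \/ wo_lt gamma beta) ->
    rk_geS M (rk_ge M beta) w -> rk_ge M alpha w
| rk_ge_limit (alpha : W) w :
    (exists beta : W, wo_lt beta alpha) ->
    (forall beta : W, wo_lt beta alpha ->
       exists gamma : W, wo_lt beta gamma /\ wo_lt gamma alpha) ->
    (forall beta : W, wo_lt beta alpha -> rk_ge M beta w) -> rk_ge M alpha w.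

Definition rk_minus1 tau U (M : model tau U) (w : set U) : Prop :=
  ~ rk_ge0 M w.

Definition rk_eq tau U (M : model tau U) (W : wellorder) (alpha : W)
    (w : set U) : Prop :=
  rk_ge M alpha w /\ ~ rk_geS M (rk_ge M alpha) w.

Definition rk_le tau U (M : model tau U) (W : wellorder) (delta : W)
    (w : set U) : Prop :=
  rk_minus1 M w \/
  exists alpha : W, (alpha = delta \/ wo_lt alpha delta) /\ rk_eq M alpha w.

(* rk(w,M) <= delta excludes rk(w,M) = infinity; sup < eps means that some
   delta < eps is an upper bound. *)
Definition NPr (eps L : wellorder) : Prop :=
  exists (tau : vocabulary) (M : model tau L),
    countable_vocabulary tau /\
    exists delta : eps, forall w : set L,
      finite_set w -> w !=set0 -> rk_le M delta w.

(* [q <<= p] means that q is the stronger condition. *)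

Record forcing_notion := ForcingNotion {
  cond :> Type;
  stronger : cond -> cond -> Prop;
  stronger_refl : forall p, stronger p p;
  stronger_trans : forall r q p, stronger r q -> stronger q p -> stronger r p;
  weakest : cond;
  weakestP : forall p, stronger p weakest }.

Notation "q <<= p" := (stronger q p) (at level 70, no associativity).

Definition compatible (P : forcing_notion) (p q : P) : Prop :=
  exists r : P, r <<= p /\ r <<= q.

Definition antichain (P : forcing_notion) (A : set P) : Prop :=
  forall p q : P, A p -> A q -> p <> q -> ~ compatible p q.

Definition ccc (P : forcing_notion) : Prop :=
  forall A : set P, antichain A -> countable A.

(* P-names: [Name D x c] is the name {(x i, c i) : i in D}. *)

Inductive name (P : forcing_notion) : Type :=
  Name (D : Type) of (D -> name P) & (D -> P).

Arguments Name {P} D _ _.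

Definition dense_below (P : forcing_notion) (p : P) (D : set P) : Prop :=
  forall q : P, q <<= p -> exists r : P, r <<= q /\ D r.

Fixpoint forces_eq (P : forcing_notion) (a b : name P) (p : P) {struct a} : Prop :=
  match a, b with
  | Name D x c, Name E y d =>
      (forall (i : D) (q : P), q <<= p -> q <<= c i ->
         dense_below q [set r | exists j : E, r <<= d j /\ forces_eq (x i) (y j) r])
      /\
      (forall (j : E) (q : P), q <<= p -> q <<= d j ->
         dense_below q [set r | exists i : D, r <<= c i /\ forces_eq (x i) (y j) r])
  end.

Definition forces_mem (P : forcing_notion) (a b : name P) (p : P) : Prop :=
  match b with
  | Name E y d =>
      dense_below p [set r | exists j : E, r <<= d j /\ forces_eq a (y j) r]
  end.

(* Formulas of the forcing language: first-order formulas in the membership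
   relation with P-names as parameters (the bound variable of the quantifier
   is a Rocq variable). *)

Inductive formula (P : forcing_notion) : Type :=
| Feq of name P & name P
| Fmem of name P & name P
| Fnot of formula P
| Fand of formula P & formula P
| Fall of (name P -> formula P).

Fixpoint forces (P : forcing_notion) (phi : formula P) (p : P) : Prop :=
  match phi with
  | Feq a b => forces_eq a b p
  | Fmem a b => forces_mem a b p
  | Fnot phi1 => forall q : P, q <<= p -> ~ forces phi1 q
  | Fand phi1 phi2 => forces phi1 p /\ forces phi2 p
  | Fall phi1 => forall x : name P, forces (phi1 x) p
  end.

Definition Forces (P : forcing_notion) (phi : formula P) : Prop :=
  forall p : P, forces phi p.

Arguments Forces P phi : clear implicits.

Declare Scope formula_scope.
Delimit Scope formula_scope with F.
Bind Scope formula_scope with formula.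
Local Open Scope formula_scope.

Definition Fimp (P : forcing_notion) (phi psi : formula P) : formula P :=
  Fnot (Fand phi (Fnot psi)).
Definition Fiff (P : forcing_notion) (phi psi : formula P) : formula P :=
  Fand (Fimp phi psi) (Fimp psi phi).
Definition For (P : forcing_notion) (phi psi : formula P) : formula P :=
  Fnot (Fand (Fnot phi) (Fnot psi)).
Definition Fex (P : forcing_notion) (phi : name P -> formula P) : formula P :=
  Fnot (Fall (fun x => Fnot (phi x))).

Notation "x = y" := (Feq x y) : formula_scope.
Notation "x ∈ y" := (Fmem x y) (at level 70, no associativity) : formula_scope.
Notation "~ A" := (Fnot A) : formula_scope.
Notation "A /\ B" := (Fand A B) : formula_scope.
Notation "A \/ B" := (For A B) : formula_scope.
Notation "A -> B" := (Fimp A B) : formula_scope.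
Notation "A <-> B" := (Fiff A B) : formula_scope.
Notation "∀ x , A" := (Fall (fun x => A))
  (at level 200, x name, A at level 200) : formula_scope.
Notation "∃ x , A" := (Fex (fun x => A))
  (at level 200, x name, A at level 200) : formula_scope.
Notation "∀ x ∈ y , A" := (Fall (fun x => Fimp (Fmem x y) A))
  (at level 200, x name, y at level 69, A at level 200) : formula_scope.
Notation "∃ x ∈ y , A" := (Fex (fun x => Fand (Fmem x y) A))
  (at level 200, x name, y at level 69, A at level 200) : formula_scope.

(* The check name of the von Neumann ordinal {b : b < a}; [check P W] is that
   of the order type of W. *)

Definition check_elt (P : forcing_notion) (W : wellorder) : W -> name P :=
  Fix (@wo_wf W) (fun _ => name P)
    (fun (a : W) (rec : forall b : W, wo_lt b a -> name P) =>
       Name {b : W | wo_lt b a}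
         (fun b => rec (proj1_sig b) (proj2_sig b)) (fun _ => weakest P)).

Definition check (P : forcing_notion) (W : wellorder) : name P :=
  Name W (@check_elt P W) (fun _ => weakest P).

Definition nat_name (P : forcing_notion) (n : nat) : name P :=
  @check_elt P omega n.

Definition omega_name (P : forcing_notion) : name P := check P omega.

Section SetTheory.
Variable P : forcing_notion.
Implicit Types (f x y z A B C : name P).

Local Notation "0" := (nat_name P 0) : formula_scope.
Local Notation "1" := (nat_name P 1) : formula_scope.
Local Notation "'ω'" := (omega_name P) : formula_scope.

Definition is_pair z x y : formula P := ∀ t, t ∈ z <-> (t = x \/ t = y).

Definition is_ordered_pair z x y : formula P :=
  ∃ s, ∃ t, is_pair s x x /\ is_pair t x y /\ is_pair z s t.

(* f(x) = y, for a function f *)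
Definition app f x y : formula P := ∃ z, is_ordered_pair z x y /\ z ∈ f.

Definition function_on f A : formula P :=
  (∀ z ∈ f, ∃ x ∈ A, ∃ y, is_ordered_pair z x y) /\
  (∀ x ∈ A, ∃ y, app f x y /\ (∀ y', app f x y' -> y' = y)).

Definition maps_into f A (S : name P -> formula P) : formula P :=
  function_on f A /\ (∀ x ∈ A, ∀ y, app f x y -> S y).

Definition injective_on f A : formula P :=
  ∀ x ∈ A, ∀ x' ∈ A, ∀ y, app f x y /\ app f x' y -> x = x'.

Definition card_geq (k : nat) (S : name P -> formula P) : formula P :=
  ∃ f, maps_into f (nat_name P k) S /\ injective_on f (nat_name P k).

Definition cantor x : formula P := maps_into x ω (fun b => b = 0 \/ b = 1).

Definition cantor_subset B : formula P := ∀ x ∈ B, cantor x.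

Definition agree x y n : formula P :=
  ∀ m ∈ n, ∀ b, app x m b <-> app y m b.

Definition is_closed C : formula P :=
  cantor_subset C /\
  (∀ x, cantor x /\ ~ x ∈ C ->
     ∃ n ∈ ω, ∀ y, cantor y /\ agree x y n -> ~ y ∈ C).

Definition is_Sigma02 B : formula P :=
  cantor_subset B /\
  (∃ f, maps_into f ω is_closed /\
     (∀ x, x ∈ B <-> (∃ n ∈ ω, ∃ C, app f n C /\ x ∈ C))).

Definition is_perfect A : formula P :=
  is_closed A /\ (∃ x, x ∈ A) /\
  (∀ x ∈ A, ∀ n ∈ ω, ∃ y ∈ A, ~ y = x /\ agree x y n).

Definition is_sum z x y : formula P :=
  cantor z /\
  (∀ n ∈ ω, app z n 1 <-> ~ (app x n 1 <-> app y n 1)).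

(* z belongs to B + x *)
Definition in_translate B x z : formula P := ∃ b ∈ B, is_sum z b x.

(* |(B + x) ∩ (B + y)| >= k *)
Definition overlap_geq (k : nat) B x y : formula P :=
  card_geq k (fun z => in_translate B x z /\ in_translate B y z).

Definition is_pots (k : nat) B : formula P :=
  cantor_subset B /\
  (∃ A, is_perfect A /\ (∀ x ∈ A, ∀ y ∈ A, overlap_geq k B x y)).

Definition is_npots (k : nat) B : formula P :=
  cantor_subset B /\ ~ is_pots k B.

Definition has_overlapping_translates (k : nat) (L : wellorder) B : formula P :=
  ∃ eta, maps_into eta (check P L) cantor /\ injective_on eta (check P L) /\
    (∀ alpha ∈ check P L, ∀ beta ∈ check P L, ∀ x, ∀ y,
       app eta alpha x /\ app eta beta y -> overlap_geq k B x y).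

End SetTheory.

(* Main.v *)
(* A condition carries finitely many reals eta_a (a < lambda), reals nu_{ab,i}
   (i < iota) for every pair {a, b} and a color for the pair, all reals being
   approximated up to a finite length at which they are linearly independent.  The
   point eta_a + nu_{ab,i} is put in the closed set whose index is the color of
   {a, b}, and B is the union of these sets: nu_{ab,i} and nu_{ab,i} + eta_a + eta_b
   are then 2 iota common points of B + eta_a and B + eta_b.

   Conversely, by independence, if x + y is a sum of two points of B in more than
   four ways then, at every large level, x + y = eta_a + eta_b for a pair of
   indices, and if this holds for all pairs from at least five points, these points
   are a translate of eta_a (a in w) for some tuple w of indices.  The model given by
   NPr yields countably many labels for such tuples, and in a condition two tuples
   that look alike must have the same label.  If A were a perfect set whose
   translates of B all meet in 2 iota points, a Baire category argument would give
   arbitrarily large families of open subsets of A with constant colors between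
   them.  Splitting the set of the family that the label points at moves one index
   of w to a new one without changing the label, so the rank of w drops each time,
   forever. *)

From Stdlib Require Import Inverse_Image.
Require Import Defs.
From mathcomp Require Import all_boot.
From mathcomp Require Import boolp classical_sets functions cardinality.

Set Implicit Arguments.
Unset Strict Implicit.
Unset Printing Implicit Defensive.

Local Open Scope classical_set_scope.
Local Open Scope card_scope.

(** * Forcing *)

(** The rule that tuples looking alike have equal labels must survive amalgamation, and this shapes
    the conditions. Gluing two isomorphic conditions creates tuples with indices on both sides,
    about whose labels nothing is known; a color for the mixed pairs that is not below the new
    length keeps these tuples outside the rule. Isomorphic conditions whose corresponding tuples
    have equal labels exist in every uncountable family because there are only countably many
    labels. For this the bound [delta] on the ranks must lie below omega_1, so that it has only
    countably many predecessors. The perfect set is merely a name, but the descent of ranks takes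
    place among lists of indices of the ground model, found by strengthening conditions, so ranks
    are never computed in the extension. The assumption 3 <= iota enters as 2 iota > 4: once a
    representation of x + y as a sum of two points of B uses two different nu, only four candidates
    for the first summand remain. *)

Section Forcing.
Variable P : forcing_notion.
Implicit Types (p q r : P) (a b c x y z f : name P) (phi psi : formula P).

Lemma srefl p : p <<= p. Proof. exact: stronger_refl. Qed.
Lemma strans q p r : r <<= q -> q <<= p -> r <<= p.
Proof. exact: stronger_trans. Qed.
Hint Resolve srefl : core.

Lemma forces_eq_mono a b p q : q <<= p -> forces_eq a b p -> forces_eq a b q.
Proof.
case: a => D x c; case: b => E y d qp /= [H1 H2].
by split=> i r rq rc; [apply: H1 | apply: H2] => //; apply: strans qp.
Qed.

Lemma forces_eq_dense a b p :
  dense_below p [set r | forces_eq a b r] -> forces_eq a b p.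
Proof.
case: a => D x c; case: b => E y d /= H.
split=> i q qp qc q' q'q.
- have [r [rq' [H1 _]]] := H _ (strans q'q qp).
  have [s [sr Hs]] := H1 i r (srefl r) (strans rq' (strans q'q qc)) r (srefl r).
  by exists s; split=> //; apply: strans rq'.
- have [r [rq' [_ H2]]] := H _ (strans q'q qp).
  have [s [sr Hs]] := H2 i r (srefl r) (strans rq' (strans q'q qc)) r (srefl r).
  by exists s; split=> //; apply: strans rq'.
Qed.

Lemma forces_mem_mono a b p q : q <<= p -> forces_mem a b p -> forces_mem a b q.
Proof. by case: b => E y d qp /= H r rq; apply: H; apply: strans qp. Qed.

Lemma forces_mem_dense a b p :
  dense_below p [set r | forces_mem a b r] -> forces_mem a b p.
Proof.
case: b => E y d /= H q qp; have [r [rq Hr]] := H q qp.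
have [s [sr Hs]] := Hr r (srefl r).
by exists s; split=> //; apply: strans rq.
Qed.

Lemma forces_mono phi p q : q <<= p -> forces phi p -> forces phi q.
Proof.
elim: phi p q => [a b|a b|phi IH|phi IH1 psi IH2|phi IH] p q qp /=.
- exact: forces_eq_mono.
- exact: forces_mem_mono.
- by move=> H r rq; apply: H; apply: strans qp.
- by case=> H1 H2; split; [apply: IH1 H1 | apply: IH2 H2].
- by move=> H x; apply: IH qp (H x).
Qed.

(** The clauses for equality, membership and negation are closed under density, hence so is the
    whole relation. Whatever has to be decided below may therefore be decided by a stronger
    condition. *)
Lemma forces_dense phi p :
  (forall q, q <<= p -> exists r, r <<= q /\ forces phi r) -> forces phi p.
Proof.
elim: phi p => [a b|a b|phi IH|phi IH1 psi IH2|phi IH] p /= H.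
- exact: forces_eq_dense.
- exact: forces_mem_dense.
- move=> q qp Hq; have [r [rq Hr]] := H q qp.
  by apply: (Hr r) => //; apply: forces_mono Hq.
- by split; [apply: IH1 | apply: IH2] => q qp; have [r [rq [? ?]]] := H q qp;
    exists r.
- by move=> x; apply: IH => q qp; have [r [rq Hr]] := H q qp; exists r.
Qed.

Lemma not_forces phi p :
  ~ forces phi p -> exists q, q <<= p /\ forces (~ phi)%F q.
Proof.
move=> H; apply: contrapT => H'; apply: H; apply: forces_dense => q qp.
apply: contrapT => H2; apply: H'; exists q; split=> //= r rq Hr.
by apply: H2; exists r.
Qed.

Lemma f_imp phi psi p :
  forces (phi -> psi)%F p <-> forall q, q <<= p -> forces phi q -> forces psi q.
Proof.
split=> /= [H q qp Hq|H q qp [H1 H2]].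
  apply: contrapT => /not_forces [r [rq Hr]].
  by apply: (H r) => //; [apply: strans qp | split=> //; apply: forces_mono Hq].
by apply: (H2 q) => //; apply: H.
Qed.

Lemma f_or phi psi p :
  forces (phi \/ psi)%F p <->
  forall q, q <<= p -> exists r, r <<= q /\ (forces phi r \/ forces psi r).
Proof.
split=> /= [H q qp|H q qp [H1 H2]].
  apply: contrapT => H'; apply: (H q qp); split=> r rq Hr;
    apply: H'; exists r; auto.
by have [r [rq [Hr|Hr]]] := H q qp; [apply: (H1 r) | apply: (H2 r)].
Qed.

Lemma f_ex (phi : name P -> formula P) p :
  forces (Fex phi) p <->
  forall q, q <<= p -> exists r, r <<= q /\ exists x, forces (phi x) r.
Proof.
split=> /= [H q qp|H q qp H1].
  apply: contrapT => H'; apply: (H q qp) => x r rq Hr.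
  by apply: H'; exists r; split=> //; exists x.
by have [r [rq [x Hr]]] := H q qp; apply: (H1 x r).
Qed.

Lemma f_ex_intro (phi : name P -> formula P) x p :
  forces (phi x) p -> forces (Fex phi) p.
Proof.
move=> H; apply/f_ex => q qp; exists q; split=> //; exists x.
exact: forces_mono H.
Qed.

Lemma f_iff phi psi p :
  forces (phi <-> psi)%F p <->
  forall q, q <<= p -> (forces phi q <-> forces psi q).
Proof.
split=> [[/f_imp H1 /f_imp H2] q qp|H]; first by split; [apply: H1|apply: H2].
by split; apply/f_imp => q /H [].
Qed.

Lemma f_not phi p :
  forces (~ phi)%F p <-> forall q, q <<= p -> ~ forces phi q.
Proof. by []. Qed.

Lemma f_and phi psi p :
  forces (phi /\ psi)%F p <-> forces phi p /\ forces psi p.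
Proof. by []. Qed.

Lemma f_all (phi : name P -> formula P) p :
  forces (Fall phi) p <-> forall x, forces (phi x) p.
Proof. by []. Qed.

Lemma f_allin y (phi : name P -> formula P) p :
  forces (Fall (fun x => Fimp (Fmem x y) (phi x))) p <->
  forall x q, q <<= p -> forces (x ∈ y)%F q -> forces (phi x) q.
Proof.
split=> [/f_all H x q qp Hx|H].
  by have /f_imp G : forces (x ∈ y -> phi x)%F p := H x; apply: G.
by apply/f_all => x; apply/f_imp => q; apply: H.
Qed.

Lemma f_exin y (phi : name P -> formula P) p :
  forces (Fex (fun x => Fand (Fmem x y) (phi x))) p <->
  forall q, q <<= p -> exists r, r <<= q /\
    exists x, forces (x ∈ y)%F r /\ forces (phi x) r.
Proof. exact: f_ex. Qed.

Lemma feqxx x p : forces_eq x x p.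
Proof.
elim: x p => D x IH c p /=.
by split=> i q qp qc r rq; exists r; split=> //; exists i; split;
  try exact: IH; apply: strans qc.
Qed.
Hint Resolve feqxx : core.

Lemma feqC x y p : forces_eq x y p -> forces_eq y x p.
Proof.
elim: x y p => D x IH c [E y d] p /= [H1 H2].
split=> i q qp qd r rq.
- have [s [sr [j [sc Hs]]]] := H2 i q qp qd r rq.
  by exists s; split=> //; exists j; split=> //; apply: IH.
- have [s [sr [j [sc Hs]]]] := H1 i q qp qd r rq.
  by exists s; split=> //; exists j; split=> //; apply: IH.
Qed.

Lemma feq_trans y x z p : forces_eq x y p -> forces_eq y z p -> forces_eq x z p.
Proof.
elim: x y z p => D x IH c [E y d] [F z e] p /= [H1 H2] [H3 H4].
split=> i q qp qd r rq.
- have [s [sr [j [sd Hs]]]] := H1 i q qp qd r rq.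
  have sp : s <<= p by apply: strans qp; apply: strans rq.
  have [t [ts [k [te Ht]]]] := H3 j s sp sd s (srefl s).
  exists t; split; first exact: strans sr.
  by exists k; split=> //; apply: IH Ht; apply: forces_eq_mono Hs.
- have [s [sr [j [sd Hs]]]] := H4 i q qp qd r rq.
  have sp : s <<= p by apply: strans qp; apply: strans rq.
  have [t [ts [k [te Ht]]]] := H2 j s sp sd s (srefl s).
  exists t; split; first exact: strans sr.
  exists k; split=> //; apply: IH Ht _; exact: forces_eq_mono Hs.
Qed.

Lemma fmem_eql x x' y p :
  forces_eq x x' p -> forces_mem x y p -> forces_mem x' y p.
Proof.
case: y => E y d /= Hx H q qp; have [r [rq [j [rd Hr]]]] := H q qp.
exists r; split=> //; exists j; split=> //; apply: feq_trans Hr.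
by apply: feqC; apply: forces_eq_mono Hx; apply: strans qp.
Qed.

Lemma fmem_eqr x y y' p :
  forces_eq y y' p -> forces_mem x y p -> forces_mem x y' p.
Proof.
case: y => E y d; case: y' => F z e /= [H _] Hx q qp.
have [r [rq [j [rd Hr]]]] := Hx q qp.
have [s [sr [k [se Hs]]]] := H j r (strans rq qp) rd r (srefl r).
exists s; split; first exact: strans rq.
by exists k; split=> //; apply: feq_trans Hs; apply: forces_eq_mono Hr.
Qed.

Lemma fmem_name (D : Type) (x : D -> name P) (c : D -> P) i p :
  p <<= c i -> forces_mem (x i) (Name D x c) p.
Proof.
move=> pc q qp; exists q; split=> //; exists i; split=> //.
exact: strans pc.
Qed.

Lemma f_ext x y p :
  (forall z q, q <<= p -> (forces (z ∈ x)%F q <-> forces (z ∈ y)%F q)) ->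
  forces (x = y)%F p.
Proof.
case: x => D x c; case: y => E y d H; split=> i q qp qc.
- by have /= := (H (x i) q qp).1 (fmem_name x qc).
- have /= := (H (y i) q qp).2 (fmem_name y qc).
  move=> H' r rq; have [s [sr [j [? ?]]]] := H' r rq.
  by exists s; split=> //; exists j; split=> //; apply: feqC.
Qed.

(** A congruence for the connectives, which replaces substitution of equal names: formulas bind
    variables by Rocq functions, and no substitution lemma holds for all of these. *)
Definition fequiv p phi psi := forall q, q <<= p -> (forces phi q <-> forces psi q).

Lemma fequiv_refl p phi : fequiv p phi phi. Proof. by []. Qed.

Lemma fequiv_mono p q phi psi : q <<= p -> fequiv p phi psi -> fequiv q phi psi.
Proof. by move=> qp H r rq; apply: H; apply: strans qp. Qed.

Lemma fequiv_eq p x x' y y' : forces_eq x x' p -> forces_eq y y' p ->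
  fequiv p (x = y)%F (x' = y')%F.
Proof.
move=> Hx Hy q qp; have Hx' := forces_eq_mono qp Hx.
have Hy' := forces_eq_mono qp Hy; split=> /= H.
  exact: feq_trans (feq_trans (feqC Hx') H) Hy'.
exact: feq_trans (feq_trans Hx' H) (feqC Hy').
Qed.

Lemma fequiv_mem p x x' y y' : forces_eq x x' p -> forces_eq y y' p ->
  fequiv p (x ∈ y)%F (x' ∈ y')%F.
Proof.
move=> Hx Hy q qp; have Hx' := forces_eq_mono qp Hx.
have Hy' := forces_eq_mono qp Hy; split=> /= H.
  exact: fmem_eqr Hy' (fmem_eql Hx' H).
exact: fmem_eqr (feqC Hy') (fmem_eql (feqC Hx') H).
Qed.

Lemma fequiv_not p phi psi : fequiv p phi psi -> fequiv p (~ phi)%F (~ psi)%F.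
Proof.
move=> H q qp; split=> /= H' r rq Hr; apply: (H' r rq);
  by apply/(H r) => //; apply: strans qp.
Qed.

Lemma fequiv_and p phi psi phi' psi' : fequiv p phi phi' -> fequiv p psi psi' ->
  fequiv p (phi /\ psi)%F (phi' /\ psi')%F.
Proof.
move=> H1 H2 q qp /=.
by split=> -[A B]; split; [apply/(H1 q)|apply/(H2 q)|apply/(H1 q)|apply/(H2 q)].
Qed.

Lemma fequiv_all p (phi psi : name P -> formula P) :
  (forall x, fequiv p (phi x) (psi x)) -> fequiv p (Fall phi) (Fall psi).
Proof. by move=> H q qp /=; split=> A x; apply/(H x q). Qed.

End Forcing.

#[global] Opaque forces.
#[global] Arguments cond : simpl never.
#[global] Arguments stronger : simpl never.
#[global] Arguments forces : simpl never.
#[global] Arguments forces_eq : simpl never.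
#[global] Arguments forces_mem : simpl never.

#[global] Hint Resolve srefl feqxx fequiv_refl : core.

Ltac fcongr :=
  repeat lazymatch goal with
    | |- fequiv _ (Fnot _) (Fnot _) => apply: fequiv_not
    | |- fequiv _ (Fand _ _) (Fand _ _) => apply: fequiv_and
    | |- fequiv _ (Fall _) (Fall _) => apply: fequiv_all => ?
    | |- fequiv _ (Fex _) (Fex _) => rewrite /Fex
    | |- fequiv _ (Fimp _ _) (Fimp _ _) => rewrite /Fimp
    | |- fequiv _ (For _ _) (For _ _) => rewrite /For
    | |- fequiv _ (Fiff _ _) (Fiff _ _) => rewrite /Fiff
    | |- fequiv _ (Feq _ _) (Feq _ _) => apply: fequiv_eq
    | |- fequiv _ (Fmem _ _) (Fmem _ _) => apply: fequiv_mem
    | |- fequiv _ (app _ _ _) (app _ _ _) =>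
        rewrite /app /is_ordered_pair /is_pair
    end;
  try first [ exact: feqxx | assumption | exact: fequiv_refl ].

(** * Ordered pairs and graphs of functions as names *)

Section Pairs.
Variable P : forcing_notion.
Implicit Types (p q r : P) (a b c x y z f : name P) (phi psi : formula P).

Definition upair x y : name P :=
  Name bool (fun b : bool => if b then x else y) (fun _ => weakest P).

Definition opair x y : name P := upair (upair x x) (upair x y).

Lemma mem_upair z x y p : forces (z ∈ upair x y)%F p <->
  forall q, q <<= p -> exists r, r <<= q /\ (forces_eq z x r \/ forces_eq z y r).
Proof.
split=> /= H q qp; have [r [rq Hr]] := H q qp; exists r; split=> //.
  by case: Hr => -[] [_ Hr]; auto.
by case: Hr; [exists true | exists false]; split=> //; apply: weakestP.
Qed.

Lemma mem_upair_or z x y p :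
  forces (z ∈ upair x y)%F p <-> forces (z = x \/ z = y)%F p.
Proof. by rewrite mem_upair f_or. Qed.

Lemma is_pairP z x y p : forces (is_pair z x y) p <-> forces_eq z (upair x y) p.
Proof.
split=> [/f_all H|H].
  apply: f_ext => t q qp; rewrite mem_upair_or.
  by have /f_iff := H t; apply.
apply/f_all => t; apply/f_iff => q qp; rewrite -mem_upair_or.
by apply: (fequiv_mem (feqxx t p) H).
Qed.

Lemma upair_eq x x' y y' p : forces_eq x x' p -> forces_eq y y' p ->
  forces_eq (upair x y) (upair x' y') p.
Proof.
move=> Hx Hy; apply/is_pairP; apply/f_all => t.
by apply/f_iff => q qp; rewrite mem_upair_or;
  apply: (fequiv_mono qp) (srefl q); fcongr.
Qed.

Lemma opair_eq x x' y y' p : forces_eq x x' p -> forces_eq y y' p ->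
  forces_eq (opair x y) (opair x' y') p.
Proof. by move=> Hx Hy; do 2 ?apply: upair_eq. Qed.

Lemma is_opairP z x y p :
  forces (is_ordered_pair z x y) p <-> forces_eq z (opair x y) p.
Proof.
split=> [/f_ex H|H].
  apply: forces_eq_dense => q qp; have [r [rq [s /f_ex Hs]]] := H q qp.
  have [r' [r'r [t /f_and [/is_pairP H1 /f_and [/is_pairP H2 /is_pairP H3]]]]] := Hs r (srefl r).
  exists r'; split; first exact: strans rq.
  by apply: feq_trans H3 _; apply: upair_eq.
apply: (f_ex_intro (x := upair x x)); apply: (f_ex_intro (x := upair x y)).
by apply/f_and; split; [|apply/f_and; split]; apply/is_pairP.
Qed.

(** Each of the four components is a member of the other pair. Deciding to which component it is
    equal costs one strengthening each time, so the disjunction is only obtained densely. *)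
Lemma upair_inj x y x' y' p : forces_eq (upair x y) (upair x' y') p ->
  forall q, q <<= p -> exists r, r <<= q /\
   ((forces_eq x x' r /\ forces_eq y y' r) \/ (forces_eq x y' r /\ forces_eq y x' r)).
Proof.
move=> H q qp.
have m1 : forces (x ∈ upair x y)%F q.
  by apply/mem_upair => r rq; exists r; split=> //; left.
have m2 : forces (y ∈ upair x y)%F q.
  by apply/mem_upair => r rq; exists r; split=> //; right.
have m3 : forces (x' ∈ upair x' y')%F q.
  by apply/mem_upair => r rq; exists r; split=> //; left.
have m4 : forces (y' ∈ upair x' y')%F q.
  by apply/mem_upair => r rq; exists r; split=> //; right.
have Hq := forces_eq_mono qp H.
have {}m1 := fmem_eqr Hq m1; have {}m2 := fmem_eqr Hq m2.
have {}m3 := fmem_eqr (feqC Hq) m3; have {}m4 := fmem_eqr (feqC Hq) m4.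
move/mem_upair: m1 => m1; have [r1 [r1q {}m1]] := m1 q (srefl q).
move/mem_upair: m2 => m2; have [r2 [r21 {}m2]] := m2 r1 r1q.
have r2q := strans r21 r1q.
move/mem_upair: m3 => m3; have [r3 [r32 {}m3]] := m3 r2 r2q.
have r3q := strans r32 r2q.
move/mem_upair: m4 => m4; have [r4 [r43 {}m4]] := m4 r3 r3q.
have r4q := strans r43 r3q.
have e1 : forces_eq x x' r4 \/ forces_eq x y' r4.
  by case: m1 => m; [left|right]; apply: forces_eq_mono m;
    exact: strans (strans r43 r32) r21.
have e2 : forces_eq y x' r4 \/ forces_eq y y' r4.
  by case: m2 => m; [left|right]; apply: forces_eq_mono m; exact: strans r43 r32.
have e3 : forces_eq x' x r4 \/ forces_eq x' y r4.
  by case: m3 => m; [left|right]; apply: forces_eq_mono m.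
exists r4; split=> //.
case: e1 => e1; case: e2 => e2; try by [left | right].
  case: m4 => m4; [right | left]; split=> //; try exact: feqC.
case: e3 => e3; [left|right]; split=> //; try exact: feqC.
Qed.

(** All cases of [upair_inj] lead to the same equalities, which therefore hold densely and so at [p]
    itself. *)
Lemma opair_inj x y x' y' p : forces_eq (opair x y) (opair x' y') p ->
  forces_eq x x' p /\ forces_eq y y' p.
Proof.
move=> H.
have Hx : forces_eq x x' p.
  apply: forces_eq_dense => q qp.
  have [r [rq [[H1 _]|[H1 H2]]]] := upair_inj H qp.
    have [s [sr [[? _]|[? _]]]] := upair_inj H1 (srefl r);
      by exists s; split=> //; apply: strans rq.
  have [s [sr Hs]] := upair_inj H1 (srefl r).
  exists s; split; first exact: strans rq.
  by case: Hs => -[].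
split=> //; apply: forces_eq_dense => q qp.
have Hxq := forces_eq_mono qp Hx.
have [r [rq [[H1 H2]|[H1 H2]]]] := upair_inj H qp.
  have [s [sr [[H3 H4]|[H3 H4]]]] := upair_inj H2 (srefl r);
    exists s; split=> //; try exact: strans rq.
  have Hxs : forces_eq x x' s := forces_eq_mono (strans sr rq) Hxq.
  exact: feq_trans H4 (feq_trans (feqC Hxs) H3).
have [s [sr Hs]] := upair_inj H1 (srefl r).
have [t [ts Ht]] := upair_inj H2 sr.
exists t; split; first exact: strans ts (strans sr rq).
have Hxt : forces_eq x x' t := forces_eq_mono (strans ts (strans sr rq)) Hxq.
have xy' : forces_eq x y' t.
  by apply: (forces_eq_mono ts); case: Hs => -[].
have yx' : forces_eq y x' t by case: Ht => -[].
exact: feq_trans yx' (feq_trans (feqC Hxt) xy').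
Qed.

Lemma appP f x y p : forces (app f x y) p <-> forces (opair x y ∈ f)%F p.
Proof.
split=> [/f_ex H|H].
  apply: forces_dense => q qp; have [r [rq [z /f_and [/is_opairP Hz Hf]]]] := H q qp.
  by exists r; split=> //; apply: fmem_eql Hz Hf.
by apply: (f_ex_intro (x := opair x y)); apply/f_and; split=> //; apply/is_opairP.
Qed.

Lemma app_eq f f' x x' y y' p :
  forces_eq f f' p -> forces_eq x x' p -> forces_eq y y' p ->
  fequiv p (app f x y) (app f' x' y').
Proof.
move=> Hf Hx Hy q qp; rewrite !appP; apply: (fequiv_mem _ Hf) => //.
exact: opair_eq.
Qed.

Definition graph_name (D : Type) (k v : D -> name P) (c : D -> P) : name P :=
  Name D (fun i => opair (k i) (v i)) c.

Lemma mem_graph (D : Type) (k v : D -> name P) (c : D -> P) z p :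
  forces (z ∈ graph_name k v c)%F p <->
  forall q, q <<= p -> exists r, r <<= q /\ exists i,
    r <<= c i /\ forces_eq z (opair (k i) (v i)) r.
Proof. by []. Qed.

Lemma app_graph (D : Type) (k v : D -> name P) (c : D -> P) x y p :
  forces (app (graph_name k v c) x y) p <->
  forall q, q <<= p -> exists r, r <<= q /\ exists i,
    [/\ r <<= c i, forces_eq x (k i) r & forces_eq y (v i) r].
Proof.
rewrite appP mem_graph; split=> H q qp; have [r [rq [i Hi]]] := H q qp;
  exists r; split=> //; exists i.
  by case: Hi => Hc /opair_inj [].
by case: Hi => Hc Hx Hy; split=> //; apply: opair_eq.
Qed.

Lemma app_graph_intro (D : Type) (k v : D -> name P) (c : D -> P) i p :
  p <<= c i -> forces (app (graph_name k v c) (k i) (v i)) p.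
Proof.
move=> pc; apply/app_graph => q qp; exists q; split=> //; exists i.
by split=> //; apply: strans pc.
Qed.

Lemma function_on_graph (D : Type) (k v : D -> name P) (c : D -> P) A p :
  (forall i q, q <<= p -> q <<= c i -> forces (k i ∈ A)%F q) ->
  (forall x q, q <<= p -> forces (x ∈ A)%F q -> exists r, r <<= q /\
     exists i, r <<= c i /\ forces_eq x (k i) r) ->
  (forall i j q, q <<= p -> q <<= c i -> q <<= c j -> forces_eq (k i) (k j) q ->
     forces_eq (v i) (v j) q) ->
  forces (function_on (graph_name k v c) A) p.
Proof.
move=> HA Hex Huni; apply/f_and; split.
  apply/f_allin => z q qp /mem_graph Hz; apply/f_exin => q' q'q.
  have [r [rq [i [rc Hi]]]] := Hz q' q'q.
  have rp : r <<= p by apply: strans rq (strans q'q qp).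
  exists r; split=> //; exists (k i); split; first exact: HA.
  by apply: (f_ex_intro (x := v i)); apply/is_opairP.
apply/f_allin => x q qp Hx; apply/f_ex => q' q'q.
have [r [rq [i [rc Hi]]]] := Hex x q' (strans q'q qp) (forces_mono q'q Hx).
have rp : r <<= p by apply: strans rq (strans q'q qp).
exists r; split=> //; exists (v i); apply/f_and; split.
  apply/(app_eq (feqxx _ _) Hi (feqxx _ _) (srefl r)).
  exact: app_graph_intro.
apply/f_all => y'; apply/f_imp => s sr /app_graph Hy.
apply: forces_dense => t ts; have [w [wt [j [wc Hx' Hy']]]] := Hy t ts.
exists w; split=> //=; apply: feq_trans Hy' _.
have wr : w <<= r by apply: strans wt (strans ts sr).
apply: Huni => //; first exact: strans rp.
  exact: strans rc.
exact: feq_trans (feqC Hx') (forces_eq_mono wr Hi).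
Qed.

End Pairs.

(** * Check names and quantification over them *)

Section Check.
Variable P : forcing_notion.
Implicit Types (p q r : P) (x y z : name P).

(** An arbitrary function from names to formulas may separate names that are forced to be equal;
    [fext] excludes this. *)
Definition fext (phi : name P -> formula P) :=
  forall x x' p, forces_eq x x' p -> fequiv p (phi x) (phi x').

Lemma fext_elim phi x x' p : fext phi -> forces_eq x x' p ->
  forces (phi x) p -> forces (phi x') p.
Proof. by move=> H e /(H x x' p e p (srefl p)). Qed.

Lemma check_eltE (W : wellorder) (a : W) : check_elt P a =
  Name {b : W | wo_lt b a} (fun b => check_elt P (proj1_sig b)) (fun _ => weakest P).
Proof.
rewrite {1}/check_elt Fix_eq //= => {}a f g fg; congr Name.
by apply/funext => b; apply: fg.
Qed.

Lemma mem_check_elt (W : wellorder) (a : W) x p :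
  forces (x ∈ check_elt P a)%F p <->
  forall q, q <<= p -> exists r, r <<= q /\ exists b : W,
    wo_lt b a /\ forces_eq x (check_elt P b) r.
Proof.
rewrite check_eltE; split=> H q qp; have [r [rq Hr]] := H q qp; exists r; split=> //.
  by case: Hr => -[b ba] [_ Hb]; exists b.
by case: Hr => b [ba Hb]; exists (exist _ b ba); split=> //; apply: weakestP.
Qed.

Lemma mem_check (W : wellorder) x p :
  forces (x ∈ check P W)%F p <->
  forall q, q <<= p -> exists r, r <<= q /\ exists b : W, forces_eq x (check_elt P b) r.
Proof.
split=> H q qp; have [r [rq Hr]] := H q qp; exists r; split=> //.
  by case: Hr => b [_ Hb]; exists b.
by case: Hr => b Hb; exists b; split=> //; apply: weakestP.
Qed.

Lemma check_elt_lt (W : wellorder) (a b : W) p :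
  wo_lt b a -> forces (check_elt P b ∈ check_elt P a)%F p.
Proof. by move=> ba; apply/mem_check_elt => q qp; exists q; split=> //; exists b. Qed.

Lemma check_elt_in (W : wellorder) (a : W) p : forces (check_elt P a ∈ check P W)%F p.
Proof. by apply/mem_check => q qp; exists q; split=> //; exists a. Qed.

(** A stronger condition would equate the name with that of some [b] below [a], and the name of [b]
    would then be a member of itself. *)
Lemma check_elt_irr (W : wellorder) (a : W) p :
  ~ forces (check_elt P a ∈ check_elt P a)%F p.
Proof.
elim/(well_founded_ind (wo_wf (w := W))): a p => a IH p H.
have [r [rp [b [ba e]]]] := (mem_check_elt a _ p).1 H p (srefl p).
apply: (IH b ba r).
have H' := check_elt_lt r ba.
exact: fmem_eqr e H'.
Qed.

Lemma check_elt_inj (W : wellorder) (a b : W) p :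
  forces_eq (check_elt P a) (check_elt P b) p -> a = b.
Proof.
move=> e; case: (wo_tri a b) => [H|[//|H]].
  by case: (check_elt_irr (p := p) (fmem_eqr (feqC e) (check_elt_lt p H))).
by case: (check_elt_irr (p := p) (fmem_eqr e (check_elt_lt p H))).
Qed.

Lemma f_all_check (W : wellorder) phi p : fext phi ->
  forces (Fall (fun x => Fimp (Fmem x (check P W)) (phi x))) p <->
  forall a : W, forces (phi (check_elt P a)) p.
Proof.
move=> ex; rewrite f_allin; split=> [H a|H x q qp /mem_check Hx].
  by apply: H => //; apply: check_elt_in.
apply: forces_dense => q' q'q; have [r [rq [a e]]] := Hx q' q'q.
exists r; split=> //; apply: (fext_elim ex (feqC e)).
apply: forces_mono (H a); exact: strans rq (strans q'q qp).
Qed.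

Lemma f_all_check_elt (W : wellorder) (b : W) phi p : fext phi ->
  forces (Fall (fun x => Fimp (Fmem x (check_elt P b)) (phi x))) p <->
  forall a : W, wo_lt a b -> forces (phi (check_elt P a)) p.
Proof.
move=> ex; rewrite f_allin; split=> [H a ab|H x q qp /mem_check_elt Hx].
  by apply: H => //; apply: check_elt_lt.
apply: forces_dense => q' q'q; have [r [rq [a [ab e]]]] := Hx q' q'q.
exists r; split=> //; apply: (fext_elim ex (feqC e)).
apply: forces_mono (H a ab); exact: strans rq (strans q'q qp).
Qed.

Lemma maps_into_graph (D : Type) (k v : D -> name P) (c : D -> P) A
    (S : name P -> formula P) p :
  fext S ->
  (forall i q, q <<= p -> q <<= c i -> forces (k i ∈ A)%F q) ->
  (forall x q, q <<= p -> forces (x ∈ A)%F q -> exists r, r <<= q /\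
     exists i, r <<= c i /\ forces_eq x (k i) r) ->
  (forall i j q, q <<= p -> q <<= c i -> q <<= c j -> forces_eq (k i) (k j) q ->
     forces_eq (v i) (v j) q) ->
  (forall i q, q <<= p -> q <<= c i -> forces (S (v i)) q) ->
  forces (maps_into (graph_name k v c) A S) p.
Proof.
move=> ex HA Hex Huni HS; apply/f_and; split; first exact: function_on_graph.
apply/f_allin => x q qp Hx; apply/f_all => y; apply/f_imp => r rq /app_graph Hy.
apply: forces_dense => r' r'r; have [s [sr [i [sc _ e]]]] := Hy r' r'r.
exists s; split=> //; apply: (fext_elim ex (feqC e)); apply: HS => //.
exact: strans (strans sr r'r) (strans rq qp).
Qed.

Lemma maps_into_elim g A (S : name P -> formula P) x y p :
  forces (maps_into g A S) p -> forces (x ∈ A)%F p -> forces (app g x y) p ->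
  forces (S y) p.
Proof.
move=> /f_and [_ /f_allin H] Hx Hy.
by have /f_all /(_ y) /f_imp := H x p (srefl p) Hx; apply.
Qed.

Lemma maps_into_ex g A (S : name P -> formula P) x p :
  forces (maps_into g A S) p -> forces (x ∈ A)%F p ->
  forall q, q <<= p -> exists r, r <<= q /\ exists y,
    forces (app g x y) r /\ forces (S y) r.
Proof.
move=> H Hx q qp; have /f_and [/f_and [_ /f_allin H1] _] := H.
have /f_ex H2 := H1 x p (srefl p) Hx.
have [r [rq [y /f_and [Hy _]]]] := H2 q qp; exists r; split=> //; exists y; split=> //.
have rp := strans rq qp.
exact: maps_into_elim (forces_mono rp H) (forces_mono rp Hx) Hy.
Qed.

Lemma maps_into_uniq g A (S : name P -> formula P) x y y' p :
  forces (maps_into g A S) p -> forces (x ∈ A)%F p ->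
  forces (app g x y) p -> forces (app g x y') p -> forces_eq y y' p.
Proof.
move=> /f_and [/f_and [_ /f_allin H1] _] Hx Hy Hy'.
have /f_ex H2 := H1 x p (srefl p) Hx.
apply: forces_eq_dense => q qp.
have [r [rq [w /f_and [_ /f_all Hw]]]] := H2 q qp; exists r; split=> //=.
have rp := strans rq qp.
have /f_imp /(_ r (srefl r) (forces_mono rp Hy)) e := Hw y.
have /f_imp /(_ r (srefl r) (forces_mono rp Hy')) e' := Hw y'.
exact: feq_trans e (feqC e').
Qed.

Lemma maps_into_elt g A (S : name P -> formula P) z p :
  forces (maps_into g A S) p -> forces (z ∈ g)%F p ->
  forall q, q <<= p -> exists r, r <<= q /\ exists x y,
    [/\ forces (x ∈ A)%F r, forces_eq z (opair x y) r, forces (app g x y) r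
      & forces (S y) r].
Proof.
move=> H Hz q qp; have /f_and [/f_and [/f_allin H1 _] _] := H.
have /f_exin H2 := H1 z p (srefl p) Hz.
have [r [rq [x [Hx /f_ex Hy]]]] := H2 q qp.
have [s [sr [y /is_opairP e]]] := Hy r (srefl r).
have sp := strans sr (strans rq qp).
have xA : forces (x ∈ A)%F s by apply: forces_mono Hx.
have gxy : forces (app g x y) s.
  by apply/appP; apply: fmem_eql e _; apply: forces_mem_mono Hz.
exists s; split; first exact: strans rq.
exists x; exists y; split=> //.
exact: maps_into_elim (forces_mono sp H) xA gxy.
Qed.

End Check.

(** * Names of reals *)

Lemma omega_ltE (a b : omega) : wo_lt a b <-> (a < b)%N.
Proof. by split=> /ltP. Qed.

Section Reals.
Variable P : forcing_notion.
Implicit Types (p q r : P) (x y z : name P) (n k : nat) (b : bool).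

Local Notation nn := (nat_name P).

Definition bit b : name P := nn (nat_of_bool b).

Lemma nat_name_inj n n' p : forces_eq (nn n) (nn n') p -> n = n'.
Proof. exact: check_elt_inj. Qed.

Lemma bit_inj b b' p : forces_eq (bit b) (bit b') p -> b = b'.
Proof. by move/nat_name_inj; case: b; case: b'. Qed.

Lemma nat_name_omega n p : forces (nn n ∈ omega_name P)%F p.
Proof. exact: (check_elt_in (W := omega)). Qed.
Arguments nat_name_omega n p : clear implicits.

Lemma mem_nat_name x k p :
  forces (x ∈ nn k)%F p <->
  forall q, q <<= p -> exists r, r <<= q /\ exists n, (n < k)%N /\ forces_eq x (nn n) r.
Proof.
rewrite (mem_check_elt (W := omega)); split=> H q qp;
  have [r [rq [n [nk e]]]] := H q qp; exists r; split=> //; exists n;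
  by split=> //; apply/omega_ltE.
Qed.

Lemma mem_omega_name x p :
  forces (x ∈ omega_name P)%F p <->
  forall q, q <<= p -> exists r, r <<= q /\ exists n, forces_eq x (nn n) r.
Proof. exact: (mem_check omega). Qed.

Lemma nat_name_lt n k p : (n < k)%N -> forces (nn n ∈ nn k)%F p.
Proof. by move=> nk; apply: (check_elt_lt (W := omega)); apply/omega_ltE. Qed.

Definition val x n b p := forces (app x (nn n) (bit b)) p.

Lemma val_mono x n b p q : q <<= p -> val x n b p -> val x n b q.
Proof. exact: forces_mono. Qed.

Lemma val_dense x n b p :
  (forall q, q <<= p -> exists r, r <<= q /\ val x n b r) -> val x n b p.
Proof. exact: forces_dense. Qed.

Lemma val_eq x y n b p : forces_eq x y p -> val x n b p -> val y n b p.
Proof. by move=> e /(app_eq e (feqxx _ _) (feqxx _ _) (srefl p)). Qed.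

Definition isbit : name P -> formula P := fun x => (x = nn 0 \/ x = nn 1)%F.

Lemma fext_isbit : fext isbit.
Proof. by move=> x x' p e; rewrite /isbit; fcongr. Qed.

Lemma isbit_bit b p : forces (isbit (bit b)) p.
Proof.
apply/f_or => q qp; exists q; split=> //.
by case: b; [right|left]; exact: feqxx.
Qed.

Lemma isbit_dec y p : forces (isbit y) p ->
  forall q, q <<= p -> exists r, r <<= q /\ exists b, forces_eq y (bit b) r.
Proof.
move=> /f_or H q qp; have [r [rq Hr]] := H q qp; exists r; split=> //.
by case: Hr => Hr; [exists false | exists true].
Qed.

Lemma cantor_app x n y p : forces (cantor x) p -> forces (app x (nn n) y) p ->
  forces (isbit y) p.
Proof. by move=> H; apply: maps_into_elim H _; apply: nat_name_omega. Qed.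

Lemma cantor_dec x n p : forces (cantor x) p ->
  forall q, q <<= p -> exists r, r <<= q /\ exists b, val x n b r.
Proof.
move=> H q qp.
have [r [rq [y [H1 H2]]]] := maps_into_ex H (nat_name_omega n p) qp.
have [s [sr [b e]]] := isbit_dec H2 (srefl r).
exists s; split; first exact: strans rq.
exists b; apply/(app_eq (feqxx _ _) (feqxx _ _) (feqC e) (srefl s)).
exact: forces_mono H1.
Qed.

Lemma cantor_excl x n b b' p : forces (cantor x) p ->
  val x n b p -> val x n b' p -> b = b'.
Proof.
move=> H H1 H2; apply: (bit_inj (p := p)).
exact: maps_into_uniq H (nat_name_omega n p) H1 H2.
Qed.

Lemma cantor_sub x y p : forces (cantor x) p ->
  (forall n b q, q <<= p -> val x n b q -> val y n b q) ->
  forall z q, q <<= p -> forces (z ∈ x)%F q -> forces (z ∈ y)%F q.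
Proof.
move=> Hx H z q qp Hz; apply: forces_dense => q' q'q.
have Hxq := forces_mono (strans q'q qp) Hx.
have [r [rq' [u [v [Hu e Huv Hv]]]]] :=
  maps_into_elt Hxq (forces_mono q'q Hz) (srefl q').
have [s [sr [n eu]]] := (mem_omega_name u r).1 Hu r (srefl r).
have [t [ts [b ev]]] := isbit_dec (forces_mono sr Hv) (srefl s).
have tr := strans ts sr.
have tq' := strans tr rq'.
have eu' := forces_eq_mono ts eu.
exists t; split=> //.
have : val y n b t.
  apply: H; first exact: strans tq' (strans q'q qp).
  apply/(app_eq (feqxx _ _) (feqC eu') (feqC ev) (srefl t)).
  exact: forces_mono Huv.
move=> /appP; apply: fmem_eql; apply: feqC.
apply: feq_trans (forces_eq_mono tr e) _.
exact: opair_eq.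
Qed.

(** One inclusion of values is enough: [x] has some value at [n], [y] shares it, and [y] has only
    one. *)
Lemma cantor_ext x y p : forces (cantor x) p -> forces (cantor y) p ->
  (forall n b q, q <<= p -> val x n b q -> val y n b q) -> forces_eq x y p.
Proof.
move=> Hx Hy H; apply: f_ext => z q qp; split; first exact: cantor_sub H z q qp.
apply: (cantor_sub (p := p)) => // n b {}q {}qp Hv.
apply: val_dense => q' q'q.
have [r [rq [b' Hb']]] := cantor_dec n Hx (strans q'q qp).
exists r; split=> //.
have rp := strans rq (strans q'q qp).
suff -> : b = b' by [].
apply: (cantor_excl (forces_mono rp Hy) (val_mono (strans rq q'q) Hv)).
exact: H Hb'.
Qed.

Lemma fext_cantor : fext (fun x => cantor x).
Proof.
move=> x x' p e.
by rewrite /cantor /maps_into /function_on /is_ordered_pair /is_pair; fcongr.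
Qed.

(* [R n b c] is read as "c forces x(n) = b". *)
Definition real_name (R : nat -> bool -> P -> Prop) : name P :=
  graph_name (D := {t : nat * bool * P | R t.1.1 t.1.2 t.2})
    (fun t => nn (sval t).1.1) (fun t => bit (sval t).1.2) (fun t => (sval t).2).

Lemma val_real R n b p :
  val (real_name R) n b p <->
  forall q, q <<= p -> exists r, r <<= q /\ exists c, r <<= c /\ R n b c.
Proof.
rewrite /val app_graph; split=> H q qp; have [r [rq Hr]] := H q qp; exists r; split=> //.
  case: Hr => -[[[m d] c] /= Rc] [rc /nat_name_inj -> /bit_inj ->].
  by exists c.
case: Hr => c [rc Rc].
by exists (exist _ (n, b, c) Rc).
Qed.

Lemma val_real_intro (R : nat -> bool -> P -> Prop) n b p :
  R n b p -> val (real_name R) n b p.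
Proof.
by move=> H; apply/val_real => q qp; exists q; split=> //; exists p.
Qed.

Lemma cantor_real (R : nat -> bool -> P -> Prop) p :
  (forall n b b' q c c', q <<= p -> q <<= c -> q <<= c' ->
     R n b c -> R n b' c' -> b = b') ->
  (forall n q, q <<= p -> exists r, r <<= q /\ exists b c, r <<= c /\ R n b c) ->
  forces (cantor (real_name R)) p.
Proof.
move=> Hex Hd; apply: maps_into_graph.
- exact: fext_isbit.
- by move=> i q _ _; apply: nat_name_omega.
- move=> x q qp /mem_omega_name Hx.
  have [r [rq [n e]]] := Hx q (srefl q).
  have [s [sr [b [c [sc Rc]]]]] := Hd n r (strans rq qp).
  exists s; split; first exact: strans rq.
  exists (exist _ (n, b, c) Rc); split=> //=.
  exact: forces_eq_mono e.
- move=> [[[n b] c] /= H1] [[[n' b'] c'] /= H2] q qp qc qc' /nat_name_inj e.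
  have bb : b = b' by subst n'; exact: (Hex n b b' q c c').
  by rewrite bb.
- by move=> i q _ _; apply: isbit_bit.
Qed.

(** The nice name of a real keeps only the values decided below [p0]. Such names are given by
    relations between numbers, bits and conditions, which form a type that can index a name, unlike
    all names together. *)
Definition nice p0 x : name P := real_name (fun n b r => r <<= p0 /\ val x n b r).

Lemma nice_eq p0 x : forces (cantor x) p0 -> forces_eq x (nice p0 x) p0.
Proof.
move=> Hx; apply: cantor_ext => //.
  apply: cantor_real.
    move=> n b b' q c c' qp qc qc' [_ H1] [_ H2].
    apply: (cantor_excl (forces_mono qp Hx) (n := n)).
      exact: val_mono H1.
    exact: val_mono H2.
  move=> n q qp; have [r [rq [b Hb]]] := cantor_dec n Hx qp.
  exists r; split=> //; exists b; exists r; split=> //; split=> //.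
  exact: strans qp.
by move=> n b q qp H; apply: val_real_intro.
Qed.

Lemma app1_dec x n b p : forces (cantor x) p -> val x n b p ->
  forall q, q <<= p -> (forces (app x (nn n) (nn 1)) q <-> b = true).
Proof.
move=> Hx H q qp; split=> [H1|bt].
  apply: (cantor_excl (forces_mono qp Hx) (val_mono qp H)).
  exact: H1.
by move: (val_mono qp H); rewrite bt.
Qed.

Lemma fext_sum_body x y z :
  fext (fun u => app z u (nn 1) <-> ~ (app x u (nn 1) <-> app y u (nn 1)))%F.
Proof.
by move=> u u' p e; fcongr.
Qed.

Lemma sum_body_dec x y z n bx b_y bz p :
  forces (cantor x) p -> forces (cantor y) p -> forces (cantor z) p ->
  val x n bx p -> val y n b_y p -> val z n bz p ->
  (forces (app z (nn n) (nn 1) <-> ~ (app x (nn n) (nn 1) <-> app y (nn n) (nn 1)))%F p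
   <-> bz = bx (+) b_y).
Proof.
move=> Hx Hy Hz vx vy vz.
have ex := app1_dec Hx vx; have ey := app1_dec Hy vy; have ez := app1_dec Hz vz.
have eq q : q <<= p ->
    (forces (app x (nn n) (nn 1) <-> app y (nn n) (nn 1))%F q <-> bx = b_y).
  move=> qp; rewrite f_iff; split=> [H|e r rq].
    have := H q (srefl q); rewrite (ex q qp) (ey q qp).
    by case: (bx) (b_y) => -[] // [H1 H2]; [have := H1 erefl | have := H2 erefl].
  rewrite (ex r (strans rq qp)) (ey r (strans rq qp)) e.
  by split.
have ne q : q <<= p ->
    (forces (~ (app x (nn n) (nn 1) <-> app y (nn n) (nn 1)))%F q <-> bx <> b_y).
  move=> qp; rewrite f_not; split=> [H e|H r rq /(eq r (strans rq qp))//].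
  by apply: (H q (srefl q)); apply/(eq q qp).
rewrite f_iff; split=> [H|e q qp].
  have := H p (srefl p); rewrite (ez p (srefl p)) (ne p (srefl p)).
  case: (bx) (b_y) (bz) => -[] [] //= -[H1 H2].
  - by case: (H1 erefl).
  - by apply: H2.
  - by apply: H2.
  - by case: (H1 erefl).
rewrite (ez q qp) (ne q qp) e.
by case: (bx); case: (b_y).
Qed.

End Reals.

Arguments nat_name_lt {P n k} p _.
Arguments nat_name_omega {P} n p.

(** * Sums, agreement and counting of named reals *)

Section Sums.
Variable P : forcing_notion.
Implicit Types (p q r : P) (x y z : name P) (n k : nat) (b : bool).

Local Notation nn := (nat_name P).

Lemma is_sum_val z x y n b1 b2 p :
  forces (cantor x) p -> forces (cantor y) p ->
  forces (is_sum z x y) p -> val x n b1 p -> val y n b2 p -> val z n (b1 (+) b2) p.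
Proof.
move=> Hx Hy /f_and [Hz Hs] vx vy.
have {}Hs := (f_all_check omega _ (fext_sum_body x y z)).1 Hs n.
apply: val_dense => q qp; have [r [rq [b3 vz]]] := cantor_dec n Hz qp.
exists r; split=> //; have rp := strans rq qp.
suff <- : b3 = b1 (+) b2 by [].
apply/(sum_body_dec (forces_mono rp Hx) (forces_mono rp Hy) (forces_mono rp Hz)
  (val_mono rp vx) (val_mono rp vy) vz).
exact: forces_mono Hs.
Qed.

Lemma is_sum_intro z x y p :
  forces (cantor x) p -> forces (cantor y) p -> forces (cantor z) p ->
  (forall n b1 b2 q, q <<= p -> val x n b1 q -> val y n b2 q -> val z n (b1 (+) b2) q) ->
  forces (is_sum z x y) p.
Proof.
move=> Hx Hy Hz H; apply/f_and; split=> //.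
apply: ((f_all_check omega _ (fext_sum_body x y z)).2 _) => n.
apply: forces_dense => q qp.
have [r [rq [b1 v1]]] := cantor_dec n Hx qp.
have [s [sr [b2 v2]]] := cantor_dec n Hy (strans rq qp).
have sp := strans sr (strans rq qp).
exists s; split; first exact: strans rq.
apply/(sum_body_dec (forces_mono sp Hx) (forces_mono sp Hy) (forces_mono sp Hz)
  (val_mono sr v1) v2 (H n b1 b2 s sp (val_mono sr v1) v2)).
by [].
Qed.

Lemma fext_agree_body x y :
  fext (fun u => ∀ b, app x u b <-> app y u b)%F.
Proof. by move=> u u' p e; fcongr. Qed.

Lemma agree_val x y k n b p :
  forces (agree x y (nn k)) p -> (n < k)%N -> val x n b p -> val y n b p.
Proof.
move=> H /ltP nk.
have /f_all /(_ (bit P b)) /f_iff /(_ p (srefl p)) [H1 _] :=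
  (f_all_check_elt (W := omega) k _ (fext_agree_body x y)).1 H n nk.
exact: H1.
Qed.

Lemma agree_intro x y k p : forces (cantor x) p -> forces (cantor y) p ->
  (forall n b q, (n < k)%N -> q <<= p -> val x n b q -> val y n b q) ->
  forces (agree x y (nn k)) p.
Proof.
move=> Hx Hy H.
apply: ((f_all_check_elt (W := omega) k _ (fext_agree_body x y)).2 _) => n /ltP nk.
have aux u v : forces (cantor u) p -> 
    (forall b q, q <<= p -> val u n b q -> val v n b q) ->
    forall w q, q <<= p -> forces (app u (nn n) w) q -> forces (app v (nn n) w) q.
  move=> Hu Huv w q qp Hw; apply: forces_dense => q' q'q.
  have [r [rq [b e]]] := isbit_dec (cantor_app (forces_mono qp Hu) Hw) q'q.
  exists r; split=> //; apply/(app_eq (feqxx _ _) (feqxx _ _) e (srefl r)).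
  apply: Huv; first exact: strans rq (strans q'q qp).
  apply/(app_eq (feqxx _ _) (feqxx _ _) (feqC e) (srefl r)).
  exact: forces_mono (strans rq q'q) Hw.
apply/f_all => w; apply/f_iff => q qp; split; apply: aux => //.
  by move=> b r rp; apply: H.
move=> b r rp vy; apply: val_dense => r' r'r.
have [s [sr [b' vx]]] := cantor_dec n Hx (strans r'r rp).
exists s; split=> //; suff -> : b = b' by [].
have sp := strans sr (strans r'r rp).
apply: (cantor_excl (forces_mono sp Hy) (val_mono (strans sr r'r) vy)).
exact: H.
Qed.

Lemma card_geq_intro k (S : name P -> formula P) (z : nat -> name P) p :
  fext S -> (forall i, (i < k)%N -> forces (S (z i)) p) ->
  (forall i j q, (i < k)%N -> (j < k)%N -> q <<= p -> forces_eq (z i) (z j) q -> i = j) ->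
  forces (card_geq k S) p.
Proof.
move=> ex HS Hz.
apply: (f_ex_intro (x := graph_name (D := 'I_k) (fun i => nn i) (fun i => z i)
  (fun=> weakest P))).
apply/f_and; split.
  apply: maps_into_graph => //.
  - by move=> i q _ _; apply: nat_name_lt.
  - move=> x q qp /mem_nat_name Hx; have [r [rq [n [nk e]]]] := Hx q (srefl q).
    by exists r; split=> //; exists (Ordinal nk); split=> //; apply: weakestP.
  - by move=> i j q _ _ _ /nat_name_inj ->.
  - by move=> i q qp _; apply: forces_mono (HS i (ltn_ord i)).
apply/f_allin => x q qp Hx; apply/f_allin => x' r rq Hx'.
apply/f_all => y; apply/f_imp => s sr /f_and [/app_graph H1 /app_graph H2].
apply: forces_dense => s' s's.
have [t [ts [i [_ e1 e2]]]] := H1 s' s's.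
have [t' [t't [j [_ e3 e4]]]] := H2 t (strans ts s's).
exists t'; split; first exact: strans ts.
have e1' := forces_eq_mono t't e1; have e2' := forces_eq_mono t't e2.
apply: feq_trans e1' (feqC _).
suff -> : nat_of_ord i = j by [].
apply: (Hz i j t') => //.
  by apply: strans qp; apply: strans rq; apply: strans sr; apply: strans s's;
    apply: strans ts.
exact: feq_trans (feqC e2') e4.
Qed.

Lemma finite_dense k (D : nat -> P -> Prop) p :
  (forall i q r, r <<= q -> D i q -> D i r) ->
  (forall i, (i < k)%N -> forall q, q <<= p -> exists r, r <<= q /\ D i r) ->
  exists q, q <<= p /\ forall i, (i < k)%N -> D i q.
Proof.
move=> Dm; elim: k => [|k IH] Hd; first by exists p.
have [|q [qp Hq]] := IH; first by move=> i ik; apply: Hd; apply: ltnW.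
have [r [rq Hr]] := Hd k (ltnSn k) q qp.
exists r; split; first exact: strans qp.
move=> i; rewrite ltnS leq_eqVlt => /orP[/eqP -> //|ik].
exact: Dm rq (Hq i ik).
Qed.

Lemma card_geq_elim k (S : name P -> formula P) p :
  forces (card_geq k S) p ->
  forall q, q <<= p -> exists r, r <<= q /\ exists z : nat -> name P,
    (forall i, (i < k)%N -> forces (S (z i)) r) /\
    (forall i j, (i < k)%N -> (j < k)%N -> i <> j -> forces (~ z i = z j)%F r).
Proof.
move=> /f_ex H q qp; have [q1 [q1q [f /f_and [Hf Hinj]]]] := H q qp.
pose D i r := r <<= q1 /\ exists y, forces (app f (nn i) y) r /\ forces (S y) r.
have [||r [rq1 Hr]] := @finite_dense k D q1.
- move=> i r s sr [rq [y [H1 H2]]]; split; first exact: strans rq.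
  by exists y; split; apply: forces_mono sr _.
- move=> i ik r rq1; have [s [sr Hs]] := maps_into_ex Hf (nat_name_lt q1 ik) rq1.
  by exists s; split=> //; split=> //; apply: strans rq1.
have Hc i : exists y, (i < k)%N -> forces (app f (nn i) y) r /\ forces (S y) r.
  by case: (boolP (i < k)%N) => [/Hr [_ [y Hy]]|_]; [exists y | exists (nn 0)].
have [z Hz] := choice Hc.
exists r; split; first exact: strans q1q.
exists z; split=> [i ik|i j ik jk ij]; first exact: (Hz i ik).2.
apply/f_not => s sr e; apply: ij.
have sq := strans sr rq1.
have /f_allin /(_ _ _ sq (nat_name_lt s ik)) /f_allin
  /(_ _ _ (srefl s) (nat_name_lt s jk)) /f_all /(_ (z i)) /f_imp H1 := Hinj.
apply: (nat_name_inj (p := s)); apply: H1 => //; apply/f_and; split.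
  exact: forces_mono sr (Hz i ik).1.
apply/(app_eq (feqxx _ _) (feqxx _ _) e (srefl s)).
exact: forces_mono sr (Hz j jk).1.
Qed.

Lemma fext_overlap_body B x y :
  fext (fun z => in_translate B x z /\ in_translate B y z)%F.
Proof.
move=> u u' p e.
by rewrite /in_translate /is_sum /cantor /maps_into /function_on /is_ordered_pair
  /is_pair; fcongr.
Qed.

Lemma overlap_eq k B x x' y y' p : forces_eq x x' p -> forces_eq y y' p ->
  fequiv p (overlap_geq k B x y) (overlap_geq k B x' y').
Proof.
move=> e e'.
rewrite /overlap_geq /card_geq /injective_on /in_translate /is_sum /maps_into.
by fcongr.
Qed.

Lemma cantor_neq x y p : forces (cantor x) p -> forces (cantor y) p ->
  forces (~ x = y)%F p ->
  forall q, q <<= p -> exists r, r <<= q /\ exists n b, val x n b r /\ val y n (~~ b) r.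
Proof.
move=> Hx Hy /f_not H q qp; apply: contrapT => H'.
apply: (H q qp); apply: cantor_ext; try exact: forces_mono qp _.
move=> n b r rq vx; apply: val_dense => r' r'r.
have [s [sr [b' vy]]] := cantor_dec n Hy (strans r'r (strans rq qp)).
have vxs := val_mono (strans sr r'r) vx.
exists s; split=> //; case: (eqVneq b b') => [->//|/negPf bb].
case: H'; exists s; split; first exact: strans sr (strans r'r rq).
by exists n; exists b; split=> //; case: b b' bb {vx vxs} vy => -[].
Qed.

End Sums.

(** * Conditions *)

Section Conditions.
Variables (L : eqType) (x0 : L) (io : nat) (lab : seq L -> nat).
Implicit Types (a b c d : L) (u w : seq L) (i j k l n : nat).

(* A condition is a finite set [supp] of indices a, a length [len] and, below that
   length, initial segments of reals eta_a and nu_{ab,i} (i < io), with a color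
   [col a b] for every pair.  Everything but [supp] is stored by position in [supp],
   so that isomorphic conditions have the same [shape], and at the unordered pair of positions, so that [col] and [nu] are symmetric in a and b. *)
Definition shape : Type :=
  (nat * seq (seq bool) * seq (seq nat) * seq (seq (seq (seq bool))))%type.
Definition pre : Type := (seq L * shape)%type.

Implicit Types x y z : pre.

Definition supp x : seq L := x.1.
Definition len x : nat := x.2.1.1.1.
Definition eta x a j : bool := nth false (nth [::] x.2.1.1.2 (index a x.1)) j.
Definition col x a b : nat :=
  nth 0 (nth [::] x.2.1.2 (minn (index a x.1) (index b x.1)))
    (maxn (index a x.1) (index b x.1)).
Definition nu x a b i j : bool :=
  nth false (nth [::] (nth [::] (nth [::] x.2.2
    (minn (index a x.1) (index b x.1))) (maxn (index a x.1) (index b x.1))) i) j.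

Lemma colC x a b : col x a b = col x b a.
Proof. by rewrite /col minnC maxnC. Qed.

Lemma nuC x a b : nu x a b = nu x b a.
Proof. by rewrite /nu minnC maxnC. Qed.

Definition mk u n (H : L -> nat -> bool) (C : L -> L -> nat)
    (N : L -> L -> nat -> nat -> bool) : pre :=
  (u, (n, [seq mkseq (H a) n | a <- u], [seq [seq C a b | b <- u] | a <- u],
    [seq [seq mkseq (fun i => mkseq (N a b i) n) io | b <- u] | a <- u])).

Lemma nth_map_index (T : Type) (y0 : T) (f : L -> T) u a :
  a \in u -> nth y0 [seq f b | b <- u] (index a u) = f a.
Proof. by move=> au; rewrite (nth_map a) ?index_mem // nth_index. Qed.

Section Mk.
Variables (u : seq L) (n : nat) (H : L -> nat -> bool) (C : L -> L -> nat)
  (N : L -> L -> nat -> nat -> bool).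
Hypotheses (HC : forall a b, C a b = C b a) (HN : forall a b, N a b = N b a).

Lemma eta_mk a j : a \in u -> j < n -> eta (mk u n H C N) a j = H a j.
Proof. by move=> au jn; rewrite /eta /= nth_map_index // nth_mkseq. Qed.

Lemma col_mk a b : a \in u -> b \in u -> col (mk u n H C N) a b = C a b.
Proof.
move=> au bu; rewrite /col /=; case: leqP => _; rewrite !nth_map_index //.
Qed.

Lemma nu_mk a b i j : a \in u -> b \in u -> i < io -> j < n ->
  nu (mk u n H C N) a b i j = N a b i j.
Proof.
move=> au bu iio jn; rewrite /nu /=.
case: leqP => _; rewrite !nth_map_index // !nth_mkseq //.
by rewrite HN.
Qed.

End Mk.

(* [wfE] and [wfN] give every generator eta_a, nu_{ab,i} a private coordinate, where
   it is 1 and all other generators are 0: this is how linear independence over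
   the field with two elements is expressed. *)

Definition same_generator a b i c d k : bool :=
  (i == k) && ((c == a) && (d == b) || (c == b) && (d == a)).

Definition wfE x := forall a, a \in supp x -> exists j, [/\ j < len x,
  forall b, b \in supp x -> eta x b j = (b == a) &
  forall b c i, b \in supp x -> c \in supp x -> b != c -> i < io -> nu x b c i j = false].

Definition wfN x := forall a b i, a \in supp x -> b \in supp x -> a != b -> i < io ->
  exists j, [/\ j < len x,
  forall c, c \in supp x -> eta x c j = false &
  forall c d k, c \in supp x -> d \in supp x -> c != d -> k < io ->
    nu x c d k j = same_generator a b i c d k].

Notation "w `_ i" := (nth x0 w i).

(* The color-respecting translates of a configuration carry its label.  Demanding
   that the colors be smaller than the level l lets an amalgamation use colors
   above its length without creating new instances. *)
Definition wfS x := forall w w' l (e : nat -> bool),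
  size w = size w' -> 2 < size w -> uniq w -> uniq w' ->
  {subset w <= supp x} -> {subset w' <= supp x} -> l <= len x ->
  (forall i j, i < size w -> j < l -> eta x w`_i j = eta x w'`_i j (+) e j) ->
  (forall i k, i < size w -> k < size w -> i != k ->
     col x w`_i w`_k = col x w'`_i w'`_k /\ col x w`_i w`_k < l) ->
  lab w = lab w'.

Definition wf x := [/\ uniq (supp x), wfE x, wfN x & wfS x].

(* [le_tree]: the nodes of length [len x] of the trees of index smaller than [len x]
   are frozen. *)
Record lepre y x : Prop := LePre {
  le_supp : {subset supp x <= supp y};
  le_len : len x <= len y;
  le_eta : forall a j, a \in supp x -> j < len x -> eta y a j = eta x a j;
  le_col : forall a b, a \in supp x -> b \in supp x -> a != b ->
    col y a b = col x a b;
  le_nu : forall a b i j, a \in supp x -> b \in supp x -> a != b -> i < io ->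
    j < len x -> nu y a b i j = nu x a b i j;
  le_tree : forall a b i, a \in supp y -> b \in supp y -> a != b -> i < io ->
    col y a b < len x -> exists a' b' i', [/\ a' \in supp x, b' \in supp x & a' != b']
      /\ [/\ i' < io, col x a' b' = col y a b &
      forall j, j < len x -> eta y a j (+) nu y a b i j = eta x a' j (+) nu x a' b' i' j] }.

Lemma lepre_refl x : lepre x x.
Proof. by split=> // a b i au bu ab iio _; exists a, b, i. Qed.

Lemma lepre_trans y x z : lepre z y -> lepre y x -> lepre z x.
Proof.
move=> zy yx; have nxy := le_len yx; have nyz := le_len zy; split.
- by move=> a /(le_supp yx) /(le_supp zy).
- exact: leq_trans nyz.
- move=> a j au jn; rewrite (le_eta zy) ?(le_eta yx) //; first exact: (le_supp yx).
  exact: leq_trans nxy.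
- move=> a b au bu ab.
  by rewrite (le_col zy) ?(le_col yx) //; apply: (le_supp yx).
- move=> a b i j au bu ab ii jn.
  rewrite (le_nu zy) ?(le_nu yx) //; try exact: (le_supp yx).
  exact: leq_trans nxy.
- move=> a b i au bu ab ii cn.
  have [a1 [b1 [i1 [[a1u b1u ab1] [ii1 e1 H1]]]]] :=
    le_tree zy au bu ab ii (leq_trans cn nxy).
  rewrite -e1 in cn.
  have [a2 [b2 [i2 [[a2u b2u ab2] [ii2 e2 H2]]]]] := le_tree yx a1u b1u ab1 ii1 cn.
  exists a2, b2, i2; split=> //; split=> //; first by rewrite e2.
  by move=> j jn; rewrite H1 ?H2 //; apply: leq_trans nxy.
Qed.

Definition condition := {x : pre | wf x}.

Lemma wf0 : wf ([::], (0, [::], [::], [::])).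
Proof.
split=> // w w' l e sw w2 uw uw' sub.
by case: w {sw uw} w2 sub => // a w _ /(_ a); rewrite inE eqxx => /(_ isT).
Qed.

Definition cond0 : condition := exist _ _ wf0.

Lemma lepre0 (p : condition) : lepre (sval p) (sval cond0).
Proof. by split. Qed.

Definition poset : forcing_notion := @ForcingNotion condition
  (fun q p => lepre (sval q) (sval p)) (fun p => lepre_refl (sval p))
  (fun r q p => @lepre_trans (sval q) (sval p) (sval r)) cond0 lepre0.

(** Let a be the entry of [w] at position i. At the private coordinate of a, the equations for i and
    k show that a stands in [w'] at i or at k. Were it not at i, it would stand at two other
    positions, as there are at least three in all, against [uniq w']. *)
Lemma independent_shift x w w' (e : nat -> bool) : wfE x ->
  size w = size w' -> 2 < size w -> uniq w -> uniq w' ->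
  {subset w <= supp x} -> {subset w' <= supp x} ->
  (forall i j, i < size w -> j < len x -> eta x w`_i j = eta x w'`_i j (+) e j) ->
  w = w'.
Proof.
move=> wE sw w2 uw uw' sub sub' He.
have key i k : i < size w -> k < size w -> i != k -> w`_i = w'`_i \/ w`_i = w'`_k.
  move=> iw kw ik.
  have [j [jn Hj _]] := wE _ (sub _ (mem_nth x0 iw)).
  have := He i j iw jn; have := He k j kw jn.
  have mw k' : k' < size w -> w`_k' \in supp x by move=> kw'; apply/sub/mem_nth.
  have mw' k' : k' < size w -> w'`_k' \in supp x.
    by move=> kw'; apply/sub'/mem_nth; rewrite -sw.
  rewrite !Hj ?mw ?mw' //.
  rewrite eqxx (nth_uniq _ kw iw uw) eq_sym (negPf ik) /=.
  case: eqP => [->|_]; first by right.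
  by case: eqP => [->|_]; [left | case: (e j)].
apply: (@eq_from_nth _ x0) => // i iw.
have [k [k' [kw k'w /andP[ik ik'] kk']]] :
    exists k k', [/\ k < size w, k' < size w, (i != k) && (i != k') & k != k'].
  case: (eqVneq i 0) => [->|i0].
    by exists 1, 2; split=> //; apply: ltn_trans w2.
  case: (eqVneq i 1) => [->|i1].
    by exists 0, 2; split=> //; apply: ltn_trans w2.
  exists 0, 1; split=> //; try exact: ltn_trans w2.
  by rewrite i0 i1.
have [//|e1] := key i k iw kw ik.
have [//|e2] := key i k' iw k'w ik'.
have := nth_uniq x0 (s := w') (i := k) (j := k').
rewrite -sw kw k'w uw' -e1 -e2 eqxx => /(_ isT isT isT) /esym.
by rewrite (negPf kk').
Qed.

(* One extension step serves for density and for amalgamation: [u'] is glued to [p]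
   as a copy, along [pi], of a part of [p], and the pairs that are neither in [p]
   nor in [u'] get a color not smaller than the new length.  The generators become
   independent by appending one unit vector for each. *)
Section Extension.
Variables (p : condition) (u' u'' : seq L) (pi : L -> L) (M : nat).
Let x := sval p.
Hypotheses (pi_in : forall a, a \in u' -> pi a \in supp x)
  (pi_inj : {in u' &, injective pi})
  (pi_id : forall a, a \in u' -> a \in supp x -> pi a = a)
  (pi_lab : forall w, uniq w -> {subset w <= u'} -> lab (map pi w) = lab w).

(** [sg] folds [supp x] and [u'] back onto [supp x]; [pure] pairs lie within one of these two
    copies, and all other pairs are mixed. *)
Let sg a := if a \in supp x then a else pi a.
Let pure a b := (a \in supp x) && (b \in supp x) || (a \in u') && (b \in u').

Lemma sg_u' a : a \in u' -> sg a = pi a.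
Proof. by move=> au; rewrite /sg; case: ifP => // ax; rewrite pi_id. Qed.

Lemma sg_in a b : pure a b ->
  [/\ sg a \in supp x, sg b \in supp x & (a != b) -> (sg a != sg b)].
Proof.
case/orP => /andP[au bu]; first by rewrite /sg au bu.
rewrite !sg_u' // !pi_in //; split=> //.
by apply: contra_neq; apply: pi_inj.
Qed.

Lemma pureC a b : pure a b = pure b a.
Proof. by rewrite /pure [in X in X || _]andbC [in X in _ || X]andbC. Qed.

Let U := undup (supp x ++ u' ++ u'').
Let gens : seq (L + L * L * nat) := [seq inl a | a <- U] ++
  [seq inr (ab, i) | ab <- [seq (a, b) | a <- U, b <- U], i <- iota 0 io].
Let n0 := len x.
Let n1 := n0 + (size gens + M).
(** Level n0 + t carries the unit vector of generator number t. Past the end of [gens] the default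
    [inl x0] is read: those [M] levels only lengthen the condition, and no private coordinate is
    taken from them. *)
Let gen j := nth (inl x0) gens (j - n0).
Let H a j := if j < n0 then eta x (sg a) j else gen j == inl a.
Let C a b := if pure a b then col x (sg a) (sg b) else n1.
Let N a b i j := if j < n0 then nu x (sg a) (sg b) i j
  else (gen j == inr (a, b, i)) || (gen j == inr (b, a, i)).
Let y := mk U n1 H C N.

Let HC a b : C a b = C b a.
Proof. by rewrite /C pureC colC. Qed.

Let HN a b : N a b = N b a.
Proof.
by apply/funext => i; apply/funext => j; rewrite /N nuC orbC.
Qed.

Let n01 : n0 <= n1. Proof. exact: leq_addr. Qed.

Let gen_index g : g \in gens -> gen (n0 + index g gens) = g /\ n0 + index g gens < n1.
Proof.
move=> gg; rewrite /gen addKn nth_index //; split=> //.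
by rewrite ltn_add2l; apply: leq_trans (leq_addr _ _); rewrite index_mem.
Qed.

Let n0F k : (n0 + k < n0) = false. Proof. by rewrite ltnNge leq_addr. Qed.

Lemma ext_wf : wf y.
Proof.
have [ux xE xN xS] := svalP p; rewrite -/x in ux xE xN xS.
have UU : uniq U by apply: undup_uniq.
split=> //.
- move=> a aU; have [|ga gl] := gen_index (g := inl a).
    by rewrite mem_cat map_f.
  exists (n0 + index (inl a) gens); split=> // [b bU|b c i bU cU bc ii].
    by rewrite eta_mk // /H n0F ga (inj_eq inl_inj) eq_sym.
  by rewrite nu_mk // /N n0F ga.
- move=> a b i aU bU ab ii; have [|ga gl] := gen_index (g := inr (a, b, i)).
    rewrite mem_cat; apply/orP; right; apply/allpairsP; exists ((a, b), i) => /=.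
    by rewrite mem_iota; split=> //; apply/allpairsP; exists (a, b).
  exists (n0 + index (inr (a, b, i)) gens); split=> // [c cU|c d k cU dU cd kk].
    by rewrite eta_mk // /H n0F ga.
  rewrite nu_mk // /N n0F ga !(inj_eq inr_inj) !xpair_eqE /same_generator.
  rewrite ![_ == a]eq_sym ![_ == b]eq_sym.
  by case: (a == c); case: (b == d); case: (a == d); case: (b == c); case: (i == k).
move=> w w' l e sw w2 uw uw' sub sub' ln He Hc.
(* Such a tuple has no mixed pair, since the color [n1] is not below [l]. An index outside [supp x]
   thus forces the others, and then itself, into [u']. The tuple lies within one copy, and folding
   it preserves its label and its distinctness. *)
have pw v : uniq v -> 2 < size v -> {subset v <= U} ->
   (forall i k, i < size v -> k < size v -> i != k -> col y v`_i v`_k < l) ->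
   [/\ {subset map sg v <= supp x}, uniq (map sg v), lab v = lab (map sg v) &
    forall i k, i < size v -> k < size v -> i != k -> pure v`_i v`_k].
  move=> uv v2 subv Hv.
  have pv i k : i < size v -> k < size v -> i != k -> pure v`_i v`_k.
    move=> iv kv ik; have := Hv i k iv kv ik.
    rewrite col_mk ?subv ?mem_nth // /C; case: ifP => // _ nl.
    by have := leq_trans nl ln; rewrite /y /len /= ltnn.
  have : {subset v <= supp x} \/ {subset v <= u'}.
    case: (boolP (all (mem (supp x)) v)) => [/allP|/allPn[a av ax]]; first by left.
    right=> b bv; have {}ax : a \notin supp x := ax.
    have pab c : c \in v -> a != c -> pure a c.
      move=> cv ac; rewrite -(nth_index x0 av) -(nth_index x0 cv).
      apply: pv; rewrite ?index_mem //.
      by apply: contra_neq ac => e'; rewrite -(nth_index x0 av) e' nth_index.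
    case: (eqVneq a b) => [e'|ab]; last first.
      by have := pab b bv ab; rewrite /pure (negPf ax) => /andP[].
    subst b.
    have [c cv ac] : exists2 c, c \in v & a != c.
      case: (eqVneq a v`_0) => [e'|]; last first.
        by exists v`_0 => //; rewrite mem_nth // (ltn_trans _ v2).
      exists v`_1; first by rewrite mem_nth // (ltn_trans _ v2).
      by rewrite e' nth_uniq // (ltn_trans _ v2).
    by have := pab c cv ac; rewrite /pure (negPf ax) => /andP[].
  case=> sv; last first.
    have -> : map sg v = map pi v.
      by apply/eq_in_map => a av; rewrite sg_u' // sv.
    rewrite pi_lab //; split=> //.
      by move=> a /mapP[b bv ->]; apply: pi_in; apply: sv.
    by rewrite map_inj_in_uniq // => a b av bv; apply: pi_inj; apply: sv.
  have -> : map sg v = v.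
    rewrite -[RHS]map_id; apply/eq_in_map => a av; by rewrite /sg sv.
  by split.
have [|s1 u1 l1 p1] := pw w uw w2 sub.
  by move=> i k iw kw ik; have [] := Hc i k iw kw ik.
have w'2 : 2 < size w' by rewrite -sw.
have [|s2 u2 l2 p2] := pw w' uw' w'2 sub'.
  move=> i k; rewrite -sw => iw kw ik; by have [<-] := Hc i k iw kw ik.
have mw k : k < size w -> w`_k \in U by move=> kw; apply/sub/mem_nth.
have mw' k : k < size w -> w'`_k \in U by move=> kw; apply/sub'/mem_nth; rewrite -sw.
have He' i j : i < size w -> j < l -> j < n0 ->
    eta x (sg w`_i) j = eta x (sg w'`_i) j (+) e j.
  move=> iw jl jn; have := He i j iw jl.
  have jn1 := leq_trans jn n01.
  by rewrite !eta_mk ?mw ?mw' // /H jn.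
rewrite l1 l2.
(* Up to the old length the folded tuples are an instance of [wfS] in [p]. Beyond it they are
   translates of each other on all levels of [p], and independence makes them equal. *)
case: (leqP l n0) => ln0.
  apply: (xS _ _ l e); rewrite ?size_map //.
    move=> i j iw jl; rewrite !(nth_map x0) -?sw //; apply: He' => //.
    exact: leq_trans ln0.
  move=> i k iw kw ik; rewrite !(nth_map x0) -?sw //.
  have := Hc i k iw kw ik.
  rewrite !col_mk ?mw ?mw' // /C p1 // p2 -?sw //.
congr lab; apply: (independent_shift (x := x) (e := e)); rewrite ?size_map //.
move=> i j iw jn; rewrite !(nth_map x0) -?sw //; apply: He' => //.
exact: ltn_trans ln0.
Qed.

Lemma extension : exists q : condition, [/\ lepre (sval q) x, M <= len (sval q),
  supp (sval q) =i supp x ++ u' ++ u'',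
  forall a j, a \in u' -> j < len x -> eta (sval q) a j = eta x (pi a) j &
  [/\ forall a b, a \in u' -> b \in u' -> col (sval q) a b = col x (pi a) (pi b),
  forall a b i j, a \in u' -> b \in u' -> i < io -> j < len x ->
    nu (sval q) a b i j = nu x (pi a) (pi b) i j &
  len x <= len (sval q) /\
  forall a b, a \in supp (sval q) -> b \in supp (sval q) ->
    col (sval q) a b < len x ->
    (a \in supp x) && (b \in supp x) || (a \in u') && (b \in u')]].
Proof.
have su a : a \in supp x -> a \in U by rewrite mem_undup mem_cat => ->.
have su' a : a \in u' -> a \in U.
  by rewrite mem_undup !mem_cat => ->; rewrite orbT.
have sgx a : a \in supp x -> sg a = a by rewrite /sg => ->.
have lt j : j < n0 -> j < n1 by move=> jn; apply: leq_trans n01.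
have pur a b : a \in U -> b \in U -> col y a b < n0 -> pure a b.
  by move=> aU bU; rewrite col_mk // /C; case: ifP => // _; rewrite ltnNge n01.
exists (exist _ _ ext_wf); split=> /=.
- split=> //.
  + by move=> a j ax jn; rewrite eta_mk ?su ?lt // /H jn sgx.
  + by move=> a b ax bx ab; rewrite col_mk ?su // /C /pure ax bx /= !sgx.
  + move=> a b i j ax bx ab ii jn.
    by rewrite nu_mk ?su ?lt // /N jn !sgx.
  (* A color below the old length belongs to a pure pair, whose nodes repeat those of the folded
     pair, so no frozen tree gains a node. *)
  + move=> a b i aU bU ab ii cn; have pab := pur a b aU bU cn.
    have [sa sb /(_ ab) sab] := sg_in pab.
    exists (sg a), (sg b), i; split=> //; split=> //.
      by rewrite col_mk // /C pab.
    by move=> j jn; rewrite eta_mk ?lt // nu_mk ?lt // /H /N jn.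
- by rewrite /len /= /n1 addnA leq_addl.
- by move=> a; rewrite mem_undup.
- by move=> a j au jn; rewrite eta_mk ?su' ?lt // /H jn sg_u'.
split.
- move=> a b au bu; rewrite col_mk ?su' // /C /pure au bu orbT !sg_u' //.
- by move=> a b i j au bu ii jn; rewrite nu_mk ?su' ?lt // /N jn !sg_u'.
- by split.
Qed.

End Extension.
End Conditions.

(** * The countable chain condition *)

Lemma uncountable_fibre (T : Type) (S : set T) (f : T -> nat) :
  ~ countable S -> exists n, ~ countable (S `&` [set x | f x = n]).
Proof.
move=> HS; apply: contrapT => H; apply: HS.
have -> : S = \bigcup_(n in [set: nat]) (S `&` [set x | f x = n]).
  by apply/seteqP; split=> x => [Sx|[n _ []//]]; exists (f x).
apply: bigcup_countable => // n _; apply: contrapT => Hn; apply: H.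
by exists n.
Qed.

Lemma countableU (T : Type) (S S' : set T) :
  countable S -> countable S' -> countable (S `|` S').
Proof.
move=> HS HS'; have -> : S `|` S' = \bigcup_(n in [set: bool]) (if n then S else S').
  apply/seteqP; split=> x /=; first by case=> Hx; [exists true | exists false].
  by case=> -[] _ Hx; [left|right].
by apply: bigcup_countable => // -[].
Qed.

Lemma uncountable_ex (T : Type) (S : set T) : ~ countable S -> exists x, S x.
Proof.
move=> HS; apply: contrapT => H; apply: HS.
have -> : S = set0 by apply/seteqP; split=> // x Sx; case: H; exists x.
exact: countable0.
Qed.

(* What remains of the Delta-system lemma: two sequences of the family meet only
   at equal positions.  R is a maximal set of positions on which uncountably many
   of the sequences agree. *)
Lemma aligned_pair (T : Type) (L : eqType) (x0 : L) (S : set T) (v : T -> seq L) k :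
  ~ countable S -> (forall p, S p -> size (v p) = k /\ uniq (v p)) ->
  exists p q, [/\ S p, S q, p <> q & forall s t, (s < k)%N -> (t < k)%N ->
    nth x0 (v p) s = nth x0 (v q) t -> s = t].
Proof.
move=> HS Hv.
pose agr (R : {set 'I_k}) (rho : 'I_k -> L) :=
  S `&` [set p | forall i, i \in R -> nth x0 (v p) i = rho i].
pose good (R : {set 'I_k}) := `[< exists rho, ~ countable (agr R rho) >].
have good0 : good finset.set0.
  apply/asboolP; exists (fun=> x0); suff -> : agr finset.set0 (fun=> x0) = S by [].
  by apply/seteqP; split=> p /= => [[]//|Sp]; split=> // i; rewrite finset.in_set0.
case: (@arg_maxnP _ finset.set0 good (fun R => #|R|) good0) => R /asboolP[rho Hrho] Rmax.
have [p Ip] := uncountable_ex Hrho.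
(* Were uncountably many sequences to carry the same entry of [v p] at a position outside [R], then
   [R] could be enlarged by that position; so each bad set is countable. *)
pose bad (st : 'I_k * 'I_k) := [set q | st.1 \notin R] `&` agr R rho `&`
   [set q | nth x0 (v q) st.1 = nth x0 (v p) st.2].
have badc st : countable (bad st).
  case: (boolP (st.1 \in R)) => stR.
    suff -> : bad st = set0 by exact: countable0.
    by apply/seteqP; split=> // q [[]] /=; rewrite stR.
  pose rho' i := if i == st.1 then nth x0 (v p) st.2 else rho i.
  apply: contrapT => Hb.
  have : good (st.1 |: R)%SET.
    apply/asboolP; exists rho' => Hc; apply: Hb; apply: sub_countable Hc.
    apply: subset_card_le => q [[_ [Sq Hq]] Hs]; split=> // i.
    rewrite finset.in_setU1 /rho' => /orP[/eqP ->|iR]; first by rewrite eqxx.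
    by case: eqP => [->|_]; [| apply: Hq].
  by move=> /Rmax; rewrite cardsU1 stR /= add1n ltnn.
have : ~ countable (agr R rho `\` ([set p] `|` \bigcup_(st in [set: 'I_k * 'I_k]) bad st)).
  move=> Hc; apply: Hrho.
  apply: (@sub_countable _ _ _
    ((agr R rho `\` ([set p] `|` \bigcup_(st in [set: 'I_k * 'I_k]) bad st)) `|`
     ([set p] `|` \bigcup_(st in [set: 'I_k * 'I_k]) bad st))).
    apply: subset_card_le => q Hq.
    by case: (pselect (([set p] `|` \bigcup_(st in [set: 'I_k * 'I_k]) bad st) q)) => H;
      [right | left].
  apply: countableU => //; apply: countableU; first exact: countable1.
  exact: bigcup_countable.
move=> /uncountable_ex [q [[Sq Hq] /not_orP[qp nb]]].
have [Sp Hp] := Ip; have [sp up] := Hv p Sp; have [sq uq] := Hv q Sq.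
exists p, q; split=> //; first by move=> pq; apply: qp.
move=> s t sk tk e; case: (boolP (Ordinal tk \in R)) => tR.
  have /= e2 := Hq _ tR; have /= e3 := Hp _ tR.
  have : nth x0 (v p) s == nth x0 (v p) t by rewrite e e2 e3.
  by rewrite nth_uniq ?sp // => /eqP.
case: nb; exists (Ordinal tk, Ordinal sk) => //.
Qed.

Fixpoint words (T : Type) (s : seq T) m : seq (seq T) :=
  if m is m'.+1 then [seq a :: t | a <- s, t <- words s m'] else [:: [::]].

Lemma mem_words (T : eqType) (s t : seq T) :
  {subset t <= s} -> t \in words s (size t).
Proof.
elim: t => [|a t IH] sub //=; apply/allpairsP; exists (a, t); split=> //=.
  by apply: sub; rewrite inE eqxx.
by apply: IH => b bt; apply: sub; rewrite inE bt orbT.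
Qed.

Section CCC.
Variables (L : eqType) (x0 : L) (io : nat) (lab : seq L -> nat).
Notation cond := (condition x0 io lab).
Notation P := (poset x0 io lab).
Implicit Types (a b c d : L) (p q r : cond).

(** A tuple without repetition is no longer than the support, so words of length at most [k]
    describe all such tuples by position. *)
Let positions k := flatten [seq words (iota 0 k) m | m <- iota 0 k.+1].

Let labels (p : cond) : seq nat :=
  [seq lab (map (nth x0 (supp (sval p))) t) | t <- positions (size (supp (sval p)))].

(** Codes lie in a countable type. Equal codes mean that the conditions are isomorphic by position,
    with equal labels at corresponding tuples. *)
Let code (p : cond) : nat * shape * seq nat :=
  (size (supp (sval p)), (sval p).2, labels p).

(** Passing to the index at the same position is an isomorphism from [q] to [p]. By the second
    hypothesis it fixes the common indices, so [extension] can glue [q] to [p] as a copy. *)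
Lemma amalgamation p q : code p = code q ->
  (forall s t, (s < size (supp (sval p)))%N -> (t < size (supp (sval p)))%N ->
     nth x0 (supp (sval p)) s = nth x0 (supp (sval q)) t -> s = t) ->
  compatible (P := P) p q.
Proof.
move=> ecode al.
have es : size (supp (sval p)) = size (supp (sval q)) := congr1 (fun z => z.1.1) ecode.
have esh : (sval p).2 = (sval q).2 := congr1 (fun z => z.1.2) ecode.
have el : labels p = labels q := congr1 snd ecode.
set x := sval p; set y := sval q; rewrite /labels in el.
have [ux _ _ _] := svalP p; have [uy _ _ _] := svalP q; rewrite -/x in ux; rewrite -/y in uy.
rewrite -/x -/y in es esh el al.
pose tr (z z' : pre L) a := nth x0 (supp z) (index a (supp z')).
have tr_in (z z' : pre L) a : size (supp z) = size (supp z') -> a \in supp z' ->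
    tr z z' a \in supp z.
  by move=> e az; rewrite /tr mem_nth // e index_mem.
have tr_index (z z' : pre L) a : size (supp z) = size (supp z') -> uniq (supp z) ->
    a \in supp z' -> index (tr z z' a) (supp z) = index a (supp z').
  by move=> e uz az; rewrite /tr index_uniq // e index_mem.
pose pi := tr x y.
have pi_in a : a \in supp y -> pi a \in supp x by apply: tr_in.
have pi_index a : a \in supp y -> index (pi a) (supp x) = index a (supp y).
  exact: tr_index.
have pi_inj : {in supp y &, injective pi}.
  move=> a b ay b_y e; rewrite -(nth_index x0 ay) -(nth_index x0 b_y).
  by rewrite -pi_index // -pi_index // e.
have pi_id a : a \in supp y -> a \in supp x -> pi a = a.
  move=> ay ax; rewrite /pi /tr -(al (index a (supp x)) (index a (supp y))).
  - by rewrite nth_index.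
  - by rewrite index_mem.
  - by rewrite es index_mem.
  - by rewrite !nth_index.
have pi_lab w : uniq w -> {subset w <= supp y} -> lab (map pi w) = lab w.
  move=> uw sub; pose t := map (index^~ (supp y)) w.
  have tin : t \in positions (size (supp y)).
    apply/flattenP; exists (words (iota 0 (size (supp y))) (size t)).
      rewrite map_f // mem_iota /= add0n ltnS size_map; exact: uniq_leq_size.
    apply: mem_words => i /mapP[a aw ->]; rewrite mem_iota /= add0n index_mem.
    exact: sub.
  rewrite es in el.
  have := (eq_in_map (fun t => lab (map (nth x0 (supp x)) t))
     (fun t => lab (map (nth x0 (supp y)) t)) _).2 el t tin.
  rewrite /t -!map_comp => e.
  have -> : map pi w = [seq (nth x0 (supp x) \o index^~ (supp y)) i | i <- w] by [].
  rewrite e; congr lab; rewrite -[RHS]map_id; apply/eq_in_map => a aw /=.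
  by rewrite nth_index // sub.
have etaE a j : a \in supp y -> eta x (pi a) j = eta y a j.
  by move=> ay; rewrite /eta pi_index // esh.
have colE a b : a \in supp y -> b \in supp y -> col x (pi a) (pi b) = col y a b.
  by move=> ay b_y; rewrite /col !pi_index // esh.
have nuE a b i j : a \in supp y -> b \in supp y ->
    nu x (pi a) (pi b) i j = nu y a b i j.
  by move=> ay b_y; rewrite /nu !pi_index // esh.
have lenE : len x = len y by rewrite /len esh.
have [r [rp _ sr re [rc rn [ln rpure]]]] :=
  extension (p := p) [::] 0 pi_in pi_inj pi_id pi_lab.
rewrite -/x in rp re rc rn ln rpure.
have sry a : a \in supp y -> a \in supp (sval r).
  by rewrite sr !mem_cat => ->; rewrite orbT.
exists r; split=> //=; rewrite -/y; split=> //.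
- by rewrite -lenE.
- by move=> a j ay jn; rewrite re ?etaE // lenE.
- by move=> a b ay b_y ab; rewrite rc ?colE.
- by move=> a b i j ay b_y ab ii jn; rewrite rn ?nuE // lenE.
move=> a b i ar br ab ii cn; rewrite -lenE in cn.
have := rpure a b ar br cn => /orP[] /andP[ax bx]; last first.
  exists a, b, i; split=> //; split=> //; first by rewrite rc ?colE.
  by move=> j jn; rewrite re ?rn ?etaE ?nuE // lenE.
have inv c : c \in supp x -> exists2 c', c' \in supp y & pi c' = c.
  move=> cx; exists (tr y x c); first exact: tr_in.
  by rewrite /pi {1}/tr tr_index // nth_index.
have [a' ay ea] := inv a ax; have [b' b_y eb] := inv b bx.
exists a', b', i; split=> //.
  by split=> //; apply: contra_neq ab => e; rewrite -ea -eb e.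
split=> //.
  by rewrite -colE // ea eb (le_col rp).
move=> j jn; rewrite -lenE in jn; rewrite -etaE // -nuE // ea eb.
by rewrite (le_eta rp) // (le_nu rp).
Qed.

Lemma poset_ccc : ccc P.
Proof.
move=> A antiA; apply: contrapT => Ac.
have [n Hn] := uncountable_fibre (fun p => pickle (code p)) Ac.
have [p0 [_ /= e0]] := uncountable_ex Hn.
have codeE p : (A `&` [set x | pickle (code x) = n]) p -> code p = code p0.
  by move=> [_ /= e]; apply: (pcan_inj pickleK); rewrite e e0.
have [|p [q [Ap Aq pq Hpq]]] := @aligned_pair _ L x0 _ (fun p : cond => supp (sval p))
    (size (supp (sval p0))) Hn.
  move=> p /codeE /(congr1 (fun z => z.1.1)) /= ->; split=> //.
  by have [] := svalP p.
apply: (antiA p q) => //; [exact: Ap.1 | exact: Aq.1|].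
apply: amalgamation; first by rewrite (codeE _ Ap) (codeE _ Aq).
by have /(congr1 (fun z => z.1.1)) /= -> := codeE _ Ap.
Qed.

Lemma density (p : P) M (s : seq L) : exists q : P,
  [/\ q <<= p, (M <= len (sval q))%N & supp (sval q) =i supp (sval p) ++ s].
Proof.
have [||||q [qp Mq sq _ _]] := @extension L x0 io lab p [::] s id M.
- by [].
- by [].
- by [].
- by move=> w _ _; rewrite map_id.
by exists q; split.
Qed.

End CCC.

(** * Sums of generic reals *)

Section Combinatorics.
Variables (L : eqType) (x0 : L) (io : nat) (lab : seq L -> nat).
Variable x : pre L.
Hypothesis wfx : wf x0 io lab x.
Implicit Types (a b c d : L) (v : nat -> bool).

Let n := len x.
Let uE : wfE io x. Proof. by have [] := wfx. Qed.
Let uN : wfN io x. Proof. by have [] := wfx. Qed.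

(** The first [n] values of [v] are a node of the tree with index [m]: an initial segment of some
    eta_a + nu_{ab,i} with {a, b} of color [m]. *)
Definition node m v := exists a b i,
  [/\ a \in supp x, b \in supp x & a != b] /\
  [/\ (i < io)%N, col x a b = m &
    forall j, (j < n)%N -> v j = eta x a j (+) nu x a b i j].

Definition edge v a b := [/\ a \in supp x, b \in supp x & a != b] /\
  forall j, (j < n)%N -> v j = eta x a j (+) eta x b j.

Lemma same_sym a b i c d k : same_generator a b i c d k = same_generator c d k a b i.
Proof.
rewrite /same_generator eq_sym ![_ == c]eq_sym ![_ == d]eq_sym.
by case: (i == k); case: (c == a); case: (d == b); case: (c == b); case: (d == a).
Qed.

Lemma same_refl a b i : same_generator a b i a b i.
Proof. by rewrite /same_generator !eqxx. Qed.

Lemma same_trans a b i c d k a' b' i' : same_generator a b i c d k ->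
  same_generator a b i a' b' i' = same_generator c d k a' b' i'.
Proof.
case/andP => /eqP -> /orP[] /andP[/eqP -> /eqP ->] //.
by rewrite /same_generator orbC.
Qed.

Lemma same_nu a b i c d k : same_generator a b i c d k -> nu x c d k = nu x a b i.
Proof. by case/andP => /eqP -> /orP[] /andP[/eqP -> /eqP ->] //; rewrite nuC. Qed.

(* If the first representation v = b + b' uses two different nu, all the others use
   the same two, and only four vectors b are left. *)
Lemma common_difference (K : nat) (bv : nat -> nat -> bool) (m m' : nat -> nat) v :
  (4 < K)%N ->
  (forall k k', (k < K)%N -> (k' < K)%N ->
     (forall j, (j < n)%N -> bv k j = bv k' j) -> k = k') ->
  (forall k, (k < K)%N -> node (m k) (bv k)) ->
  (forall k, (k < K)%N -> node (m' k) (fun j => bv k j (+) v j)) ->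
  (exists2 j, (j < n)%N & v j) ->
  exists a b, edge v a b /\ col x a b = m 0.
Proof.
move=> K4 dist Hm Hm' [jv jvn vjv].
have K0 : (0 < K)%N by apply: ltn_trans K4.
have [a0 [b0 [i0 [[a0u b0u ab0] [i0n c0 E0]]]]] := Hm 0 K0.
have [c1 [d1 [i1 [[c1u d1u cd1] [i1n c1E E1]]]]] := Hm' 0 K0.
have vE j : (j < n)%N -> v j = eta x a0 j (+) nu x a0 b0 i0 j (+)
    (eta x c1 j (+) nu x c1 d1 i1 j).
  move=> jn; rewrite -E0 // -E1 //.
  by rewrite addbA addbb.
(* If both summands use the same nu, it cancels, and [v], not being zero, is the sum of the reals
   eta of the two ends of its pair. *)
case: (boolP (same_generator a0 b0 i0 c1 d1 i1)) => [sm|nsm].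
  have [ca|ca] := eqVneq c1 a0.
    by have := vE jv jvn; rewrite (same_nu sm) ca addbb vjv.
  have cb : c1 = b0.
    by move: sm => /andP[_]; rewrite (negPf ca) /= => /andP[/eqP].
  exists a0, b0; split=> //; split=> // j jn.
  rewrite vE // (same_nu sm) cb.
  by case: (eta x a0 j); case: (eta x b0 j); case: (nu x a0 b0 i0 j).
(* [v] is 1 at the private coordinates of both nu, so in every representation each of the two occurs
   exactly once. *)
have [jf [jfn fe fn]] := uN a0u b0u ab0 i0n.
have [jg [jgn ge gn]] := uN c1u d1u cd1 i1n.
have vjf : v jf by rewrite vE // !fe // !fn // same_refl (negPf nsm).
have vjg : v jg.
  by rewrite vE // !ge // !gn // same_refl same_sym (negPf nsm).
(* The four candidates: either nu, added to the eta of either end of its pair. *)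
pose cand (t : 'I_4) j := nth false
  [:: eta x a0 j (+) nu x a0 b0 i0 j; eta x b0 j (+) nu x a0 b0 i0 j;
      eta x c1 j (+) nu x c1 d1 i1 j; eta x d1 j (+) nu x c1 d1 i1 j] t.
have tagP (k : 'I_K) : exists t : 'I_4, forall j, (j < n)%N -> bv k j = cand t j.
  have [a [b [i [[au bu ab] [ii ce E]]]]] := Hm k (ltn_ord k).
  have [a' [b' [i' [[au' bu' ab'] [ii' ce' E']]]]] := Hm' k (ltn_ord k).
  have vE' j : (j < n)%N -> v j = eta x a j (+) nu x a b i j (+)
      (eta x a' j (+) nu x a' b' i' j).
    by move=> jn; rewrite -E // -E' // addbA addbb.
  case: (boolP (same_generator a0 b0 i0 a b i)) => sa.
    have : (a == a0) || (a == b0).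
      by move: sa => /andP[_ /orP[] /andP[-> _]]; rewrite ?orbT.
    have nE := same_nu sa.
    case/orP => /eqP e.
      by exists (inord 0) => j jn; rewrite /cand inordK //= E // nE e.
    by exists (inord 1) => j jn; rewrite /cand inordK //= E // nE e.
  have sa' : same_generator a0 b0 i0 a' b' i'.
    by move: vjf; rewrite vE' // !fe // !fn // (negPf sa).
  have sg : same_generator c1 d1 i1 a b i.
    move: vjg; rewrite vE' // !ge // !gn // [same_generator _ _ _ a' _ _]same_sym.
    by rewrite -(same_trans _ _ _ sa') (negPf nsm) /= addbF.
  have : (a == c1) || (a == d1).
    by move: sg => /andP[_ /orP[] /andP[-> _]]; rewrite ?orbT.
  have nE := same_nu sg.
  case/orP => /eqP e.
    by exists (inord 2) => j jn; rewrite /cand inordK //= E // nE e.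
  by exists (inord 3) => j jn; rewrite /cand inordK //= E // nE e.
have [tag Htag] := choice tagP.
have : injective tag.
  move=> k k' e; apply: val_inj; apply: (dist _ _ (ltn_ord k) (ltn_ord k')) => j jn.
  by rewrite !Htag // e.
by move/leq_card; rewrite !card_ord leqNgt K4.
Qed.

(** At the private coordinate of z, [v] tells whether z is an end of the edge. *)
Lemma edge_uniq v a b c d : edge v a b -> edge v c d ->
  (a = c /\ b = d) \/ (a = d /\ b = c).
Proof.
move=> [[au bu ab] E] [[cu du cd] E'].
have key z : z \in supp x -> (a == z) (+) (b == z) = (c == z) (+) (d == z).
  move=> zu; have [j [jn Hj _]] := uE zu.
  by rewrite -!Hj // -E // E'.
have := key a au; rewrite eqxx eq_sym (negPf ab) /= ![_ == a]eq_sym.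
case: eqP => [ac|_]; case: eqP => [ad|_] //= _.
  left; split=> //; apply/eqP; have := key b bu.
  by rewrite eqxx -ac (negPf ab) /= eq_sym => <-.
right; split=> //; apply/eqP; have := key b bu.
by rewrite eqxx -ad (negPf ab) addbF /= eq_sym => <-.
Qed.

(** The sum of two disjoint edges involves four independent reals eta and the sum of two equal edges
    is zero; neither is an edge. Exactly one common end remains. *)
Lemma edge_meet v v' a b c d : edge v a b -> edge v' c d ->
  (exists a' b', edge (fun j => v j (+) v' j) a' b') ->
  exists z, [/\ (z == a) || (z == b), (z == c) || (z == d) &
    forall z', (z' == a) || (z' == b) -> (z' == c) || (z' == d) -> z' = z].
Proof.
move=> [[au bu ab] E] [[cu du cd] E'] [s [t [[su tu st] F]]].
have key z : z \in supp x ->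
    (a == z) (+) (b == z) (+) ((c == z) (+) (d == z)) = (s == z) (+) (t == z).
  move=> zu; have [j [jn Hj _]] := uE zu.
  by rewrite -!Hj // -F // E // E'.
have ka := key a au; have kb := key b bu; have kc := key c cu; have kd := key d du.
have ks := key s su.
have [ac|ac] := eqVneq a c; have [ad|ad] := eqVneq a d.
- by case/eqP: cd; rewrite -ac -ad.
- have [bd|bd] := eqVneq b d.
    by move: ks; rewrite ac bd addbb eqxx eq_sym (negPf st).
  exists a; rewrite eqxx ac eqxx; split=> // z /orP[/eqP -> //|/eqP ->].
  by rewrite -ac eq_sym (negPf ab) (negPf bd).
- have [bc|bc] := eqVneq b c.
    move: ks; rewrite ad bc eqxx [t == s]eq_sym (negPf st).
    by case: (d == s); case: (c == s).
  exists a; rewrite eqxx ad eqxx orbT; split=> // z /orP[/eqP -> //|/eqP ->].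
  by rewrite -ad (negPf bc) eq_sym (negPf ab).
have [bc|bc] := eqVneq b c.
  exists b; rewrite eqxx bc eqxx orbT; split=> // z /orP[/eqP ->|/eqP -> //].
  by rewrite -bc (negPf ab) (negPf ad).
have [bd|bd] := eqVneq b d.
  exists b; rewrite eqxx bd eqxx !orbT; split=> // z /orP[/eqP ->|/eqP -> //].
  by rewrite -bd (negPf ac) (negPf ab).
(* now a, b, c, d are distinct, and cannot all be in {s, t} *)
exfalso; move: ka kb kc {kd ks}.
rewrite !eqxx [b == a]eq_sym [c == a]eq_sym [d == a]eq_sym [c == b]eq_sym
  [d == b]eq_sym [d == c]eq_sym.
rewrite (negPf ab) (negPf ac) (negPf ad) (negPf bc) (negPf bd) (negPf cd) /=.
have [sa|_] := eqVneq s a.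
  rewrite sa (negPf ab) (negPf ac) /=.
  have [tb|//] := eqVneq t b; rewrite tb (negPf bc) => _ _ //.
have [ta|//] := eqVneq t a; rewrite ta (negPf ab) (negPf ac) !addbF => _.
by have [sb|//] := eqVneq s b; rewrite sb (negPf bc).
Qed.

(* Pairwise intersecting edges form a star or a triangle, and a triangle is
   excluded when there are at least four of them. *)
Lemma star k (s : nat -> nat -> bool) : (4 < k)%N ->
  (forall i j, (i < k)%N -> (j < k)%N -> i != j ->
     exists a b, edge (fun t => s i t (+) s j t) a b) ->
  exists (al : nat -> L) (e : nat -> bool), forall i, (i < k)%N ->
    al i \in supp x /\ forall t, (t < n)%N -> s i t = e t (+) eta x (al i) t.
Proof.
move=> k4 H; have k0 : (0 < k)%N by apply: ltn_trans k4.
have Hf0 j : exists ab : L * L, (0 < j < k)%N ->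
    edge (fun t => s 0 t (+) s j t) ab.1 ab.2.
  case: (boolP (0 < j < k)%N) => [/andP[j0 jk]|_]; last by exists (x0, x0).
  have [|a [b E]] := H 0 j k0 jk; first by rewrite neq_ltn j0.
  by exists (a, b).
have [f Hf] := choice Hf0.
pose inE j z := (z == (f j).1) || (z == (f j).2).
have meet j j' : (0 < j < k)%N -> (0 < j' < k)%N -> j != j' ->
    exists z, [/\ inE j z, inE j' z & forall z', inE j z' -> inE j' z' -> z' = z].
  move=> jk jk' jj; apply: (edge_meet (Hf j jk) (Hf j' jk')).
  have [a [b [E E']]] := H j j' (andP jk).2 (andP jk').2 jj.
  exists a, b; split=> // t tn; rewrite -E' //.
  by case: (s 0 t); case: (s j t); case: (s j' t).
have other j a : (0 < j < k)%N -> inE j a -> exists b, [/\ b != a, inE j b,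
    (forall z, inE j z -> z = a \/ z = b) & edge (fun t => s 0 t (+) s j t) a b].
  move=> jk; have [[au bu ab] E] := Hf j jk; case/orP => /eqP ->.
    exists (f j).2; split=> //; first by rewrite eq_sym.
    - by rewrite /inE eqxx orbT.
    - by move=> z /orP[] /eqP ->; [left|right].
  exists (f j).1; split=> //; first by rewrite /inE eqxx.
    by move=> z /orP[] /eqP ->; [right|left].
  split; first by rewrite eq_sym.
  by move=> t tn; rewrite E // addbC.
have k1 : (0 < 1 < k)%N by rewrite (ltn_trans _ k4).
have k2 : (0 < 2 < k)%N by rewrite (ltn_trans _ k4).
have [a [a1 a2 a12]] := meet 1 2 k1 k2 isT.
have [b [ba b1 b1P _]] := other 1 a k1 a1.
have [c [ca c2 c2P _]] := other 2 a k2 a2.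
have bc : b != c by apply/eqP => e; have := a12 b b1; rewrite e c2 => /(_ isT);
  apply/eqP; rewrite -e.
(* An edge missing [a] would be [bc], closing a triangle with edges 1 and 2. However a fourth edge
   meets this triangle, it shares both ends with one of the sides. *)
have center j : (0 < j < k)%N -> inE j a.
  move=> jk; apply/negP => /negP ja.
  have j1 : j != 1 by apply: contraNneq ja => ->.
  have j2 : j != 2 by apply: contraNneq ja => ->.
  have jb : inE j b.
    have [z [z1 z2 _]] := meet j 1 jk k1 j1.
    by case: (b1P z z2) => e; [case/negP: ja; rewrite -e | rewrite -e].
  have jc : inE j c.
    have [z [z1 z2 _]] := meet j 2 jk k2 j2.
    by case: (c2P z z2) => e; [case/negP: ja; rewrite -e | rewrite -e].
  have [j' [jk' j'1 j'2 jj']] : exists j', [/\ (0 < j' < k)%N, j' != 1, j' != 2 & j != j'].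
    case: (eqVneq j 3) => [->|j3]; last by exists 3; split=> //; apply: ltn_trans k4.
    by exists 4.
  have [z [zj zj' zu]] := meet j j' jk jk' jj'.
  case: (boolP (inE j' a)) => j'a.
    have [d [da dj' dP _]] := other j' a jk' j'a.
    have zE : z = d.
      by case: (dP z zj') => // e; case/negP: ja; rewrite -e.

    have [b' [b'b jb' b'P _]] := other j b jk jb.
    have cb' : c = b' by case: (b'P c jc) => // e; case/eqP: bc.
    case: (b'P z zj) => e.
      have [y [_ _ yu]] := meet 1 j' k1 jk' (contra_neq (fun e => esym e) j'1).
      by case/eqP: ba; rewrite -e (yu a) // (yu z) // e.
    have [y [_ _ yu]] := meet 2 j' k2 jk' (contra_neq (fun e => esym e) j'2).
    by case/eqP: ca; rewrite cb' -e (yu a) // (yu z) // e -cb'.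
  have j'b : inE j' b.
    have [y [y1 y2 _]] := meet j' 1 jk' k1 j'1.
    by case: (b1P y y2) => e; [case/negP: j'a; rewrite -e | rewrite -e].
  have j'c : inE j' c.
    have [y [y1 y2 _]] := meet j' 2 jk' k2 j'2.
    by case: (c2P y y2) => e; [case/negP: j'a; rewrite -e | rewrite -e].
  by case/eqP: bc; rewrite (zu b) // (zu c).
have Hal i : exists b, (0 < i < k)%N -> edge (fun t => s 0 t (+) s i t) a b.
  case: (boolP (0 < i < k)%N) => [ik|_]; last by exists a.
  by have [b' [_ _ _ E]] := other i a ik (center i ik); exists b'.
have [al alP] := choice Hal.
have [[au _ _] _] := alP 1 k1.
exists (fun i => if i == 0 then a else al i), (fun t => s 0 t (+) eta x a t) => i ik.
case: eqVneq => [->|i0].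
  by split=> // t tn; rewrite -addbA addbb addbF.
have [|[_ bu _] E] := alP i; first by rewrite lt0n i0.
split=> // t tn; have := E t tn.
by case: (s 0 t); case: (s i t); case: (eta x a t); case: (eta x (al i) t).
Qed.

End Combinatorics.

(** * Labels *)

Lemma countable_code (T : Type) (S : set T) :
  countable S -> exists f : T -> nat, forall x y, S x -> S y -> f x = f y -> x = y.
Proof.
by move=> /countable_injP[f Hf]; exists f => x y Sx Sy; apply: Hf; rewrite inE.
Qed.

(** * Countability of the quantifier free formulas *)

Section FormulaCodes.
Variable tau : vocabulary.
Variables (cf : Defs.fsym tau -> nat) (cr : rsym tau -> nat).
Hypotheses (cf_inj : injective cf) (cr_inj : injective cr).

Fixpoint term_code n (t : term tau n) : GenTree.tree nat :=
  match t with
  | tvar i => GenTree.Leaf (nat_of_ord i)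
  | tapp f ts => GenTree.Node (cf f) [seq term_code (ts i) | i <- enum 'I_(farity f)]
  end.

Lemma nth_map_enum k (T : Type) (y : T) (f : 'I_k -> T) (i : 'I_k) :
  nth y [seq f j | j <- enum 'I_k] i = f i.
Proof.
rewrite (nth_map i) ?size_enum_ord //; congr f; apply: val_inj.
exact: nth_enum_ord.
Qed.

Lemma map_enum_inj k (T : Type) (f g : 'I_k -> T) :
  [seq f i | i <- enum 'I_k] = [seq g i | i <- enum 'I_k] -> f =1 g.
Proof. by move=> e i; rewrite -(nth_map_enum (f i) f i) e nth_map_enum. Qed.

Lemma term_code_inj n : injective (@term_code n).
Proof.
elim=> [i|f ts IH] [j|g us] //=; first by case=> /val_inj ->.
case=> /cf_inj e; subst g => /map_enum_inj e.
by congr tapp; apply/funext => i; apply: IH; apply: e.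
Qed.

Fixpoint formula_code n (phi : qf_formula tau n) : GenTree.tree nat :=
  match phi with
  | qf_eq s t => GenTree.Node 0 [:: term_code s; term_code t]
  | qf_rel r ts => GenTree.Node 1
      (GenTree.Leaf (cr r) :: [seq term_code (ts i) | i <- enum 'I_(rarity r)])
  | qf_not phi1 => GenTree.Node 2 [:: formula_code phi1]
  | qf_and phi1 phi2 => GenTree.Node 3 [:: formula_code phi1; formula_code phi2]
  end.

Lemma formula_code_inj n : injective (@formula_code n).
Proof.
elim=> [s t|r ts|phi IH|phi IH1 psi IH2] [s' t'|r' ts'|phi'|phi' psi'] //=.
- by case=> /term_code_inj -> /term_code_inj ->.
- case=> /cr_inj e; subst r' => /map_enum_inj e.
  by congr qf_rel; apply/funext => i; apply: term_code_inj; apply: e.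
- by case=> /IH ->.
- by case=> /IH1 -> /IH2 ->.
Qed.

End FormulaCodes.

Section Ranks.
Variables (tau : vocabulary) (U : Type) (M : model tau U) (W : wellorder).

(** A single clause covers zero, successors and limits, where it passes to all smaller ordinals by
    induction. Ranks can then be bounded from below without knowing the kind of the ordinal. *)
Lemma rk_ge_intro (alpha : W) w : rk_ge0 M w ->
  (forall beta : W, wo_lt beta alpha -> rk_geS M (rk_ge M beta) w) -> rk_ge M alpha w.
Proof.
move=> H0; elim/(well_founded_ind (wo_wf (w := W))): alpha => alpha IH HS.
case: (pselect (exists beta : W, wo_lt beta alpha)) => [ex|nex]; last first.
  by apply: rk_ge_zero => // beta ba; apply: nex; exists beta.
case: (pselect (exists2 beta : W, wo_lt beta alpha &
    forall gamma, wo_lt gamma alpha -> gamma = beta \/ wo_lt gamma beta)).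
  by case=> beta ba Hb; apply: (rk_ge_succ ba Hb); apply: HS.
move=> nsucc; apply: rk_ge_limit => // beta ba.
  apply: contrapT => H; apply: nsucc; exists beta => // gamma ga.
  case: (wo_tri gamma beta) => [|[]]; [by right | by left | move=> bg].
  by case: H; exists gamma.
apply: IH => // gamma gb; apply: HS; exact: wo_trans gb ba.
Qed.

Lemma rk_minus1P w : rk_minus1 M w -> exists n (a : 'I_n.+1 -> U),
  enumerates a w /\ exists (phi : qf_formula tau n.+1) k, sat M phi a /\
    countable [set x | sat M phi (replace a k x)].
Proof.
move=> H; apply: contrapT => H'; apply: H => n a aw phi k s c; apply: H'.
by exists n, a; split=> //; exists phi, k.
Qed.

Lemma not_rk_geSP X w : ~ rk_geS M X w -> exists n (a : 'I_n.+1 -> U),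
  enumerates a w /\ exists (phi : qf_formula tau n.+1) k, sat M phi a /\
    forall x, ~ w x -> sat M phi (replace a k x) -> ~ X (w `|` [set x]).
Proof.
move=> H; apply: contrapT => H'; apply: H => n a aw phi k s; apply: contrapT => H.
apply: H'; exists n, a; split=> //; exists phi, k; split=> // x wx sx Xx.
by apply: H; exists x.
Qed.

End Ranks.

Lemma wo_least (W : wellorder) (S : W -> Prop) a : S a ->
  exists b, [/\ S b, b = a \/ wo_lt b a & forall c, wo_lt c b -> ~ S c].
Proof.
elim/(well_founded_ind (wo_wf (w := W))): a => a IH Sa.
case: (pselect (exists2 c, wo_lt c a & S c)) => [[c ca Sc]|H].
  have [b [Sb bc Hb]] := IH c ca Sc; exists b; split=> //; right.
  by case: bc => [->//|bc]; apply: wo_trans ca.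
by exists a; split=> //; [left | move=> c ca Sc; apply: H; exists c].
Qed.

Section Labels.
Variables (eps lambda : wellorder) (tau : vocabulary) (M : model tau lambda).
Variable delta : eps.
Hypotheses (eps_countable : forall a : eps, countable [set b : eps | wo_lt b a])
  (tau_countable : countable_vocabulary tau)
  (rkM : forall w : set lambda, finite_set w -> w !=set0 -> rk_le M delta w).

Let L : eqType := {classic lambda}.
Variable x0 : L.
Implicit Types (w v : seq L).

Let els w : set lambda := [set x | (x : L) \in w].

(** A witness for the rank of a tuple. Enumerations are stored as positions in the tuple, so that a
    witness can be carried over to other tuples. [ld_neg] marks rank -1, where [ld_rk] is a
    dummy. *)
Record label_data := LabelData {
  ld_neg : bool;
  ld_rk : eps;
  ld_n : nat;
  ld_pos : seq nat;
  ld_phi : qf_formula tau ld_n.+1;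
  ld_k : 'I_ld_n.+1 }.

Let arg w (d : label_data) : 'I_(ld_n d).+1 -> lambda :=
  fun i => nth x0 w (nth 0 (ld_pos d) i).

Arguments arg : clear implicits.

(** [ld_rk] is the least ordinal at which the successor step fails, and the formula and the variable
    witness this failure. *)
Record good w (d : label_data) : Prop := Good {
  good_enum : enumerates (arg w d) (els w);
  good_sat : sat M (ld_phi d) (arg w d);
  good_pos : forall i : 'I_(ld_n d).+1, (nth 0 (ld_pos d) i < size w)%N;
  good_neg : ld_neg d -> countable [set x | sat M (ld_phi d) (replace (arg w d) (ld_k d) x)];
  good_rk : ~~ ld_neg d -> [/\ ld_rk d = delta \/ wo_lt (ld_rk d) delta,
    rk_ge0 M (els w),
    forall beta, wo_lt beta (ld_rk d) -> rk_geS M (rk_ge M beta) (els w) &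
    forall x, ~ els w x -> sat M (ld_phi d) (replace (arg w d) (ld_k d) x) ->
      ~ rk_ge M (ld_rk d) (els w `|` [set x])] }.

Lemma good_exists w : (0 < size w)%N -> exists d, good w d.
Proof.
move=> w0.
have fw : finite_set (els w) := @finite_seq L w.
have nw : els w !=set0.
  by case: w w0 {fw} => // a w _; exists a; rewrite /els /= inE eqxx.
have argE n (a : 'I_n.+1 -> lambda) : enumerates a (els w) ->
    let t := [seq index (a i : L) w | i <- enum 'I_n.+1] in
    (fun i : 'I_n.+1 => nth x0 w (nth 0 t i)) = a /\
    forall i : 'I_n.+1, (nth 0 t i < size w)%N.
  move=> [_ ra]; have aw i : (a i : L) \in w.
    by have : els w (a i) by rewrite -ra; exists i.
  have tE i : nth 0 [seq index (a i : L) w | i <- enum 'I_n.+1] (nat_of_ord i) =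
      index (a i : L) w.
    exact: nth_map_enum.
  by split=> [|i]; [apply/funext => i|]; rewrite tE ?nth_index ?index_mem.
have neg : rk_minus1 M (els w) -> exists d, good w d.
  move=> /rk_minus1P[n [a [aw [phi [k [s c]]]]]].
  have [e lt] := argE n a aw.
  exists (@LabelData true delta n [seq index (a i : L) w | i <- enum 'I_n.+1] phi k).
  by split=> //=; rewrite /arg /= e.
case: (pselect (rk_ge0 M (els w))) => [ge0|/neg//].
have [/neg//|[alpha [ad [_ nS]]]] := rkM fw nw.
have [b [nSb ba Hb]] := wo_least (S := fun al => ~ rk_geS M (rk_ge M al) (els w)) nS.
have [n [a [aw [phi [k [s c]]]]]] := not_rk_geSP nSb.
have [e lt] := argE n a aw.
exists (@LabelData false b n [seq index (a i : L) w | i <- enum 'I_n.+1] phi k).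
split=> //=; rewrite /arg /= ?e // => _; split=> //.
- case: ad ba => [<-|ad] [->|ba]; [by left|by right|by right|right].
  exact: wo_trans ad.
- by move=> beta bb; apply: contrapT; apply: Hb.
Qed.

(** [None] stands for rank -1. *)
Let opt_lt (o o' : option eps) : Prop :=
  match o, o' with
  | None, Some _ => True
  | Some a, Some b => wo_lt a b
  | _, None => False
  end.

Let opt_lt_wf : well_founded opt_lt.
Proof.
have H0 : Acc opt_lt None by split=> -[].
case=> [a|//]; elim/(well_founded_ind (wo_wf (w := eps))): a => a IH.
by split=> -[b /= /IH|].
Qed.

(* The label of [w] records a formula witnessing the rank of [w], the position of
   the variable to be moved, the rank and, when the rank is -1, the number of the
   moved point in an enumeration of the countable set defined by the formula. *)
Lemma rank_labels : exists (lab pos : seq L -> nat) (Rk : Type) (rk : seq L -> Rk)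
    (lt : Rk -> Rk -> Prop),
  [/\ well_founded lt,
  forall w w', (0 < size w)%N -> size w = size w' -> lab w = lab w' ->
    pos w = pos w' /\ rk w = rk w' &
  forall w, (0 < size w)%N -> (pos w < size w)%N /\ forall x, x \notin w ->
    uniq w -> lab (set_nth x0 w (pos w) x) = lab w -> lt (rk (rcons w x)) (rk w)].
Proof.
have [cf Hcf] := countable_code tau_countable.1.
have [cr Hcr] := countable_code tau_countable.2.
have cf_inj : injective cf by move=> f g; apply: Hcf.
have cr_inj : injective cr by move=> f g; apply: Hcr.
have : countable [set b : eps | b = delta \/ wo_lt b delta].
  have -> : [set b : eps | b = delta \/ wo_lt b delta] =
    [set delta] `|` [set b | wo_lt b delta] by [].
  by apply: countableU => //; apply: countable1.
move=> /countable_code[ce ce_inj].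
(* A numbering of every countable set; for other sets it is a dummy. *)
have Hnum (S : set lambda) : exists f : lambda -> nat,
    countable S -> forall x y, S x -> S y -> f x = f y -> x = y.
  case: (pselect (countable S)) => [/countable_code[f Hf]|nS]; first by exists f.
  by exists (fun=> 0).
have [num num_inj] := choice Hnum.
have d0 : label_data := @LabelData true delta 0 [::] (qf_eq (tvar _ ord0) (tvar _ ord0)) ord0.
have Hdat w : exists d, (0 < size w)%N -> good w d.
  by case: (ltnP 0 (size w)) => [/good_exists[d Hd]|_]; [exists d | exists d0].
have [dat Hd] := choice Hdat.
pose fam w := [set x | sat M (ld_phi (dat w)) (replace (arg w (dat w)) (ld_k (dat w)) x)].
pose idx w := if ld_neg (dat w) then num (fam w) (arg w (dat w) (ld_k (dat w))) else 0.
pose lab w := pickle (ld_neg (dat w), ce (ld_rk (dat w)), ld_n (dat w),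
  ld_pos (dat w), formula_code cf cr (ld_phi (dat w)), nat_of_ord (ld_k (dat w)), idx w).
pose rk w := if ld_neg (dat w) then None else Some (ld_rk (dat w)).
pose pos w := nth 0 (ld_pos (dat w)) (ld_k (dat w)).
(* The formula and its variable have types that depend on [ld_n], so they are compared as dependent
   pairs. *)
have labE w w' : lab w = lab w' -> [/\ ld_neg (dat w) = ld_neg (dat w'),
   ce (ld_rk (dat w)) = ce (ld_rk (dat w')), ld_pos (dat w) = ld_pos (dat w'),
   idx w = idx w' & existT (fun n => qf_formula tau n.+1 * 'I_n.+1)%type
     (ld_n (dat w)) (ld_phi (dat w), ld_k (dat w)) =
   existT _ (ld_n (dat w')) (ld_phi (dat w'), ld_k (dat w'))].
  move=> /(pcan_inj pickleK); case; case: (dat w) => ? ? n ? phi k.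
  case: (dat w') => ? ? n' ? phi' k' /= -> -> e -> + + ->; subst n'.
  by move=> /(formula_code_inj cf_inj cr_inj) -> /val_inj ->.
exists lab, pos, (option eps), rk, opt_lt; split=> //.
  move=> w w' w0 ws /labE [en er ep _ ek]; split.
    by rewrite /pos ep; have /(congr1 (fun z => nat_of_ord (projT2 z).2)) /= -> := ek.
  rewrite /rk en; case: ifP => // /negbT nn'; congr Some.
  have w'0 : (0 < size w')%N by rewrite -ws.
  have nn : ~~ ld_neg (dat w) by rewrite en.
  have [r1 _ _ _] := good_rk (Hd w w0) nn.
  have [r2 _ _ _] := good_rk (Hd w' w'0) nn'.
  exact: ce_inj er.
move=> w w0; have gw := Hd w w0; split; first exact: good_pos gw _.
move=> x xw uw le; set w' := set_nth x0 w (pos w) x in le.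
have sw' : size w' = size w.
  by rewrite size_set_nth; apply/maxn_idPr; exact: (good_pos gw).
have gw' : good w' (dat w') by apply: Hd; rewrite sw'.
have [en er ep ei ek] := labE _ _ le.
(* The enumeration is injective, so changing the entry of [w] at [pos w] changes exactly the
   variable [ld_k]. *)
have argE : existT (fun n => 'I_n.+1 -> lambda)%type (ld_n (dat w')) (arg w' (dat w')) =
    existT _ (ld_n (dat w)) (replace (arg w (dat w)) (ld_k (dat w)) x).
  have en' : ld_n (dat w') = ld_n (dat w) := congr1 (@projT1 _ _) ek.
  rewrite /arg ep /replace.
  have -> : (fun i : 'I_(ld_n (dat w)).+1 => if i == ld_k (dat w) then x else
       nth x0 w (nth 0 (ld_pos (dat w)) i)) =
     fun i => nth x0 w' (nth 0 (ld_pos (dat w)) i).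
    apply/funext => i; rewrite /w' nth_set_nth /= /pos.
    case: eqVneq => [->|ik]; first by rewrite eqxx.
    case: eqP => // e; case/eqP: ik; apply: (good_enum gw).1.
    by rewrite /arg e.
  by rewrite en'.
have xS : fam w x.
  have := good_sat gw'; rewrite /fam /=.
  case: (dat w) (dat w') ek argE => ? ? n ? phi k [? ? n' ? phi' k'] /= ek argE.
  have en' : n' = n := congr1 (@projT1 _ _) ek; subst n'.
  have /(congr1 fst) /= <- := existT_inj2 ek.
  by have <- := existT_inj2 argE.
(* In rank -1 the formula defines the same countable set from [w] and from [w']. Equal numbers make
   the two moved points equal, although [x] is not in [w]. *)
have nw : ~~ ld_neg (dat w).
  apply/negP => nw.
  have famE : fam w' = fam w.
    rewrite /fam; move: ek argE; clear.
    case: (dat w) (dat w') => ? ? n ? phi k [? ? n' ? phi' k'] /= ek argE.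
    have en' : n' = n := congr1 (@projT1 _ _) ek; subst n'.
    rewrite (existT_inj2 argE); have /= e := existT_inj2 ek; case: e => -> ->.
    apply/funext => y /=; congr (sat M phi _); apply/funext => i.
    by rewrite /replace; case: (i == k).
  have xE : arg w' (dat w') (ld_k (dat w')) = x.
    move: ek argE; clear; case: (dat w) (dat w') => ? ? n ? phi k [? ? n' ? phi' k'] /= ek argE.
    have en' : n' = n := congr1 (@projT1 _ _) ek; subst n'.
    rewrite (existT_inj2 argE); have /= e := existT_inj2 ek; case: e => _ ->.
    by rewrite /replace eqxx.
  have aS : fam w (arg w (dat w) (ld_k (dat w))).
    have := good_sat gw; rewrite /fam /=; congr (sat M _ _); apply/funext => i.
    by rewrite /replace; case: eqP => [->|].
  move: ei; rewrite /idx en nw famE xE => /esym e.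
  have ax := num_inj _ (good_neg gw nw) _ _ aS xS e.
  by move: xw; rewrite -ax mem_nth // (good_pos gw).
rewrite /rk (negPf nw); case: ifPn => //= nv.
have gv : good (rcons w x) (dat (rcons w x)) by apply: Hd; rewrite size_rcons.
have [rv _ _ _] := good_rk gv nv; have [_ ge0v geSv _] := good_rk gv nv.
have [rw _ _ nge] := good_rk gw nw.
have elsE : els (rcons w x) = els w `|` [set x].
  apply/seteqP; split=> y; rewrite /els /= mem_rcons inE.
    by case/orP => [/eqP|]; [right|left].
  by case=> [->|->]; rewrite ?eqxx ?orbT.
have nx : ~ els w x by apply/negP.
(* [x] satisfies the formula that witnesses the failure at [w], so the enlarged set does not reach
   the rank of [w]. *)
have {nge} := nge x nx xS; rewrite -elsE => nge.
case: (wo_tri (ld_rk (dat (rcons w x))) (ld_rk (dat w))) => // H; case: nge.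
apply: rk_ge_intro => // beta bw; apply: geSv.
by case: H => [->//|]; apply: wo_trans bw.
Qed.

End Labels.

(** * Cardinal arithmetic *)

Definition embeds (T U : Type) (S : set T) (S' : set U) := exists f : T -> U,
  (forall x, S x -> S' (f x)) /\ forall x y, S x -> S y -> f x = f y -> x = y.

Lemma embeds_card_le (T U : Type) (S : set T) (S' : set U) :
  embeds S S' -> S #<= S'.
Proof.
move=> [f [fS finj]]; apply: (@card_le_trans _ _ _ (f @` S)).
  have : f @` S #= S by apply: inj_card_eq => x y; rewrite !inE; apply: finj.
  by rewrite card_eq_sym => /card_eqPle[].
by apply: subset_card_le => _ [x Sx <-]; apply: fS.
Qed.

Lemma embeds_trans (T U V : Type) (S : set T) (S' : set U) (S'' : set V) :
  embeds S S' -> embeds S' S'' -> embeds S S''.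
Proof.
move=> [f [fS finj]] [g [gS ginj]]; exists (g \o f); split=> [x Sx|x y Sx Sy /= e].
  exact/gS/fS.
by apply: finj => //; apply: ginj => //; apply: fS.
Qed.

Lemma embeds_sub (T : Type) (S S' : set T) : S `<=` S' -> embeds S S'.
Proof. by move=> sub; exists id; split. Qed.

Lemma embeds_setX (T U : Type) (S : set T) (S' : set U) :
  embeds S S' -> embeds (S `*` S) (S' `*` S').
Proof.
move=> [f [fS finj]]; exists (fun z => (f z.1, f z.2)).
split=> [[x y] /= [Sx Sy]|[x y] [x' y'] /= [Sx Sy] [Sx' Sy'] [e e']].
  by split; apply: fS.
by congr pair; apply: finj.
Qed.

Lemma infinite_two (T : Type) (S : set T) : ~ finite_set S ->
  exists x y, [/\ S x, S y & x <> y].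
Proof.
move=> Sinf; apply: contrapT => H; apply: Sinf.
have [->|/set0P[x Sx]] := eqVneq S set0; first exact: finite_set0.
suff -> : S = [set x] by exact: finite_set1.
apply/seteqP; split=> [y Sy|y ->//]; apply: contrapT => yx.
by apply: H; exists y, x.
Qed.

Lemma embeds_setU1 (T : Type) (S : set T) z : ~ finite_set S ->
  embeds (S `|` [set z]) (S `*` S).
Proof.
move=> Sinf; have [u [u' [Su Su' uu']]] := infinite_two Sinf.
exists (fun y => if `[< S y >] then (y, u) else (u, u')).
split=> [y|x y]; first by case: asboolP.
move=> Sx Sy; case: asboolP => [Sx'|nx]; case: asboolP => [Sy'|ny] //.
- by case.
- by case=> _ /uu'.
- by case=> _ /esym /uu'.
by case: Sx Sy => [//|->] [//|->].
Qed.

(* [t] is sent to an element of [S] not used before: there is one because [S] does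
   not embed into the set of predecessors of [t]. *)
Lemma greedy (T U : Type) (R : T -> T -> Prop) (S : set U) :
  well_founded R -> (forall s t, R s t \/ s = t \/ R t s) ->
  (forall t, ~ embeds S [set s | R s t]) ->
  embeds [set: T] S.
Proof.
move=> wfR totR HS.
case: (pselect (exists t : T, True)) => [[t0 _]|nT]; last first.
  have nt : T -> False by move=> t; apply: nT; exists t.
  by exists (fun t => False_rect _ (nt t)); split=> t; case: (nt t).
have [u0 Su0] : exists u, S u.
  apply: contrapT => H; apply: (HS t0); exists (fun=> t0).
  by split=> x; [move=> Sx|move=> y Sx]; case: H; exists x.
pose step t (rec : forall s, R s t -> U) : U :=
  match pselect (exists u, S u /\ forall s (h : R s t), rec s h <> u) with
  | left e => projT1 (cid e) | right _ => u0 end.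
pose f := Fix wfR (fun=> U) step.
have fE t : f t = step t (fun s _ => f s).
  rewrite {1}/f Fix_eq // => {}t g h gh; congr step.
  by apply: functional_extensionality_dep => s; apply: funext => r; apply: gh.
have fP t : S (f t) /\ forall s, R s t -> f s <> f t.
  rewrite [f t]fE /step; case: pselect => [e|ne].
    by case: (projT2 (cid e)) => ? H; split=> // s st; apply: H st.
  exfalso; apply: (HS t).
  have Hs u : exists s, S u -> R s t /\ f s = u.
    case: (pselect (S u)) => [Su|nS]; last by exists t.
    apply: contrapT => H; apply: ne; exists u; split=> // s st e.
    by apply: H; exists s.
  have [g Hg] := choice Hs; exists g; split=> [u /Hg[]//|u v /Hg[_ {2}<-] /Hg[_ {2}<-] ->].
  by [].
exists f; split=> [t _|s t _ _ e]; first exact: (fP t).1.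
case: (totR s t) => [st|[//|ts]]; first by case: ((fP t).2 s st).
by case: ((fP s).2 t ts).
Qed.

(** * Squares of infinite cardinals *)

Section Pairing.
Variable W : wellorder.
Implicit Types a b c m : W.

Let seg a : set W := [set b | wo_lt b a].
Let omax a b : W := if `[< wo_lt a b >] then b else a.

Let le a b := wo_lt a b \/ a = b.

Lemma omax_ge a b : le a (omax a b) /\ le b (omax a b).
Proof.
rewrite /omax; case: asboolP => [ab|nab]; first by split; [left|right].
split; first by right.
by case: (wo_tri a b) => [//|[->|]]; [right|left].
Qed.

Lemma omax_or a b : omax a b = a \/ omax a b = b.
Proof. by rewrite /omax; case: asboolP; [right|left]. Qed.

Lemma le_wo_trans b a c : le a b -> le b c -> le a c.
Proof.
move=> [ab|->//] [bc|<-]; [left|by left].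
exact: wo_trans bc.
Qed.

(** The canonical well-ordering of pairs: by maximum, then lexicographically. *)
Definition goedel (x y : W * W) : Prop :=
  wo_lt (omax x.1 x.2) (omax y.1 y.2) \/
  omax x.1 x.2 = omax y.1 y.2 /\
    (wo_lt x.1 y.1 \/ x.1 = y.1 /\ wo_lt x.2 y.2).

Lemma goedel_total x y : goedel x y \/ x = y \/ goedel y x.
Proof.
case: x y => a b [c d]; rewrite /goedel /=.
case: (wo_tri (omax a b) (omax c d)) => [|[e|]]; [by left; left| |by right; right; left].
case: (wo_tri a c) => [|[e1|]]; [by left; right; split=>//; left| |].
  case: (wo_tri b d) => [|[e2|]].
  - by left; right; split=> //; right.
  - by right; left; rewrite e1 e2.
  - by right; right; right; split=> //; right.
by right; right; right; split=> //; left.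
Qed.

Lemma goedel_wf : well_founded goedel.
Proof.
suff H m : forall a b d, omax a b = m -> d = (a, b) -> Acc goedel d.
  by case=> a b; apply: H.
elim/(well_founded_ind (wo_wf (w := W))): m => m IHm a.
elim/(well_founded_ind (wo_wf (w := W))): a => a IHa b.
elim/(well_founded_ind (wo_wf (w := W))): b => b IHb d e ->.
split=> -[c d']; rewrite /goedel /= e => -[lt|[e' [lt|[ca lt]]]].
- exact: (IHm _ lt c d').
- exact: (IHa c lt d').
- by rewrite ca; apply: (IHb d' lt) => //; rewrite -ca.
Qed.

(** The predecessors of a pair with maximum m lie in the square of the segment up to m. If [D]
    embedded into them, the pairing assumed for segments would shrink this square to the segment
    below m, into which [D] does not embed. *)
Lemma initial_pairing (D : set W) : ~ finite_set D ->
  (forall a, D a -> ~ embeds D (seg a)) ->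
  (forall a, D a -> ~ finite_set (seg a) -> embeds (seg a `*` seg a) (seg a)) ->
  embeds (D `*` D) D.
Proof.
move=> Dinf Dcard IH.
pose T := {x : W * W | D x.1 /\ D x.2}.
pose R (s t : T) := goedel (sval s) (sval t).
suff [f [fD finj]] : embeds [set: T] D.
  have [u Du] : exists u, D u by have [u [_ [Du _ _]]] := infinite_two Dinf; exists u.
  exists (fun x => if pselect (D x.1 /\ D x.2) is left h then f (exist _ x h) else u).
  split=> [x Dx|x y Dx Dy]; case: pselect => [h|//]; first exact: fD.
  by case: pselect => [h'|//] /(finj _ _ I I) [].
apply: (@greedy T W R).
- exact: (Inverse_Image.wf_inverse_image _ _ goedel (@proj1_sig _ _) goedel_wf).
- move=> [s hs] [t ht]; case: (goedel_total s t) => [|[e|]]; [by left| |by right; right].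
  by right; left; subst t; congr exist; apply: Prop_irrelevance.
move=> [[a b] /= [Da Db]] Hemb.
pose m := omax a b.
have Dm : D m by rewrite /m; case: (omax_or a b) => ->.
pose down : set W := seg m `|` [set m].
have Hd : embeds D (down `*` down).
  apply: embeds_trans Hemb _; exists (@proj1_sig _ _).
  split=> [[[c d] /= hcd] H|[x hx] [y hy] _ _ /= e]; last first.
    by subst y; congr exist; apply: Prop_irrelevance.
  have [c1 d1] := omax_ge c d.
  have cm : le (omax c d) m by case: H => [H|[H _]]; [left|right].
  have toD e : le e m -> down e by case=> H'; [left|right].
  by split; apply: toD; apply: le_wo_trans cm.
case: (pselect (finite_set (seg m))) => [fin|inf].
  apply: Dinf; apply: card_le_finite (embeds_card_le Hd) _.
  by apply: finite_setX; rewrite finite_setU; split=> //; apply: finite_set1.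
have e1 : embeds down (seg m) := embeds_trans (embeds_setU1 m inf) (IH m Dm inf).
apply: (Dcard m Dm).
exact: embeds_trans Hd (embeds_trans (embeds_setX e1) (IH m Dm inf)).
Qed.

(** Either the segment embeds into a smaller one and inherits its pairing, or [a] behaves like a
    cardinal. *)
Lemma seg_pairing a : ~ finite_set (seg a) -> embeds (seg a `*` seg a) (seg a).
Proof.
elim/(well_founded_ind (wo_wf (w := W))): a => a IH ainf.
case: (pselect (exists2 b, wo_lt b a & embeds (seg a) (seg b))) => [[b ba e]|H].
  have binf : ~ finite_set (seg b).
    by move=> bf; apply: ainf; apply: card_le_finite (embeds_card_le e) bf.
  apply: embeds_trans (embeds_setX e) _; apply: embeds_trans (IH b ba binf) _.
  by apply: embeds_sub => c cb; apply: wo_trans ba.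
apply: (initial_pairing ainf) => [b ba e|b ba]; last exact: (IH b ba).
by apply: H; exists b.
Qed.

Hypotheses (Wcard : is_cardinal W) (Winf : ~ finite_set [set: W]).

Lemma cardinal_pairing : exists g : W * W -> W, injective g.
Proof.
have [||g [_ ginj]] := @initial_pairing [set: W] Winf.
- move=> a _ e; apply: (Wcard (a := a)); apply/card_eqPle; split.
    exact: card_leT.
  exact: embeds_card_le.
- by move=> a _; apply: seg_pairing.
- by exists g => x y; apply: ginj.
Qed.

Lemma cardinal_seq (C : countType) : exists h : seq W * C -> W, injective h.
Proof.
have [g ginj] := cardinal_pairing.
have [u [u' [_ _ uu']]] := infinite_two Winf.
(* The second coordinate, [u] or [u'], tells a nonempty sequence from the empty one. *)
pose code := fix code (s : seq W) : W :=
  if s is a :: s' then g (g (a, code s'), u) else g (u, u').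
have code_inj : injective code.
  elim=> [|a s IH] [|b t] //=.
  - by move/ginj => [_ /esym].
  - by move/ginj => [_].
  - by move/ginj => [] /ginj [-> /IH ->].
(* An element of the countable type is coded by the length of a constant sequence. *)
exists (fun x => g (code x.1, code (nseq (pickle x.2) u))) => -[s c] [t d] /ginj [].
move=> /code_inj -> /code_inj /(congr1 size); rewrite !size_nseq.
by move/(pcan_inj pickleK) => ->.
Qed.

End Pairing.

(** * The generic set *)

Section GenericSet.
Variables (lambda : wellorder) (io : nat) (lab : seq {classic lambda} -> nat).
Let L : eqType := {classic lambda}.
Variable x0 : L.
Local Notation P := (poset x0 io lab).
Local Notation nn := (nat_name P).
Implicit Types (p q r : P) (m n i j k : nat)
  (v : nat -> bool).

Let dt (p : P) : pre L := sval p.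

Lemma dense_supp p M (s : seq L) : exists q,
  [/\ q <<= p, M <= len (dt q) & {subset s <= supp (dt q)}].
Proof.
have [q [qp Mq sq]] := density p M s; exists q; split=> // a ls.
by rewrite sq mem_cat ls orbT.
Qed.

(** Once the indices in [s] are present and level [n] is reached, the value is final; hence [gname]
    names a single real. *)
Definition coherent (s : seq L) (F : pre L -> nat -> bool) := forall p q n,
  q <<= p -> {subset s <= supp (dt p)} -> n < len (dt p) -> F (dt q) n = F (dt p) n.

Definition gname (s : seq L) (F : pre L -> nat -> bool) : name P :=
  real_name (fun n b p => [/\ {subset s <= supp (dt p)}, n < len (dt p) & b = F (dt p) n]).

Lemma cantor_gname s F p : coherent s F -> forces (cantor (gname s F)) p.
Proof.
move=> co; apply: cantor_real.
  move=> n b b' q c c' _ qc qc' [sc nc ->] [sc' nc' ->].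
  by rewrite -(co c q n qc sc nc) (co c' q n).
move=> n q _; have [r [rq nr sr]] := dense_supp q n.+1 s.
by exists r; split=> //; exists (F (dt r) n), r.
Qed.

Lemma val_gname s F p n : {subset s <= supp (dt p)} -> n < len (dt p) ->
  val (gname s F) n (F (dt p) n) p.
Proof. by move=> sp np; apply: val_real_intro. Qed.

Lemma val_gname_eq s F p n b : coherent s F -> {subset s <= supp (dt p)} ->
  n < len (dt p) -> val (gname s F) n b p -> b = F (dt p) n.
Proof.
by move=> co sp np vb; apply: (cantor_excl (cantor_gname p co) vb); apply: val_gname.
Qed.

(* The names of the reals eta_a, of the points eta_a + nu_{ab,i} of B and of the
   common points nu_{ab,i} and nu_{ab,i} + eta_a + eta_b of B + eta_a and
   B + eta_b. *)
Definition edot (a : L) : name P := gname [:: a] (fun x n => eta x a n).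

Definition bdot (a b : L) i : name P :=
  gname [:: a; b] (fun x n => eta x a n (+) nu x a b i n).

Definition zdot (a b : L) i (s : bool) : name P :=
  gname [:: a; b] (fun x n => nu x a b i n (+) (s && (eta x a n (+) eta x b n))).

Lemma coherent_eta (a : L) : coherent [:: a] (fun x n => eta x a n).
Proof.
by move=> p q n qp sp np; apply: (le_eta qp) => //; apply: sp; rewrite inE.
Qed.

Lemma coherent_b (a b : L) i : a != b -> i < io ->
  coherent [:: a; b] (fun x n => eta x a n (+) nu x a b i n).
Proof.
move=> ab ii p q n qp sp np.
have ap : a \in supp (dt p) by apply: sp; rewrite inE eqxx.
have bp : b \in supp (dt p) by apply: sp; rewrite !inE eqxx orbT.
by rewrite (le_eta qp ap np) (le_nu qp ap bp ab ii np).
Qed.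

Lemma coherent_z (a b : L) i s : a != b -> i < io ->
  coherent [:: a; b] (fun x n => nu x a b i n (+) (s && (eta x a n (+) eta x b n))).
Proof.
move=> ab ii p q n qp sp np.
have ap : a \in supp (dt p) by apply: sp; rewrite inE eqxx.
have bp : b \in supp (dt p) by apply: sp; rewrite !inE eqxx orbT.
by rewrite (le_eta qp ap np) (le_eta qp bp np) (le_nu qp ap bp ab ii np).
Qed.

(** [r <<= p] stands for p being in the generic filter: at every level [len p] above [m] the real
    passes through a node that [p] has in the tree. These nodes are final by [le_tree]. *)
Definition branch m (x : name P) q := forall p r v, r <<= q -> r <<= p -> m < len (dt p) ->
  (forall j, j < len (dt p) -> val x j (v j) r) -> node io (dt p) m v.

Definition tree_index m := {Rq : (nat -> bool -> P -> Prop) * P |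
  forces (cantor (real_name Rq.1)) Rq.2 /\ branch m (real_name Rq.1) Rq.2}.

Definition tree_name m : name P :=
  Name (tree_index m) (fun d => real_name (sval d).1) (fun d => (sval d).2).

Definition Bname : name P := Name {m : nat & tree_index m}
  (fun d => real_name (sval (projT2 d)).1) (fun d => (sval (projT2 d)).2).

Lemma mem_tree m x q :
  forces (x ∈ tree_name m)%F q <-> forces (cantor x) q /\ branch m x q.
Proof.
split=> [H|[Hx Hb]].
  split.
    apply: forces_dense => q' q'q; have [r [rq [[[R c] /= [HR _]] [rc e]]]] := H q' q'q.
    exists r; split=> //; apply: (fext_elim (@fext_cantor P) (feqC e)).
    exact: forces_mono HR.
  move=> p r v rq rp mp Hv.
  have [s [sr [[[R c] /= [_ HR]] [sc e]]]] := H r rq.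
  apply: (HR p s v) => // [|j jp]; first exact: strans rp.
  exact: val_eq e (val_mono sr (Hv j jp)).
have e := nice_eq Hx.
have Hn : forces (cantor (nice q x)) q by apply: (fext_elim (@fext_cantor P) e).
have Hbn : branch m (nice q x) q.
  move=> p r v rq rp mp Hv; apply: (Hb p r v) => // j jp.
  exact: val_eq (forces_eq_mono rq (feqC e)) (Hv j jp).
pose i : tree_index m :=
  exist _ ((fun n b r => r <<= q /\ val x n b r), q) (conj Hn Hbn).
have := @fmem_name P (tree_index m) (fun d => real_name (sval d).1)
  (fun d => (sval d).2) i q (srefl q).
exact: fmem_eql (feqC e).
Qed.

Lemma mem_B x q : forces (x ∈ Bname)%F q <->
  forall q', q' <<= q -> exists r, r <<= q' /\ exists m, forces (x ∈ tree_name m)%F r.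
Proof.
split=> H q' q'q.
  have [r [rq [[m d] [rd e]]]] := H q' q'q; exists r; split=> //; exists m.
  apply: fmem_eql (feqC e) _.
  exact: (@fmem_name P (tree_index m) (fun d => real_name (sval d).1)
    (fun d => (sval d).2) d).
have [r [rq [m Hm]]] := H q' q'q; have [s [sr [d [sd e]]]] := Hm r (srefl r).
exists s; split; first exact: strans rq.
by exists (existT _ m d).
Qed.

Lemma tree_B x m q : forces (x ∈ tree_name m)%F q -> forces (x ∈ Bname)%F q.
Proof.
move=> H; apply/mem_B => r rq; exists r; split=> //; exists m.
exact: forces_mono H.
Qed.

Lemma B_cantor x q : forces (x ∈ Bname)%F q -> forces (cantor x) q.
Proof.
move/mem_B => H; apply: forces_dense => r rq; have [s [sr [m /mem_tree[Hs _]]]] := H r rq.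
by exists s.
Qed.

(** The pair may be absent from [p']; then [le_tree] says that at level [len p'] its point still
    follows a node of [p'] of the same color. *)
Lemma bdot_tree (a b : L) i p : a \in supp (dt p) -> b \in supp (dt p) -> a != b -> i < io ->
  forces (bdot a b i ∈ tree_name (col (dt p) a b))%F p.
Proof.
move=> ap bp ab ii; have co := coherent_b ab ii; apply/mem_tree; split.
  exact: cantor_gname.
move=> p' r v rp rp' mp Hv.
have ar : a \in supp (dt r) by apply: (le_supp rp).
have br : b \in supp (dt r) by apply: (le_supp rp).
have sr : {subset [:: a; b] <= supp (dt r)}.
  by move=> c; rewrite !inE => /orP[] /eqP ->.
have cr : col (dt r) a b = col (dt p) a b by apply: (le_col rp).
have [|a' [b' [i' [[au bu ab'] [ii' ce Hj]]]]] := le_tree rp' ar br ab ii.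
  by rewrite cr.
exists a', b', i'; split=> //; split=> //; first by rewrite ce.
move=> j jp; rewrite -Hj //.
by apply: (val_gname_eq co sr _ (Hv j jp)); apply: leq_trans (le_len rp').
Qed.

(** A failure of [branch] is seen on finitely many values, those below the length of some condition,
    so a whole neighborhood is excluded. *)
Lemma tree_closed m p : forces (is_closed (tree_name m)) p.
Proof.
apply/f_and; split; first by apply/f_allin => x q qp /mem_tree[].
apply/f_all => x; apply/f_imp => q qp /f_and[Hx /f_not nx].
apply/f_exin => q' q'q.
have Hx' := forces_mono q'q Hx.
have : ~ branch m x q' by move=> H; apply: (nx q' q'q); apply/mem_tree.
move=> /existsNP[p' /existsNP[r /existsNP[v]]].
move=> /not_implyP[rq /not_implyP[rp /not_implyP[mp /not_implyP[Hv nnode]]]].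
exists r; split=> //; exists (nn (len (dt p'))); split; first exact: nat_name_omega.
apply/f_all => y; apply/f_imp => s sr /f_and[Hy Hag].
apply/f_not => t ts /mem_tree[_ Hb]; apply: nnode.
apply: (Hb p' t v) => //; first exact: strans (strans ts sr) rp.
move=> j jp; apply: (agree_val (forces_mono ts Hag) jp).
exact: val_mono (strans ts sr) (Hv j jp).
Qed.

Lemma fext_is_closed : fext (fun C : name P => is_closed C).
Proof.
move=> C C' p e.
by rewrite /is_closed /cantor_subset /cantor /maps_into /function_on /agree; fcongr.
Qed.

Lemma B_Sigma02 p : forces (is_Sigma02 Bname) p.
Proof.
apply/f_and; split; first by apply/f_allin => x q _; apply: B_cantor.
pose f := graph_name (fun m => nn m) tree_name (fun=> weakest P).
have app_f q m : forces (app f (nn m) (tree_name m)) q.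
  by apply: (app_graph_intro (i := m)); apply: weakestP.
apply: (f_ex_intro (x := f)); apply/f_and; split.
  apply: maps_into_graph.
  - exact: fext_is_closed.
  - by move=> m q _ _; apply: nat_name_omega.
  - move=> x q qp /mem_omega_name Hx; have [r [rq [m e]]] := Hx q (srefl q).
    by exists r; split=> //; exists m; split=> //; apply: weakestP.
  - by move=> m m' q _ _ _ /nat_name_inj ->.
  - by move=> m q _ _; apply: tree_closed.
apply/f_all => x; apply/f_iff => q qp; split=> [/mem_B H|/f_exin H].
  apply/f_exin => q' q'q; have [r [rq [m Hm]]] := H q' q'q.
  exists r; split=> //; exists (nn m); split; first exact: nat_name_omega.
  by apply: (f_ex_intro (x := tree_name m)); apply/f_and.
apply/mem_B => q' q'q; have [r [rq [u [_ /f_ex Hu]]]] := H q' q'q.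
have [s [sr [C /f_and[/app_graph HC xC]]]] := Hu r (srefl r).
have [t [ts [m [_ _ e]]]] := HC s (srefl s).
exists t; split; first exact: strans ts (strans sr rq).
by exists m; apply: fmem_eqr e _; apply: forces_mono xC.
Qed.

Lemma eta_neq (a b : L) p : a != b -> a \in supp (dt p) -> b \in supp (dt p) ->
  exists j, [/\ j < len (dt p), eta (dt p) a j = true & eta (dt p) b j = false].
Proof.
move=> ab ap bp; have [_ wE _ _] := svalP p.
have [j [jn Hj _]] := wE a ap; exists j; split=> //; rewrite [LHS]Hj ?eqxx //.
by rewrite eq_sym (negPf ab).
Qed.

Lemma edot_inj (a b : L) p : forces_eq (edot a) (edot b) p -> a = b.
Proof.
move=> e; apply: contrapT => /eqP ab.
have [q [qp _ sq]] := dense_supp p 0 [:: a; b].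
have aq : a \in supp (dt q) by apply: sq; rewrite inE eqxx.
have bq : b \in supp (dt q) by apply: sq; rewrite !inE eqxx orbT.
have [j [jn Ha Hb]] := eta_neq ab aq bq.
have sa : {subset [:: a] <= supp (dt q)} by move=> c; rewrite inE => /eqP ->.
have sb : {subset [:: b] <= supp (dt q)} by move=> c; rewrite inE => /eqP ->.
have v1 := val_gname (F := fun x n => eta x a n) sa jn.
have := val_gname_eq (@coherent_eta b) sb jn (val_eq (forces_eq_mono qp e) v1).
by rewrite Ha Hb.
Qed.

Lemma in_translate_zdot (a b c : L) i s p : a != b -> i < io -> c \in [:: a; b] ->
  forces (in_translate Bname (edot c) (zdot a b i s)) p.
Proof.
move=> ab ii cab; apply/f_exin => p' p'p.
have [q [qp _ sq]] := dense_supp p' 0 [:: a; b].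
have aq : a \in supp (dt q) by apply: sq; rewrite inE eqxx.
have bq : b \in supp (dt q) by apply: sq; rewrite !inE eqxx orbT.
have ba : b != a by rewrite eq_sym.
(* nu = (eta_c + nu) + eta_c, so for [s = false] the point of B starts at [c]; for [s = true] it
   starts at the other end of the pair. *)
pose d := if (c == a) (+) s then (a, b) else (b, a).
have [du dv dd] : [/\ d.1 \in supp (dt q), d.2 \in supp (dt q) & d.1 != d.2].
  by rewrite /d; case: ifP.
exists q; split=> //; exists (bdot d.1 d.2 i); split.
  exact: tree_B (bdot_tree du dv dd ii).
apply: is_sum_intro.
- exact: cantor_gname (coherent_b dd ii).
- exact: cantor_gname (@coherent_eta c).
- exact: cantor_gname (coherent_z _ ab ii).
move=> n b1 b2 r rq v1 v2; apply: val_dense => r' r'r.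
have [t [tr nt _]] := dense_supp r' n.+1 [::].
have tq := strans tr (strans r'r rq).
have st : {subset [:: a; b] <= supp (dt t)} by move=> e /sq /(le_supp tq).
have sd : {subset [:: d.1; d.2] <= supp (dt t)}.
  by move=> e; rewrite !inE => /orP[] /eqP ->; apply: (le_supp tq).
have sc : {subset [:: c] <= supp (dt t)} by move=> e; rewrite inE => /eqP ->; apply: st.
exists t; split=> //; have trr := strans tr r'r.
rewrite (val_gname_eq (coherent_b dd ii) sd nt (val_mono trr v1)).
rewrite (val_gname_eq (@coherent_eta c) sc nt (val_mono trr v2)).
have -> : eta (dt t) d.1 n (+) nu (dt t) d.1 d.2 i n (+) eta (dt t) c n =
    nu (dt t) a b i n (+) (s && (eta (dt t) a n (+) eta (dt t) b n)).
  move: cab; rewrite /d !inE; case: eqP => [->|_] /= => [_|/eqP ->]; case: (s) => /=;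
    rewrite ?[nu _ b a]nuC; case: (eta (dt t) a n); case: (eta (dt t) b n);
    by case: (nu (dt t) a b i n).
exact: val_gname st nt.
Qed.

Lemma zdot_inj (a b : L) i s i' s' p : a != b -> i < io -> i' < io ->
  forces_eq (zdot a b i s) (zdot a b i' s') p -> (i, s) = (i', s').
Proof.
move=> ab ii ii' e.
have [q [qp _ sq]] := dense_supp p 0 [:: a; b].
have aq : a \in supp (dt q) by apply: sq; rewrite inE eqxx.
have bq : b \in supp (dt q) by apply: sq; rewrite !inE eqxx orbT.
have key j : j < len (dt q) ->
    nu (dt q) a b i j (+) (s && (eta (dt q) a j (+) eta (dt q) b j)) =
    nu (dt q) a b i' j (+) (s' && (eta (dt q) a j (+) eta (dt q) b j)).
  move=> jn; apply: (val_gname_eq (coherent_z s' ab ii') sq jn).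
  apply: val_eq (forces_eq_mono qp e) _.
  exact: (val_gname (F := fun x n =>
    nu x a b i n (+) (s && (eta x a n (+) eta x b n)))).
have [_ wE wN _] := svalP q.
have [j [jn Hj Hn]] := wE a aq.
have := key j jn; rewrite !Hj // !Hn // eqxx eq_sym (negPf ab) /= !andbT => ->.
have [k [kn Hk Hm]] := wN a b i aq bq ab ii.
have := key k kn; rewrite !Hk // !Hm // same_refl !andbF !addbF.
by move=> /esym/andP[/eqP ->].
Qed.

Lemma overlap_zdot (a b c d : L) p : a != b -> c \in [:: a; b] -> d \in [:: a; b] ->
  forces (overlap_geq (2 * io) Bname (edot c) (edot d)) p.
Proof.
move=> ab ca da.
(* [k] modulo [io] selects nu_{ab,i}, and [io <= k] tells whether eta_a + eta_b is added. *)
apply: (card_geq_intro (z := fun k => zdot a b (k %% io) (io <= k))).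
- exact: fext_overlap_body.
- move=> k kk; have io0 : 0 < io by case: (io) kk => //; rewrite muln0.
  by apply/f_and; split; apply: in_translate_zdot => //; apply: ltn_pmod.
move=> k k' q kk kk' _; have io0 : 0 < io by case: (io) kk => //; rewrite muln0.
move=> /(zdot_inj ab (ltn_pmod _ io0) (ltn_pmod _ io0)) [e1 e2].
have decomp k1 : k1 < 2 * io -> k1 = (io <= k1) * io + k1 %% io.
  rewrite mul2n -addnn => k1n; case: leqP => k1io; last by rewrite modn_small.
  rewrite mul1n -[in RHS](subnKC k1io) modnDl modn_small ?subnKC //.
  by rewrite ltn_subLR.
by rewrite (decomp k) // (decomp k') // e1 e2.
Qed.

Lemma overlapping_translates p : (exists a b : L, a != b) ->
  forces (has_overlapping_translates (2 * io) lambda Bname) p.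
Proof.
move=> [a0 [b0 ab0]].
pose h := graph_name (D := lambda) (fun a => check_elt P a) edot (fun=> weakest P).
have Hh : forces (maps_into h (check P lambda) (fun x => cantor x)) p.
  apply: maps_into_graph.
  - exact: fext_cantor.
  - by move=> a q _ _; apply: check_elt_in.
  - move=> x q qp /mem_check Hx; have [r [rq [a e]]] := Hx q (srefl q).
    by exists r; split=> //; exists a; split=> //; apply: weakestP.
  - by move=> a b q _ _ _ /check_elt_inj ->.
  - by move=> a q _ _; apply: cantor_gname (@coherent_eta a).
have app_h q (a : lambda) y : forces (app h (check_elt P a) y) q -> forces_eq y (edot a) q.
  move/app_graph => H; apply: forces_eq_dense => r rq.
  by have [s [sr [b [_ /check_elt_inj <- e]]]] := H r rq; exists s.
apply: (f_ex_intro (x := h)); apply/f_and; split=> //; apply/f_and; split.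
  apply/f_all_check => [x x' q e|a]; first by fcongr.
  apply/f_all_check => [x x' q e|b]; first by fcongr.
  apply/f_all => y; apply/f_imp => q qp /f_and[/app_h e1 /app_h e2].
  have ab : a = b := edot_inj (feq_trans (feqC e1) e2).
  by rewrite ab; exact: feqxx.
apply/f_all_check => [x x' q e|a].
  by fcongr.
apply/f_all_check => [x x' q e|b]; first by fcongr.
apply/f_all => x; apply/f_all => y; apply/f_imp => q qp /f_and[/app_h e1 /app_h e2].
apply: ((overlap_eq (2 * io) Bname e1 e2 (srefl q)).2).
(* The two indices may coincide; any other index then completes the pair. *)
have [c ac bc] : exists2 c, (a : L) != c & (b : L) \in [:: (a : L); c].
  have [ab|ab] := eqVneq (a : L) b; last by exists b => //; rewrite !inE eqxx orbT.
  rewrite -ab; have [aa0|aa0] := eqVneq (a : L) a0; last by exists a0 => //; rewrite inE eqxx.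
  by exists b0; [rewrite aa0 | rewrite inE eqxx].
by have := overlap_zdot (p := q) ac (mem_head _ _) bc.
Qed.

End GenericSet.

(** * No perfect set of translates *)

Lemma nat_least (Q : nat -> Prop) : (exists n, Q n) ->
  exists n, Q n /\ forall k, (k < n)%N -> ~ Q k.
Proof.
case=> n; elim/ltn_ind: n => n IH Qn.
case: (pselect (exists2 k, (k < n)%N & Q k)) => [[k kn Qk]|H]; first exact: IH Qk.
by exists n; split=> // k kn Qk; apply: H; exists k.
Qed.

Lemma nat_bound K (Q : nat -> nat -> Prop) :
  (forall i n n', (n <= n')%N -> Q i n -> Q i n') ->
  (forall i, (i < K)%N -> exists n, Q i n) ->
  exists n, forall i, (i < K)%N -> Q i n.
Proof.
move=> Qm; elim: K => [|K IH] H; first by exists 0.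
have [|n Hn] := IH; first by move=> i iK; apply: H; apply: ltnW.
have [n' Hn'] := H K (ltnSn K); exists (maxn n n') => i.
rewrite ltnS leq_eqVlt => /orP[/eqP ->|iK].
  by apply: Qm Hn'; apply: leq_maxr.
by apply: Qm (Hn i iK); apply: leq_maxl.
Qed.

Definition extends (s s' : seq bool) := (size s <= size s')%N /\
  forall j, (j < size s)%N -> nth false s' j = nth false s j.

Lemma extends_refl s : extends s s. Proof. by []. Qed.

Lemma extends_trans t s u : extends s t -> extends t u -> extends s u.
Proof.
move=> [H1 H2] [H3 H4]; split=> [|j js]; first exact: leq_trans H3.
by rewrite H4 ?H2 //; apply: leq_trans H1.
Qed.

#[local] Hint Resolve extends_refl : core.

(** * Nodes of a perfect set in the extension *)

Section Perfect.
Variables (P : forcing_notion) (A : name P) (p0 : P).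
Hypothesis A_perfect : forces (is_perfect A) p0.
Implicit Types (p q r : P) (s t : seq bool) (x y : name P).

Local Notation nn := (nat_name P).

Definition along x s p := forall j, (j < size s)%N -> val x j (nth false s j) p.

(** Nodes stand for basic open sets; a name for a point of [A] through [s] is at hand. *)
Definition meets p s := exists x,
  [/\ forces (x ∈ A)%F p, forces (cantor x) p & along x s p].

Lemma along_mono x s p q : q <<= p -> along x s p -> along x s q.
Proof. by move=> qp H j js; apply: val_mono qp (H j js). Qed.

Lemma meets_mono s p q : q <<= p -> meets p s -> meets q s.
Proof.
move=> qp [x [xA Hx Hs]]; exists x; split; try exact: forces_mono qp _.
exact: along_mono Hs.
Qed.

Lemma A_cantor x q : q <<= p0 -> forces (x ∈ A)%F q -> forces (cantor x) q.
Proof.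
move=> qp; have /f_and[/f_and[/f_allin H _] _] := A_perfect; exact: H.
Qed.

Lemma along_dense x n s p : forces (cantor x) p -> along x s p ->
  forall q, q <<= p -> exists r, r <<= q /\ exists s',
    [/\ extends s s', (n <= size s')%N & along x s' r].
Proof.
move=> Hx Hs q qp; pose N := maxn n (size s).
have [||r [rq Hr]] := @finite_dense P N (fun j r => exists b, val x j b r) q.
- by move=> j u r ru [b Hb]; exists b; apply: val_mono Hb.
- move=> j _ r rq. have H := cantor_dec j Hx (strans rq qp). exact: H.
have Hf j : exists b, (j < N)%N -> val x j b r.
  by case: (ltnP j N) => [/Hr[b Hb]|_]; [exists b|exists false].
have [f Hf'] := choice Hf.
have ns : (size s <= N)%N by apply: leq_maxr.
have Hal : along x (mkseq f N) r.
  by move=> j; rewrite size_mkseq => jN; rewrite nth_mkseq //; apply: Hf'.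
exists r; split=> //; exists (mkseq f N); split=> //.
  split=> [|j js]; first by rewrite size_mkseq.
  have rp := strans rq qp.
  apply: (cantor_excl (forces_mono rp Hx) _ (val_mono rp (Hs j js))).
  by apply: Hal; rewrite size_mkseq; apply: leq_trans ns.
by rewrite size_mkseq leq_maxl.
Qed.

Lemma meets_nil q : q <<= p0 -> exists r, r <<= q /\ meets r [::].
Proof.
move=> qp; have /f_and[_ /f_and[/f_ex H _]] := A_perfect.
have [r [rq [x xA]]] := H q qp; exists r; split=> //; exists x; split=> //.
exact: A_cantor (strans rq qp) xA.
Qed.

Lemma meets_extend n q s : meets q s ->
  exists r, r <<= q /\ exists s', [/\ extends s s', (n <= size s')%N & meets r s'].
Proof.
move=> [x [xA Hx Hs]]; have [r [rq [s' [e ns Hs']]]] := along_dense n Hx Hs (srefl q).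
exists r; split=> //; exists s'; split=> //; exists x; split=> //; exact: forces_mono rq _.
Qed.

Definition differ s t := exists j,
  [/\ (j < size s)%N, (j < size t)%N & nth false s j != nth false t j].

Lemma meets_split q s : q <<= p0 -> meets q s -> exists r, r <<= q /\ exists s' s'',
  [/\ extends s s', extends s s'', differ s' s'', meets r s' & meets r s''].
Proof.
move=> qp [x [xA Hx Hs]].
have /f_and[_ /f_and[_ /f_allin H]] := A_perfect.
have /f_allin/(_ _ _ (srefl q) (nat_name_omega (size s) q))/f_exin H1 := H x q qp xA.
have [r [rq [y [yA /f_and[yx Hag]]]]] := H1 q (srefl q).
have Hy := A_cantor (strans rq qp) yA.
have [r1 [r1r [n [b [vy vx]]]]] := cantor_neq Hy (forces_mono rq Hx) yx (srefl r).
have r1q := strans r1r rq.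
have Hys : along y s r1.
  move=> j js; apply: (agree_val (forces_mono r1r Hag) js); exact: val_mono r1q (Hs j js).
have [r2 [r21 [s' [e1 n1 Hs']]]] :=
  along_dense n.+1 (forces_mono r1q Hx) (along_mono r1q Hs) (srefl r1).
have [r3 [r32 [s'' [e2 n2 Hs'']]]] :=
  along_dense n.+1 (forces_mono r1r Hy) Hys r21.
have r31 := strans r32 r21; have r3q := strans r31 r1q; have r3r := strans r31 r1r.
exists r3; split=> //; exists s', s''; split=> //.
- exists n; split=> //.
  rewrite (cantor_excl (forces_mono r3q Hx) (val_mono r32 (Hs' n n1)) (val_mono r31 vx)).
  rewrite (cantor_excl (forces_mono r3r Hy) (Hs'' n n2) (val_mono r31 vy)).
  by case: (b).
- by exists x; split; [exact: forces_mono xA|exact: forces_mono Hx|exact: along_mono Hs'].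
- by exists y; split; [exact: forces_mono yA|exact: forces_mono Hy|].
Qed.

Lemma in_closed x q : q <<= p0 -> forces (cantor x) q ->
  (forall k r, r <<= q -> exists r', r' <<= r /\ exists s,
     [/\ (k <= size s)%N, meets r' s & along x s r']) ->
  forces (x ∈ A)%F q.
Proof.
move=> qp Hx H; apply: contrapT => /not_forces[r [rq nx]].
have /f_and[/f_and[_ /f_all/(_ x)/f_imp Hcl] _] := A_perfect.
have rp := strans rq qp.
have /f_exin H1 : forces (∃ n ∈ omega_name P, ∀ y, cantor y /\ agree x y n -> ~ y ∈ A)%F r.
  by apply: Hcl => //; apply/f_and; split=> //; apply: forces_mono Hx.
have [r1 [r1r [u [/mem_omega_name Hu Hy]]]] := H1 r (srefl r).
have [r2 [r21 [k e]]] := Hu r1 (srefl r1).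
have r2q := strans r21 (strans r1r rq).
have [r3 [r32 [s [ks [y [yA yc ys]] xs]]]] := H k r2 r2q.
have r31 := strans r32 r21.
have /f_all/(_ y)/f_imp/(_ r3 r31) H2 := Hy.
have Hx3 := forces_mono (strans r32 r2q) Hx.
have : forces (~ y ∈ A)%F r3.
  apply: H2; apply/f_and; split=> //.
  have H3 : forces (agree x y (nn k)) r3.
    apply: agree_intro => // n b r4 nk r43 vx.
    have ns := leq_trans nk ks.
    by rewrite (cantor_excl (forces_mono r43 Hx3) vx (val_mono r43 (xs n ns)));
      exact: val_mono r43 (ys n ns).
  have : fequiv r3 (agree x y u) (agree x y (nn k)).
    by rewrite /agree; have e3 := forces_eq_mono r32 e; fcongr.
  by move=> /(_ r3 (srefl r3)) [_]; apply.
by move/f_not/(_ r3 (srefl r3)).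
Qed.

End Perfect.

Section NoPerfect.
Variables (lambda : wellorder) (io : nat) (lab : seq {classic lambda} -> nat).
Let L : eqType := {classic lambda}.
Variable x0 : L.
Local Notation P := (poset x0 io lab).
Local Notation nn := (nat_name P).
Hypothesis io3 : (3 <= io)%N.

Implicit Types (p q r : P) (n i j k l : nat).

Let dt (p : P) : pre L := sval p.

Variables (A : name P) (p0 : P).
Hypotheses (A_perfect : forces (is_perfect A) p0)
  (A_overlap : forces (∀ x ∈ A, ∀ y ∈ A, overlap_geq (2 * io) (Bname io lab x0) x y)%F p0).

Local Notation meets := (meets A).

Definition linked m r s t := exists a b,
  edge (dt r) (fun j => nth false s j (+) nth false t j) a b /\ col (dt r) a b = m.

(** The two conditions have different roles: [r] fixes the level and supplies the pair of indices,
    while [r'] decides nodes of [A] long enough to reach that level. *)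
Definition stable m q s t := forall r r' s' t', r <<= q -> r' <<= r ->
  extends s s' -> extends t t' -> meets r' s' -> meets r' t' ->
  (len (dt r) <= size s')%N -> (len (dt r) <= size t')%N -> linked m r s' t'.

(** The color [m] fails at the level of some [r'] weaker than [r], a level not below [n]. *)
Definition refuted m n r s t := exists r', [/\ r <<= r', (n <= len (dt r'))%N,
  (len (dt r') <= size s)%N, (len (dt r') <= size t)%N & ~ linked m r' s t].

(* The Baire category argument: were no pair of nodes stable, two points x, y of A
   could be built so that no color links x to y at all levels from some n on,
   whereas the common points of B + x and B + y provide such a color. *)
Section Baire.
Variables (q : P) (s0 t0 : seq bool).
Hypotheses (qp0 : q <<= p0) (ms : meets q s0) (mt : meets q t0) (st0 : differ s0 t0).
Hypothesis no_stable : forall m n r s t, r <<= q -> extends s0 s -> extends t0 t ->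
  meets r s -> meets r t -> exists r' s' t', [/\ r' <<= r, extends s s', extends t t',
    meets r' s' /\ meets r' t' & refuted m n r' s' t'].

Implicit Types (u v : seq bool * seq bool).

(** Stage [e] refutes the color and the level bound coded by [e], so in the limit no color links
    from any level on. *)
Let dec e : nat * nat := odflt (0, 0) (unpickle e).

Let good e u v r := [/\ extends u.1 v.1, extends u.2 v.2, meets r v.1, meets r v.2 &
  refuted (dec e).1 (dec e).2 r v.1 v.2].

Lemma good_mono e u v r r' : r' <<= r -> good e u v r -> good e u v r'.
Proof.
move=> rr [H1 H2 H3 H4 [r1 [h1 h2 h3 h4 h5]]]; split=> //; try exact: meets_mono rr _.
by exists r1; split=> //; exact: strans rr h1.
Qed.

(* The value of [stage e] is decided by a condition: it is the pair of nodes with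
   the least code that refutes the e-th candidate. *)
Fixpoint stage e u r : Prop :=
  if e is e'.+1 then exists v, [/\ stage e' v r, good e' v u r &
    forall w, (pickle w < pickle u)%N -> forall r', r' <<= r -> ~ good e' v w r']
  else u = (s0, t0).

Lemma stage_mono e u r r' : r' <<= r -> stage e u r -> stage e u r'.
Proof.
elim: e u => //= e IH u rr [v [H1 H2 H3]]; exists v; split.
- exact: IH.
- exact: good_mono H2.
- by move=> w wu r1 r1r; apply: (H3 w wu); exact: strans r1r rr.
Qed.

Lemma stage_uniq e u v r : stage e u r -> stage e v r -> u = v.
Proof.
elim: e u v => [|e IH] u v /=; first by move=> -> ->.
move=> [w [H1 H2 H3]] [w' [H4 H5 H6]]; have ww := IH _ _ H1 H4; subst w'.
apply: (pcan_inj pickleK); case: (ltngtP (pickle u) (pickle v)) => // h.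
  by case: (H6 u h r).
by case: (H3 v h r).
Qed.

Lemma stage_inv e u r : r <<= q -> stage e u r ->
  [/\ extends s0 u.1, extends t0 u.2, meets r u.1 & meets r u.2].
Proof.
elim: e u => [|e IH] u rq /=; first by move=> ->; split=> //; exact: meets_mono rq _.
move=> [v [/(IH _ rq)[H1 H2 _ _] [H3 H4 H5 H6 _] _]]; split=> //.
  exact: extends_trans H3.
exact: extends_trans H4.
Qed.

Lemma stage_dense e r : r <<= q -> exists r', r' <<= r /\ exists u, stage e u r'.
Proof.
elim: e r => [|e IH] r rq; first by exists r; split=> //; exists (s0, t0).
have [r1 [r1r [v Hv]]] := IH r rq; have r1q := strans r1r rq.
have [H1 H2 H3 H4] := stage_inv r1q Hv.
have [r2 [s [t [r21 H5 H6 [H7 H8] H9]]]] := no_stable (dec e).1 (dec e).2 r1q H1 H2 H3 H4.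
have [|n [[u [<- [r3 [r31 gu]]]] Hmin]] :=
    @nat_least (fun n => exists u, pickle u = n /\ exists r', r' <<= r1 /\ good e v u r').
  by exists (pickle (s, t)), (s, t); split=> //; exists r2.
exists r3; split; first exact: strans r1r.
exists u, v; split=> //; first exact: stage_mono Hv.
move=> w wu r' r'r gw; apply: (Hmin _ wu); exists w; split=> //; exists r'.
by split=> //; exact: strans r'r r31.
Qed.

Lemma stage_extends e e' u v r : (e <= e')%N -> stage e u r -> stage e' v r ->
  extends u.1 v.1 /\ extends u.2 v.2.
Proof.
move=> /subnK <-; elim: (e' - e)%N v => [|k IH] v Hu.
  by rewrite add0n => /(stage_uniq Hu) ->.
rewrite addSn /= => -[w [Hw [H1 H2 _ _ _] _]]; have [H3 H4] := IH w Hu Hw.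
by split; [apply: extends_trans H1|apply: extends_trans H2].
Qed.

(** Refuting at a level not below [e] requires nodes of at least that length, so the stages make the
    nodes arbitrarily long without further steps. *)
Lemma stage_size n e u r : stage (pickle (n, e)).+1 u r ->
  (e <= size u.1)%N /\ (e <= size u.2)%N.
Proof.
move=> /= [v [_ [_ _ _ _ [r' [_ H1 H2 H3 _]]] _]].
move: H1; rewrite /dec pickleK /= => H1.
by rewrite (leq_trans H1 H2) (leq_trans H1 H3).
Qed.

Let limit (pr : seq bool * seq bool -> seq bool) : name P :=
  real_name (fun n b r => exists e u, [/\ stage e u r, (n < size (pr u))%N &
    b = nth false (pr u) n]).

Section Limit.
Variable pr : seq bool * seq bool -> seq bool.
Hypothesis pr_extends : forall u v, extends u.1 v.1 -> extends u.2 v.2 ->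
  extends (pr u) (pr v).
Hypothesis pr_size : forall n u, (n <= size u.1)%N -> (n <= size u.2)%N ->
  (n <= size (pr u))%N.
Hypothesis pr_meets : forall r u, meets r u.1 -> meets r u.2 -> meets r (pr u).

Lemma limit_along e u r : stage e u r -> along (limit pr) (pr u) r.
Proof. by move=> H j js; apply: val_real_intro; exists e, u. Qed.

Lemma limit_dense n r : r <<= q -> exists r', r' <<= r /\ exists e u,
  stage e u r' /\ (n <= size (pr u))%N.
Proof.
move=> rq; have [r' [rr [u Hu]]] := stage_dense (pickle (0, n)).+1 rq.
have [H1 H2] := stage_size Hu.
by exists r'; split=> //; exists (pickle (0, n)).+1, u; split=> //; apply: pr_size.
Qed.

Lemma limit_cantor : forces (cantor (limit pr)) q.
Proof.
apply: cantor_real.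
  move=> n b b' r c c' _ rc rc' [e [u [/(stage_mono rc) Hu nu ->]]].
  move=> [e' [v [/(stage_mono rc') Hv nv ->]]].
  case: (leqP e e') => [ee|/ltnW ee].
    have [/pr_extends H1 /H1 [_ H2]] := stage_extends ee Hu Hv.
    by rewrite H2.
  have [/pr_extends H1 /H1 [_ H2]] := stage_extends ee Hv Hu.
  by rewrite H2.
move=> n r rq; have [r' [rr [e [u [Hu nu]]]]] := limit_dense n.+1 rq.
by exists r'; split=> //; exists (nth false (pr u) n), r'; split=> //; exists e, u.
Qed.

Lemma limit_in : forces (limit pr ∈ A)%F q.
Proof.
apply: (in_closed A_perfect qp0 limit_cantor) => k r rq.
have [r' [rr [e [u [Hu nu]]]]] := limit_dense k rq.
exists r'; split=> //; exists (pr u); split=> //; last exact: limit_along Hu.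
by have [_ _ ? ?] := stage_inv (strans rr rq) Hu; apply: pr_meets.
Qed.

End Limit.

Lemma stable_contradiction : False.
Proof.
pose x := limit fst; pose y := limit snd.
have Hx : forces (cantor x) q by apply: limit_cantor => // u v [].
have Hy : forces (cantor y) q by apply: limit_cantor => // u v _ [].
have xA : forces (x ∈ A)%F q by apply: limit_in.
have yA : forces (y ∈ A)%F q by apply: limit_in.
move: A_overlap => /f_allin H1; have /f_allin H2 := H1 x q qp0 xA.
have {H1 H2} /card_geq_elim Hov := H2 y q (srefl q) yA.
have [r [rq [z [Hz nz]]]] := Hov q (srefl q).
have Hxr := forces_mono rq Hx; have Hyr := forces_mono rq Hy.
pose K := (2 * io)%N.
have K4 : (4 < K)%N by apply: (@leq_trans (2 * 3)); rewrite ?leq_mul2l.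
pose D1 k (r1 : P) := exists (b b' : name P) m m',
  [/\ forces (is_sum (z k) b x) r1, forces (is_sum (z k) b' y) r1,
   forces (b ∈ tree_name io lab x0 m)%F r1 & forces (b' ∈ tree_name io lab x0 m')%F r1].
have [||r1 [r1r HD1]] := @finite_dense P K D1 r.
- move=> k u v vu [b [b' [m [m' [h1 h2 h3 h4]]]]]; exists b, b', m, m'.
  by split; apply: forces_mono vu _.
- move=> k kK u ur; have /f_and[/f_exin Hb /f_exin Hb'] := Hz k kK.
  have [u1 [u1u [b [/mem_B bB hb]]]] := Hb u ur.
  have [u2 [u21 [b' [/mem_B b'B hb']]]] := Hb' u1 (strans u1u ur).
  have [u3 [u32 [m hm]]] := bB u2 u21.
  have [u4 [u43 [m' hm']]] := b'B u3 u32.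
  have u42 := strans u43 u32; have u41 := strans u42 u21.
  exists u4; split; first exact: strans u1u.
  by exists b, b', m, m'; split=> //; [exact: forces_mono hb|exact: forces_mono hb'|
    exact: forces_mono hm].
have r1q := strans r1r rq.
have Hc (i : nat) : exists w : name P * name P * nat * nat, (i < K)%N ->
   [/\ forces (is_sum (z i) w.1.1.1 x) r1, forces (is_sum (z i) w.1.1.2 y) r1,
   forces (w.1.1.1 ∈ tree_name io lab x0 w.1.2)%F r1 & forces (w.1.1.2 ∈ tree_name io lab x0 w.2)%F r1].
  case: (ltnP i K) => [/HD1[b [b' [m [m' h]]]]|_]; first by exists (b, b', m, m').
  by exists (x, x, 0, 0).
have {HD1} [w Hw] := choice Hc.
have zc k : (k < K)%N -> forces (cantor (z k)) r1.
  by move=> /Hw[/f_and[]].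
have bc k : (k < K)%N -> forces (cantor (w k).1.1.1) r1.
  by move=> /Hw[_ _ /mem_tree[]].
have b'c k : (k < K)%N -> forces (cantor (w k).1.1.2) r1.
  by move=> /Hw[_ _ _ /mem_tree[]].
pose D2 k (r1 : P) := forall k', (k' < K)%N -> k <> k' ->
  exists n b, val (z k) n b r1 /\ val (z k') n (~~ b) r1.
have [||r2 [r21 HD2]] := @finite_dense P K D2 r1.
- move=> k u v vu H k' k'K kk'; have [n [b [h1 h2]]] := H k' k'K kk'.
  by exists n, b; split; apply: val_mono vu _.
- move=> k kK u ur1.
  have [||u' [u'u Hu']] := @finite_dense P K (fun k' (v : P) => k <> k' ->
      exists n b, val (z k) n b v /\ val (z k') n (~~ b) v) u.
  + move=> k' v v' vv H kk'; have [n [b [h1 h2]]] := H kk'.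
    by exists n, b; split; apply: val_mono vv _.
  + move=> k' k'K v vu; case: (eqVneq k k') => [<-|/eqP kk'].
      by exists v; split.
    have vr1 := strans vu ur1.
    have [v' [v'v h]] := cantor_neq (forces_mono ur1 (zc k kK)) (forces_mono ur1 (zc k' k'K))
      (forces_mono (strans ur1 r1r) (nz k k' kK k'K kk')) vu.
    by exists v'.
  by exists u'.
have r2q := strans r21 r1q.
have [j0 [j0s j0t dj0]] := st0.
have [N1 HN1] : exists n, forall k, (k < K)%N -> (forall k', (k' < K)%N -> k <> k' ->
    exists2 j, (j < n)%N & exists b, val (z k) j b r2 /\ val (z k') j (~~ b) r2).
  apply: (@nat_bound K (fun k n => forall k', (k' < K)%N -> k <> k' ->
    exists2 j, (j < n)%N & exists b, val (z k) j b r2 /\ val (z k') j (~~ b) r2)).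
    move=> k n n' nn' H k' k'K kk'; have [j jn hj] := H k' k'K kk'.
    by exists j => //; apply: leq_trans nn'.
  move=> k kK; apply: (@nat_bound K (fun k' n => k <> k' ->
    exists2 j, (j < n)%N & exists b, val (z k) j b r2 /\ val (z k') j (~~ b) r2)).
    move=> k' n n' nn' H kk'; have [j jn hj] := H kk'.
    by exists j => //; apply: leq_trans nn'.
  move=> k' k'K; case: (eqVneq k k') => [->|/eqP kk']; first by exists 0.
  by have [n [b h]] := HD2 k kK k' k'K kk'; exists n.+1 => _; exists n => //; exists b.
have [N2 HN2] : exists n, forall k, (k < K)%N -> ((w k).1.2 < n /\ (w k).2 < n)%N.
  apply: (@nat_bound K (fun k n => ((w k).1.2 < n /\ (w k).2 < n)%N)).
    by move=> k n n' nn' [h1 h2]; split; [apply: leq_trans h1 _|apply: leq_trans h2 _].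
  by move=> k _; exists (maxn (w k).1.2 (w k).2).+1; rewrite !ltnS leq_maxl leq_maxr.
(* From level [N] on, the points [z k] are told apart, the indices of the trees involved are below
   the level, as [branch] requires, and x and y differ. *)
pose N := maxn (maxn N1 N2) j0.+1.
have N1N : (N1 <= N)%N by rewrite /N !leq_max leqnn.
have N2N : (N2 <= N)%N by rewrite /N !leq_max leqnn orbT.
have j0N : (j0 < N)%N by rewrite /N !leq_max leqnn !orbT.
(* [common_difference] will yield the color attached to the first summand of [z 0], so the stage
   that refutes this color from [N] on is consulted. *)
have [r3 [r32 [u Hu]]] := stage_dense (pickle ((w 0).1.2, N)).+1 r2q.
have r31 := strans r32 r21; have r3q := strans r32 r2q.
have xu := limit_along (pr := fst) Hu; have yu := limit_along (pr := snd) Hu.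
have [e1 e2 _ _] := stage_inv r3q Hu.
have /= [v [_ [_ _ _ _ Href] _]] := Hu.
move: Href; rewrite /dec pickleK /= => -[rr [r3r Nrr lu1 lu2 nl]]; apply: nl.
set M := len (dt rr) in Nrr lu1 lu2.
have [||r4 [r43 Hr4]] := @finite_dense P K (fun k (t : P) => forall j, (j < M)%N ->
    (exists b, val (w k).1.1.1 j b t) /\ exists b, val (w k).1.1.2 j b t) r3.
- move=> k a b ba H j jM; have [[b1 h1] [b2 h2]] := H j jM.
  by split; [exists b1|exists b2]; exact: val_mono ba _.
- move=> k kK a ar3.
  apply: (@finite_dense P M (fun j (t : P) => (exists b, val (w k).1.1.1 j b t) /\
    exists b, val (w k).1.1.2 j b t) a).
    move=> j c d dc [[b1 h1] [b2 h2]].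
    by split; [exists b1|exists b2]; exact: val_mono dc _.
  move=> j jM c ca; have cr1 := strans (strans ca ar3) r31.
  have [d [dc [b1 h1]]] := cantor_dec j (bc k kK) cr1.
  have [d' [d'd [b2 h2]]] := cantor_dec j (b'c k kK) (strans dc cr1).
  exists d'; split; first exact: strans dc.
  by split; [exists b1; exact: val_mono h1|exists b2].
have r41 := strans r43 r31; have r4q := strans r43 r3q; have r42 := strans r43 r32.
have Hbv (k : nat) : exists f : nat -> bool * bool, (k < K)%N -> forall j, (j < M)%N ->
    val (w k).1.1.1 j (f j).1 r4 /\ val (w k).1.1.2 j (f j).2 r4.
  case: (ltnP k K) => [kK|_]; last by exists (fun=> (false, false)).
  have Hj (j : nat) : exists b : bool * bool, (j < M)%N ->
      val (w k).1.1.1 j b.1 r4 /\ val (w k).1.1.2 j b.2 r4.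
    case: (ltnP j M) => [jM|_]; last by exists (false, false).
    by have [[b1 h1] [b2 h2]] := Hr4 k kK j jM; exists (b1, b2).
  by have [f Hf] := choice Hj; exists f.
have {Hbv} [bv Hbv] := choice Hbv.
pose xv j := nth false u.1 j; pose yv j := nth false u.2 j.
have xval j : (j < M)%N -> val x j (xv j) r4.
  by move=> jM; apply: (val_mono r43); apply: xu; apply: leq_trans lu1.
have yval j : (j < M)%N -> val y j (yv j) r4.
  by move=> jM; apply: (val_mono r43); apply: yu; apply: leq_trans lu2.
have zval k j : (k < K)%N -> (j < M)%N -> val (z k) j ((bv k j).1 (+) xv j) r4.
  move=> kK jM; have [h1 _ _ _] := Hw k kK.
  apply: (is_sum_val (forces_mono r41 (bc k kK)) (forces_mono r4q Hx)
    (forces_mono r41 h1) _ (xval j jM)).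
  exact: (Hbv k kK j jM).1.
have bvE k j : (k < K)%N -> (j < M)%N -> (bv k j).2 = (bv k j).1 (+) (xv j (+) yv j).
  move=> kK jM; have [_ h1 _ _] := Hw k kK.
  have zval' : val (z k) j ((bv k j).2 (+) yv j) r4.
    apply: (is_sum_val (forces_mono r41 (b'c k kK)) (forces_mono r4q Hy)
      (forces_mono r41 h1) _ (yval j jM)).
    exact: (Hbv k kK j jM).2.
  have := cantor_excl (forces_mono r41 (zc k kK)) (zval k j kK jM) zval'.
  by case: (bv k j).1; case: (bv k j).2; case: (xv j); case: (yv j).
have r4rr := strans r43 r3r.
have [||||a [b [Hab cab]]] := @common_difference L x0 io lab (dt rr) (svalP rr) K
  (fun k j => (bv k j).1) (fun k => (w k).1.2) (fun k => (w k).2)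
  (fun j => xv j (+) yv j) K4; last by exists a, b.
- move=> k k' kK k'K H; apply: contrapT => kk'.
  have [j jN1 [b [h1 h2]]] := HN1 k kK k' k'K kk'.
  have jM := leq_trans jN1 (leq_trans N1N Nrr).
  have E1 := cantor_excl (forces_mono r41 (zc k kK)) (zval k j kK jM) (val_mono r42 h1).
  have E2 := cantor_excl (forces_mono r41 (zc k' k'K)) (zval k' j k'K jM) (val_mono r42 h2).
  by move: E2; rewrite -H // E1; case: (b).
- move=> k kK; have [_ _ /mem_tree[_ Hb] _] := Hw k kK.
  apply: (Hb rr r4) => //; first by have [h _] := HN2 k kK; exact: leq_trans h (leq_trans N2N Nrr).
  by move=> j jM; exact: (Hbv k kK j jM).1.
- move=> k kK; have [_ _ _ /mem_tree[_ Hb]] := Hw k kK.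
  apply: (Hb rr r4) => //; first by have [_ h] := HN2 k kK; exact: leq_trans h (leq_trans N2N Nrr).
  by move=> j jM; rewrite -bvE //; exact: (Hbv k kK j jM).2.
exists j0; first exact: leq_trans j0N Nrr.
rewrite /xv /yv e1.2 // e2.2 //.
by case: (nth _ s0 _) (nth _ t0 _) dj0 => -[].
Qed.

End Baire.

Lemma linked_sym m r s t : linked m r s t -> linked m r t s.
Proof.
move=> [a [b [[h e] c]]]; exists a, b; split=> //; split=> // j jn.
by rewrite addbC e.
Qed.

Lemma stable_sym m q s t : stable m q s t -> stable m q t s.
Proof.
move=> H r r' s' t' h1 h2 h3 h4 h5 h6 h7 h8; apply: linked_sym.
exact: (H r r').
Qed.

Lemma stable_mono m q q' s t s' t' : q' <<= q -> extends s s' -> extends t t' ->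
  stable m q s t -> stable m q' s' t'.
Proof.
move=> qq es et H r r' u v h1 h2 h3 h4.
apply: (H r r') => //; [exact: strans h1 qq|exact: extends_trans h3|
  exact: extends_trans h4].
Qed.

Lemma baire q s t : q <<= p0 -> meets q s -> meets q t -> differ s t ->
  exists r s' t' m, [/\ r <<= q, extends s s', extends t t', meets r s' /\ meets r t' &
    stable m r s' t'].
Proof.
move=> qp ms mt st; apply: contrapT => H.
apply: (stable_contradiction qp ms mt st) => m n r s' t' rq es et mrs mrt.
(* With length at least [n] from the start, any later failure occurs at a level not below [n]. *)
have [r1 [r1r nr1 _]] := @dense_supp lambda io lab x0 r n [::].
apply: contrapT => H'; apply: H; exists r1, s', t', m; split=> //.
- exact: strans r1r rq.
- by split; apply: meets_mono r1r _.
move=> r2 r3 s2 t2 r21 r32 es2 et2 m3s m3t ls lt'; apply: contrapT => nl.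
apply: H'; exists r3, s2, t2; split=> //; first exact: strans (strans r32 r21) r1r.
by exists r2; split=> //; apply: leq_trans nr1 _; exact: (le_len r21).
Qed.

Definition clique q k (s : nat -> seq bool) (m : nat -> nat -> nat) :=
  [/\ q <<= p0, forall i, (i < k)%N -> meets q (s i) &
   forall i j, (i < k)%N -> (j < k)%N -> i != j -> stable (m i j) q (s i) (s j)].

(* The node number k of an extended clique is split off the node number k0. *)
Let twin k k0 i := if i == k then k0 else i.

(** Stability passes to longer nodes with the same color, so only the two halves of the split node
    need the Baire argument. *)
Lemma clique_extend q k (s : nat -> seq bool) (m : nat -> nat -> nat) k0 :
  clique q k s m -> (k0 < k)%N ->
  exists r s' m', [/\ r <<= q, clique r k.+1 s' m',
    forall i, (i <= k)%N -> extends (s (twin k k0 i)) (s' i) &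
    forall i j, (i <= k)%N -> (j <= k)%N -> twin k k0 i != twin k k0 j ->
      m' i j = m (twin k k0 i) (twin k k0 j)].
Proof.
move=> [qp Hm Hst] k0k.
have [r1 [r1q [u [v [eu ev duv mu mv]]]]] := meets_split A_perfect qp (Hm k0 k0k).
have [r [u' [v' [c [rr1 eu' ev' [mu' mv'] st]]]]] := baire (strans r1q qp) mu mv duv.
have rq := strans rr1 r1q.
pose s' i := if i == k then v' else if i == k0 then u' else s i.
pose m' i j := if twin k k0 i == twin k k0 j then c else m (twin k k0 i) (twin k k0 j).
have kk0 : k0 != k by rewrite neq_ltn k0k.
have tk i : (i <= k)%N -> (twin k k0 i < k)%N.
  by rewrite /twin => ik; case: eqVneq => // ki; rewrite ltn_neqAle ki ik.
have Hext i : extends (s (twin k k0 i)) (s' i).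
  rewrite /s' /twin; case: eqP => _; first exact: extends_trans ev ev'.
  by case: eqP => [->|_] //; apply: extends_trans eu eu'.
exists r, s', m'; split=> //.
- split.
  + exact: strans rq qp.
  + move=> i; rewrite ltnS /s' => ik; case: eqVneq => // ki; case: eqP => // _.
    by apply: meets_mono rq (Hm i _); rewrite ltn_neqAle ki ik.
  move=> i j; rewrite !ltnS => ik jk ij; rewrite /m'.
  case: (eqVneq (twin k k0 i) (twin k k0 j)) => tij; last first.
    by apply: (stable_mono rq (Hext i) (Hext j)); apply: Hst => //; apply: tk.
  move: tij; rewrite /twin /s'; case: (eqVneq i k) ij => [-> ij|ik'].
    by rewrite eq_sym (negPf ij) => <-; rewrite eqxx; apply: stable_sym.
  case: (eqVneq j k) => [-> ij ->|_ /eqP ij //]; by rewrite eqxx.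
- by move=> i j ik jk tij; rewrite /m' (negPf tij).
Qed.

Lemma clique_exists k : exists q s m, clique q k.+1 s m.
Proof.
elim: k => [|k [q [s [m H]]]].
  have [r [rp mr]] := meets_nil A_perfect (srefl p0).
  exists r, (fun=> [::]), (fun _ _ => 0); split=> // i j.
  by rewrite !ltnS !leqn0 => /eqP -> /eqP ->.
have [r [s' [m' [_ H' _ _]]]] := clique_extend H (ltn0Sn k).
by exists r, s', m'.
Qed.

(** Below [l] the nodes are one common translate of the reals eta indexed by [w], and [l] lies above
    the colors of the clique, as [wfS] requires. *)
Definition realized q k (s : nat -> seq bool) (m : nat -> nat -> nat) l (w : seq L) :=
  [/\ clique q k s m, size w = k, uniq w,
  {subset w <= supp (dt q)} &
  [/\ (l <= len (dt q))%N, forall i, (i < k)%N -> (l <= size (s i))%N,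
   exists e : nat -> bool, forall i j, (i < k)%N -> (j < l)%N ->
     eta (dt q) (nth x0 w i) j = nth false (s i) j (+) e j &
   forall i j, (i < k)%N -> (j < k)%N -> i != j ->
     col (dt q) (nth x0 w i) (nth x0 w j) = m i j /\ (m i j < l)%N]].

(** A condition [r1] is fixed and all nodes are then lengthened past its length, so that all pairs
    are linked at one level and [star] applies there. *)
Lemma clique_realized l0 q k (s : nat -> seq bool) (m : nat -> nat -> nat) :
  clique q k s m -> (4 < k)%N ->
  exists r s' l w, [/\ r <<= q, (l0 <= l)%N, forall i, (i < k)%N -> extends (s i) (s' i) &
    realized r k s' m l w].
Proof.
move=> [qp Hm Hst] k4.
have [l1 Hl1] : exists l, forall i, (i < k)%N -> forall j, (j < k)%N -> (m i j < l)%N.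
  apply: (@nat_bound k (fun i l => forall j, (j < k)%N -> (m i j < l)%N)).
    by move=> i n n' nn' H j jk; apply: leq_trans (H j jk) nn'.
  move=> i _; apply: (@nat_bound k (fun j l => (m i j < l)%N)).
    by move=> j n n' nn' H; apply: leq_trans H nn'.
  by move=> j _; exists (m i j).+1.
pose l := maxn l0 l1.
have Hl i j : (i < k)%N -> (j < k)%N -> (m i j < l)%N.
  by move=> ik jk; apply: leq_trans (Hl1 i ik j jk) _; apply: leq_maxr.
have [r1 [r1q lr1 _]] := @dense_supp lambda io lab x0 q l [::].
have [||r [rr1 Hr]] := @finite_dense P k (fun i r => exists s',
   [/\ extends (s i) s', (len (dt r1) <= size s')%N & meets r s']) r1.
- by move=> i p p' pp [s' [h1 h2 h3]]; exists s'; split=> //; apply: meets_mono h3.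
- move=> i ik p pr1; apply: meets_extend.
  exact: meets_mono (strans pr1 r1q) (Hm i ik).
have Hs (i : nat) : exists s', (i < k)%N ->
    [/\ extends (s i) s', (len (dt r1) <= size s')%N & meets r s'].
  by case: (ltnP i k) => [/Hr[s' h]|_]; [exists s'|exists [::]].
have [s' Hs'] := choice Hs.
have rq := strans rr1 r1q.
have lk i j : (i < k)%N -> (j < k)%N -> i != j -> linked (m i j) r1 (s' i) (s' j).
  move=> ik jk ij; have [h1 h2 h3] := Hs' i ik; have [h4 h5 h6] := Hs' j jk.
  exact: (Hst i j ik jk ij r1 r).
have [_ wE _ _] := svalP r1.
have [|al [e Hal]] := @star L x0 io lab (dt r1) (svalP r1) k
    (fun i j => nth false (s' i) j) k4.
  by move=> i j ik jk ij; have [a [b [h _]]] := lk i j ik jk ij; exists a, b.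
have al_inj i j : (i < k)%N -> (j < k)%N -> i != j -> al i != al j.
  move=> ik jk ij; apply/eqP => aij; have [a [b [[[au bu ab] E] _]]] := lk i j ik jk ij.
  have [t [tn Ht _]] := wE a au.
  have := E t tn; rewrite (Hal i ik).2 // (Hal j jk).2 // aij addbb.
  by rewrite [eta _ a _]Ht // [eta _ b _]Ht // eqxx eq_sym (negPf ab).
exists r, s', l, (mkseq al k); split=> //; first exact: leq_maxl.
  by move=> i /Hs'[].
split=> //.
- split; first exact: strans rq qp.
  + by move=> i /Hs'[].
  move=> i j ik jk ij; apply: (stable_mono rq _ _ (Hst i j ik jk ij)).
    by have [] := Hs' i ik.
  by have [] := Hs' j jk.
- by rewrite size_mkseq.
- rewrite map_inj_in_uniq ?iota_uniq // => i j; rewrite !mem_iota /= !add0n => ik jk.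
  by case: (eqVneq i j) => [//|/(al_inj i j ik jk)/negP H] /eqP.
- move=> a /mapP[i]; rewrite mem_iota /= add0n => ik ->.
  by apply: (le_supp rr1); exact: (Hal i ik).1.
split.
- exact: leq_trans lr1 (le_len rr1).
- by move=> i /Hs'[_ h _]; apply: leq_trans lr1 h.
- exists e => i j ik jl; have jn := leq_trans jl lr1.
  rewrite nth_mkseq // [LHS](le_eta rr1 (Hal i ik).1 jn) (Hal i ik).2 //.
  by rewrite addbC addbA addbb.
move=> i j ik jk ij; split; last exact: Hl.
rewrite !nth_mkseq // [LHS](le_col rr1 (Hal i ik).1 (Hal j jk).1 (al_inj i j ik jk ij)).
have [a [b [Hab <-]]] := lk i j ik jk ij.
(* An edge determines its ends, so the color of the link is that of the pair [al i], [al j]. *)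
have Hij : edge (dt r1) (fun t => nth false (s' i) t (+) nth false (s' j) t) (al i) (al j).
  split; first by split; [exact: (Hal i ik).1|exact: (Hal j jk).1|exact: al_inj].
  move=> t tn; rewrite (Hal i ik).2 // (Hal j jk).2 //.
  by case: (e t); case: (eta _ (al i) t); case: (eta _ (al j) t).
have [[-> ->]|[-> ->]] := edge_uniq (svalP r1) Hij Hab => //.
exact: colC.
Qed.

Variables (pos : seq L -> nat) (Rk : Type) (rk : seq L -> Rk) (lt : Rk -> Rk -> Prop).
Hypotheses (lt_wf : well_founded lt)
  (lab_eq : forall w w', (0 < size w)%N -> size w = size w' -> lab w = lab w' ->
     pos w = pos w' /\ rk w = rk w')
  (lab_step : forall w, (0 < size w)%N -> (pos w < size w)%N /\ forall x, x \notin w ->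
     uniq w -> lab (set_nth x0 w (pos w) x) = lab w -> lt (rk (rcons w x)) (rk w)).

(* Moving the point of w prescribed by its label gives a tuple with the same label,
   so the union of the two has a smaller rank. *)
Lemma no_realized q k (s : nat -> seq bool) (m : nat -> nat -> nat) l w :
  (4 < k)%N -> ~ realized q k s m l w.
Proof.
have [d Hd] : exists d : Rk, d = rk w by exists (rk w).
elim/(well_founded_ind lt_wf): d q k s m l w Hd => d IH q k s m l w Ed k4.
move=> [Hc sw uw wq [lq ls [e He] Hcol]].
have w0 : (0 < size w)%N by rewrite sw (ltn_trans _ k4).
have [posw _] := lab_step w0; have k0k : (pos w < k)%N by rewrite -sw.
set k0 := pos w in posw k0k.
have [r1 [s1 [m1 [r1q Hc1 Hs1 Hm1]]]] := clique_extend Hc k0k.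
have [|r [s2 [l2 [w2 [rr1 ll2 Hs2 Hr]]]]] := clique_realized l Hc1; first exact: ltnW.
have rq := strans rr1 r1q.
have [Hc2 sw2 uw2 w2r [l2r _ [e2 He2] Hcol2]] := Hr.
have lr := leq_trans ll2 l2r.
have wS : wfS x0 lab (dt r) by have [] := svalP r.
have node_eq i j : (i <= k)%N -> (twin k k0 i < k)%N -> (j < l)%N ->
    nth false (s2 i) j = nth false (s (twin k k0 i)) j.
  move=> ik tk jl; have [_ ->] := extends_trans (Hs1 i ik) (Hs2 i ik) => //.
  exact: leq_trans (ls _ tk).
(* For each position of [w], [sg] selects the node extending it or, at [k0], its twin. Below [l] the
   selected indices are the translate of [w] by e2 + e, with the same colors, so [wfS] gives them
   the label of [w]. *)
have relabel (sg : nat -> nat) : (forall i, (i < k)%N -> (sg i <= k)%N) ->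
    (forall i, (i < k)%N -> twin k k0 (sg i) = i) ->
    uniq (mkseq (fun i => nth x0 w2 (sg i)) k) /\
    lab (mkseq (fun i => nth x0 w2 (sg i)) k) = lab w.
  move=> sgk tsg; have sg_inj i j : (i < k)%N -> (j < k)%N -> sg i = sg j -> i = j.
    by move=> ik jk e'; rewrite -(tsg i ik) e' tsg.
  have uv : uniq (mkseq (fun i => nth x0 w2 (sg i)) k).
    rewrite map_inj_in_uniq ?iota_uniq // => i j; rewrite !mem_iota /= !add0n => ik jk.
    move=> /eqP; rewrite nth_uniq ?sw2 ?ltnS ?sgk // => /eqP; exact: sg_inj.
  split=> //; apply: (wS _ _ l (fun j => e2 j (+) e j)) => //.
  - by rewrite size_mkseq.
  - by rewrite size_mkseq (ltn_trans _ k4).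
  - move=> a /mapP[i]; rewrite mem_iota /= add0n => ik ->.
    by apply/w2r/mem_nth; rewrite sw2 ltnS sgk.
  - by move=> a /wq; apply: (le_supp rq).
  - move=> i j; rewrite size_mkseq => ik jl; rewrite nth_mkseq //.
    have iw : nth x0 w i \in supp (dt q) by apply/wq/mem_nth; rewrite sw.
    rewrite [RHS](congr1 (addb^~ _) (le_eta rq iw (leq_trans jl lq))).
    rewrite [LHS]He2 ?ltnS ?sgk //; last exact: leq_trans ll2.
    rewrite node_eq ?tsg ?sgk // [eta _ (nth x0 w i) j]He //.
    by case: (nth _ _ _); case: (e j); case: (e2 j).
  move=> i j; rewrite size_mkseq => ik jk ij; rewrite !nth_mkseq //.
  have sij : sg i != sg j by apply: contra_neq ij; apply: sg_inj.
  have [-> _] := Hcol2 (sg i) (sg j) (sgk i ik) (sgk j jk) sij.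
  rewrite Hm1 ?sgk ?tsg //; have [<- ml] := Hcol i j ik jk ij; split=> //.
  by rewrite [RHS](le_col rq) ?wq ?mem_nth ?sw // nth_uniq ?sw.
(* Without the twin: the first [k] entries of [w2] share label, position and rank with [w]. *)
have [|i ik|uv1 lv1] := relabel id; first by move=> i /ltnW.
  by rewrite /twin ltn_eqF.
pose v := mkseq (fun i => nth x0 w2 i) k; pose x := nth x0 w2 k.
have vx : rcons v x = w2.
  by rewrite /v /x -mkseqS -sw2 mkseq_nth.
have szv : size v = k by rewrite size_mkseq.
have v0 : (0 < size v)%N by rewrite szv -sw.
have [pv rv] := lab_eq v0 (etrans szv (esym sw)) lv1.
(* With the twin: the same tuple after its index at [k0] has moved to [x]. *)
have [|i ik|uv2 lv2] := relabel (fun i => if i == k0 then k else i).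
- by move=> i /ltnW ik; case: ifP.
- by rewrite /twin; case: (eqVneq i k0) => [->|_]; rewrite ?eqxx // ltn_eqF.
have set_v : set_nth x0 v (pos v) x = mkseq (fun i => nth x0 w2 (if i == k0 then k else i)) k.
  rewrite pv -/k0; apply: (@eq_from_nth _ x0).
    by rewrite size_set_nth !size_mkseq; apply/maxn_idPr.
  move=> i; rewrite size_set_nth size_mkseq (maxn_idPr k0k) => ik.
  by rewrite nth_set_nth /= !nth_mkseq //; case: ifP.
have [_ step] := lab_step v0.
apply: (IH (rk w2) _ r k.+1 s2 m1 l2 w2) => //; last exact: ltnW.
rewrite Ed -rv -vx; apply: step => //; last by rewrite set_v lv2.
by move: uw2; rewrite -vx rcons_uniq => /andP[].
Qed.

Lemma no_perfect : False.
Proof.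
have [q [s [m Hc]]] := clique_exists 4.
have [r [s' [l [w [_ _ _ Hr]]]]] := clique_realized 0 Hc isT.
exact: (no_realized (isT : (4 < 5)%N) Hr).
Qed.

End NoPerfect.

(** * Size of the forcing and conclusion *)

Lemma poset_card (lambda : wellorder) (io : nat) (lab : seq {classic lambda} -> nat) x0 :
  is_cardinal lambda -> ~ countable [set: lambda] ->
  [set: poset x0 io lab] #= [set: lambda].
Proof.
move=> Hcard Hunc.
have inf : ~ finite_set [set: lambda] by move=> /finite_set_countable.
apply/card_eqPle; split; apply: embeds_card_le.
  have [h h_inj] := cardinal_seq Hcard inf (nat * seq (seq bool) * seq (seq nat) *
    seq (seq (seq (seq bool))))%type.
  exists (fun p => h (sval p)); split=> // p q _ _ /h_inj; case: p q => [p hp] [q hq] /= e.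
  by subst q; congr exist; apply: Prop_irrelevance.
have Hp (a : lambda) : exists p : poset x0 io lab, supp (sval p) =i [:: (a : {classic lambda})].
  by have [p [_ _ Hs]] := density (weakest (poset x0 io lab)) 0 [:: (a : {classic lambda})]; exists p.
have [f Hf] := choice Hp; exists f; split=> // a b _ _ e.
by have := Hf a a; rewrite e Hf !inE eqxx => /eqP.
Qed.

Lemma B_npots (lambda : wellorder) (io : nat) (lab pos : seq {classic lambda} -> nat) x0
    (Rk : Type) (rk : seq {classic lambda} -> Rk) (lt : Rk -> Rk -> Prop) p :
  (3 <= io)%N -> well_founded lt ->
  (forall w w', (0 < size w)%N -> size w = size w' -> lab w = lab w' ->
     pos w = pos w' /\ rk w = rk w') ->
  (forall w, (0 < size w)%N -> (pos w < size w)%N /\ forall x, x \notin w ->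
     uniq w -> lab (set_nth x0 w (pos w) x) = lab w -> lt (rk (rcons w x)) (rk w)) ->
  forces (is_npots (2 * io) (Bname io lab x0)) p.
Proof.
move=> io3 lt_wf lab_eq lab_step; apply/f_and; split.
  by apply/f_allin => x q _; apply: B_cantor.
apply/f_not => q _ /f_and[_ /f_ex H].
have [r [_ [A /f_and[perfA ovA]]]] := H q (srefl q).
exact: (no_perfect io3 perfA ovA lt_wf lab_eq lab_step).
Qed.

Theorem theorem4p4 (lambda omega1 : wellorder)
  (Hcard : is_cardinal lambda) (Huncountable : ~ countable [set: lambda])
  (Homega1 : is_omega1 omega1) (HNPr : NPr omega1 lambda)
  (iota : nat) (Hiota : (3 <= iota)%N) :
  exists P : forcing_notion,
    ccc P /\
    [set: P] #= [set: lambda] /\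
    Forces P (∃ B, is_Sigma02 B /\ is_npots (2 * iota) B /\
              has_overlapping_translates (2 * iota) lambda B)%F.
Proof.
have [tau [M [tau_countable [delta rkM]]]] := HNPr.
have inf : ~ finite_set [set: lambda] by move=> /finite_set_countable.
have [a [b [_ _ ab]]] := infinite_two inf.
pose x0 : {classic lambda} := a.
have [lab [pos [Rk [rk [lt [lt_wf lab_eq lab_step]]]]]] :=
  rank_labels Homega1.2 tau_countable rkM x0.
exists (poset x0 iota lab); split; first exact: poset_ccc.
split; first exact: poset_card.
move=> p; apply: (f_ex_intro (x := Bname iota lab x0)).
apply/f_and; split; first exact: B_Sigma02.
apply/f_and; split; first exact: B_npots Hiota lt_wf lab_eq lab_step.
apply: overlapping_translates; exists a, b; exact/eqP.
Qed.
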